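(* Let $(X,d,\mu)$ be an unbounded space of homogeneous type with a Borel-semiregular measure $\mu$, and let $\mathscr{D}$ be a Hytönen--Kairema dyadic system on $X$. Let $p(\cdot):X\to[1,\infty]$ be a $\mu$-measurable function satisfying $$1<\operatorname*{ess\,inf}_{x\in X}p(x)\le\operatorname*{ess\,sup}_{x\in X}p(x)<\infty .$$ Then the Hardy--Littlewood maximal operator $M$ is bounded on the variable Lebesgue space $L^{p(\cdot)}(X,d,\mu)$ if and only if there is a constant $C>0$ such that $$\bigg\|\sum_{Q\in\mathcal{Q}}\bigg(\frac{1}{\mu(Q)}\int_Q|f(x)|\,d\mu(x)\bigg)\chi_Q\bigg\|_{p(\cdot)}\le C\,\|f\|_{p(\cdot)}$$ for all families $\mathcal{Q}$ of pairwise disjoint cubes $Q\in\mathscr{D}$ and all $f\in L^{p(\cdot)}(X,d,\mu)$.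
   Context: A space of homogeneous type $(X,d,\mu)$ is a set $X$ with: (i) a quasi-metric $d:X\times X\to[0,\infty)$, i.e. $d(x,y)=0$ iff $x=y$, $d(x,y)=d(y,x)$, and $d(x,z)\le A_0(d(x,y)+d(y,z))$ for all $x,y,z\in X$ with some constant $A_0\ge1$; (ii) a nonnegative complete measure $\mu$ on a $\sigma$-algebra containing the Borel $\sigma$-algebra of the topology $\tau_d$, where $\Omega\in\tau_d$ iff for every $x\in\Omega$ some ball $B(x,r):=\{y\in X: d(x,y)<r\}$, $r>0$, is contained in $\Omega$; (iii) all balls are $\mu$-measurable and there is $A\ge1$ with $0<\mu(B(x,r))\le A\,\mu(B(x,r/2))<\infty$ for all $x\in X$, $r>0$. It is unbounded if $\mu(X)=\infty$. The measure $\mu$ is Borel-semiregular if for every measurable $E\subseteq X$ with $\mu(E)<\infty$ there is a Borel set $B\subseteq X$ with $\mu(E\triangle B)=0$. A Hytönen--Kairema dyadic system on $X$, with parameters $0<\varepsilon,\eta<1$ and $0<r_0\le R_0<\infty$, is a collection $\mathscr{D}=\bigcup_{t=1}^K\mathscr{D}^t$ ($K$ finite), where each $\mathscr{D}^t=\bigcup_{k\in\mathbb{Z}}\mathscr{D}^t_k$ is a countable collection of Borel sets (called dyadic cubes) such that: (a) for each $k$, $X$ is the disjoint union of the cubes in $\mathscr{D}^t_k$; (b) if $k>l$, $Q_1\in\mathscr{D}^t_l$, $Q_2\in\mathscr{D}^t_k$, then $Q_2\subseteq Q_1$ or $Q_1\cap Q_2=\emptyset$; (c) each $Q_1\in\mathscr{D}^t_k$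 contains at least one $Q_2\in\mathscr{D}^t_{k+1}$ (a child of $Q_1$) and is contained in exactly one $Q_3\in\mathscr{D}^t_{k-1}$ (the parent of $Q_1$); (d) if $Q_2\in\mathscr{D}^t_k$ is a child of $Q_1\in\mathscr{D}^t_{k-1}$, then $\mu(Q_2)\ge\varepsilon\mu(Q_1)$; (e) for each $Q\in\mathscr{D}^t_k$ there is $x_c(Q)\in Q$ with $B(x_c(Q),r_0\eta^k)\subseteq Q\subseteq B(x_c(Q),R_0\eta^k)$. Moreover, there is a constant $C<\infty$ such that every ball $B$ is contained in some $Q_B\in\mathscr{D}$ with $\mu(Q_B)\le C\mu(B)$. (Such systems exist on every space of homogeneous type.) For measurable $f$, $Mf(x):=\sup_{B\ni x}\frac1{\mu(B)}\int_B|f|\,d\mu$, the supremum being over all balls $B\subseteq X$ containing $x$. ''$M$ is bounded on $L^{p(\cdot)}$'' means that there is $C>0$ with $\|Mf\|_{p(\cdot)}\le C\|f\|_{p(\cdot)}$ for all $f\in L^{p(\cdot)}$. For a $\mu$-measurable exponent $p(\cdot):X\to[1,\infty]$ with $1<\operatorname*{ess\,inf}_{x\in X}p(x)\le\operatorname*{ess\,sup}_{x\in X}p(x)<\infty$, $L^{p(\cdot)}(X,d,\mu)$ is the space of complex-valued measurable $f$ with $\|f\|_{p(\cdot)}:=\inf\{\lambda>0:\int_X(|f(x)|/\lambda)^{p(x)}d\mu(x)\le1\}<\infty$ ($\inf\emptyset=\infty$; the same formula, with $\infty^{p}=\infty$, is used for $[0,\infty]$-valued functions). $\chi_E$ is the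 characteristic function of $E$. *)

(* Defs.v *)
From HB Require Import structures.
From mathcomp Require Import all_boot all_order all_algebra.
From mathcomp Require Import all_classical all_reals all_analysis.
From mathcomp Require Import measurable_realfun ess_sup_inf complex.

Set Implicit Arguments.
Unset Strict Implicit.
Unset Printing Implicit Defensive.
Import Order.TTheory GRing.Theory Num.Theory.
Import numFieldNormedType.Exports.

Local Open Scope classical_set_scope.
Local Open Scope ring_scope.

Record quasi_metric (R : realType) (T : Type) (rho : T -> T -> R) : Prop :=
  QuasiMetric {
    qm_ge0 : forall x y, 0 <= rho x y ;
    qm_eq0 : forall x y, rho x y = 0 <-> x = y ;
    qm_sym : forall x y, rho x y = rho y x ;
    qm_triangle : exists2 A0 : R, 1 <= A0 &
      forall x y z, rho x z <= A0 * (rho x y + rho y z) }.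

Definition qball (R : realType) (T : Type) (rho : T -> T -> R) (x : T) (r : R)
  : set T := [set y | rho x y < r].

Definition is_qball (R : realType) (T : Type) (rho : T -> T -> R) (B : set T)
  : Prop := exists x : T, exists2 r : R, 0 < r & B = qball rho x r.

(* The topology tau_d; balls of a quasi-metric need not belong to it. *)
Definition qopen (R : realType) (T : Type) (rho : T -> T -> R) : set (set T) :=
  [set U | forall x, U x -> exists2 r : R, 0 < r & qball rho x r `<=` U].

Definition qborel (R : realType) (T : Type) (rho : T -> T -> R)
  : set (set T) := <<s qopen rho >>.

Record homogeneous_space (R : realType) (d : measure_display)
    (T : measurableType d) (rho : T -> T -> R)
    (mu : {measure set T -> \bar R}) : Prop := HomogeneousSpace {
  hs_quasi_metric : quasi_metric rho ;
  hs_complete : measure_is_complete mu ;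
  hs_borel : qborel rho `<=` @measurable d T ;
  hs_ball_measurable : forall x (r : R), 0 < r -> measurable (qball rho x r) ;
  hs_doubling : exists2 A : R, 1 <= A & forall x (r : R), 0 < r ->
    [/\ (0 < mu (qball rho x r))%E,
        (mu (qball rho x r) <= A%:E * mu (qball rho x (r / 2)))%E &
        (A%:E * mu (qball rho x (r / 2)) < +oo)%E] }.

Definition unbounded_space (R : realType) (d : measure_display)
    (T : measurableType d) (mu : {measure set T -> \bar R}) : Prop :=
  mu [set: T] = +oo%E.

Definition borel_semiregular (R : realType) (d : measure_display)
    (T : measurableType d) (rho : T -> T -> R)
    (mu : {measure set T -> \bar R}) : Prop :=
  forall E : set T, measurable E -> (mu E < +oo)%E ->
    exists2 B : set T, qborel rho B & mu (E `+` B) = 0%E.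

(* [D t k] is the set of cubes of generation [k] in the [t]-th dyadic grid.  A
   cube is a plain set and may occur in several generations, so the center in
   [hk_center] is allowed to depend on the generation. *)
Record HK_dyadic_system (R : realType) (d : measure_display)
    (T : measurableType d) (rho : T -> T -> R)
    (mu : {measure set T -> \bar R}) (K : nat)
    (D : 'I_K -> int -> set (set T)) (eps eta r0 R0 : R) : Prop :=
  HKDyadicSystem {
    hk_eps : 0 < eps < 1 ;
    hk_eta : 0 < eta < 1 ;
    hk_radii : 0 < r0 <= R0 ;
    hk_countable : forall t, countable (\bigcup_(k in [set: int]) D t k) ;
    hk_borel : forall t k Q, D t k Q -> qborel rho Q ;
    hk_cover : forall t k, \bigcup_(Q in D t k) Q = [set: T] ;
    hk_disjoint : forall t k, trivIset (D t k) id ;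
    hk_nested : forall t (k l : int) Q1 Q2, l < k -> D t l Q1 -> D t k Q2 ->
      Q2 `<=` Q1 \/ Q1 `&` Q2 = set0 ;
    hk_child : forall t k Q1, D t k Q1 ->
      exists2 Q2, D t (k + 1) Q2 & Q2 `<=` Q1 ;
    hk_parent : forall t k Q1, D t k Q1 ->
      exists! Q3, D t (k - 1) Q3 /\ Q1 `<=` Q3 ;
    hk_child_measure : forall t k Q1 Q2, D t (k - 1) Q1 -> D t k Q2 ->
      Q2 `<=` Q1 -> (eps%:E * mu Q1 <= mu Q2)%E ;
    hk_center : forall t k Q, D t k Q -> exists2 c : T, Q c &
      qball rho c (r0 * eta ^ k) `<=` Q /\
      Q `<=` qball rho c (R0 * eta ^ k) ;
    hk_ball : exists C : R, forall B, is_qball rho B ->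
      exists t, exists k, exists2 Q, D t k Q &
        B `<=` Q /\ (mu Q <= C%:E * mu B)%E }.

Definition cubes (T : Type) (K : nat) (D : 'I_K -> int -> set (set T))
  : set (set T) := [set Q | exists t, exists k, D t k Q].

Record admissible_exponent (R : realType) (d : measure_display)
    (T : measurableType d) (mu : {measure set T -> \bar R})
    (p : T -> \bar R) : Prop := AdmissibleExponent {
  ae_measurable : measurable_fun [set: T] p ;
  ae_ge1 : forall x, (1 <= p x)%E ;
  ae_ess : [/\ (1 < ess_inf mu p)%E, (ess_inf mu p <= ess_sup mu p)%E &
               (ess_sup mu p < +oo)%E] }.

(* [a ^ q] for [a] in [0, +oo] and [q] in [1, +oo].  The usual convention is
   used for [q = +oo]; admissible exponents take this value only on a null set.
   The case [q = -oo] is junk. *)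
Definition epower (R : realType) (a q : \bar R) : \bar R :=
  match q with
  | r%:E => poweR a r
  | +oo => if (a <= 1)%E then 0 else +oo
  | -oo => 0
  end%E.

(* The Luxemburg functional on [0, +oo]-valued functions.  The infimum is taken
   in \bar R, where the infimum of the empty set is +oo. *)
Definition lux_norm (R : realType) (d : measure_display)
    (T : measurableType d) (mu : {measure set T -> \bar R})
    (p : T -> \bar R) (g : T -> \bar R) : \bar R :=
  ereal_inf [set l%:E | l in [set l : R | 0 < l /\
    (\int[mu]_x epower (g x * (l^-1)%:E) (p x) <= 1)%E]].

Definition cabs (R : realType) (T : Type) (f : T -> R[i]) (x : T) : \bar R :=
  (ComplexField.Normc.normc (f x))%:E.

Definition measurable_cfun (R : realType) (d : measure_display)
    (T : measurableType d) (f : T -> R[i]) : Prop :=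
  measurable_fun [set: T] (fun x => complex.Re (f x)) /\
  measurable_fun [set: T] (fun x => complex.Im (f x)).

Definition in_Lp (R : realType) (d : measure_display)
    (T : measurableType d) (mu : {measure set T -> \bar R})
    (p : T -> \bar R) (f : T -> R[i]) : Prop :=
  measurable_cfun f /\ (lux_norm mu p (cabs f) < +oo)%E.

Definition average (R : realType) (d : measure_display)
    (T : measurableType d) (mu : {measure set T -> \bar R})
    (f : T -> R[i]) (A : set T) : \bar R :=
  ((mu A)^-1 * \int[mu]_(x in A) cabs f x)%E.

Definition maximal (R : realType) (d : measure_display)
    (T : measurableType d) (rho : T -> T -> R)
    (mu : {measure set T -> \bar R}) (f : T -> R[i]) (x : T) : \bar R :=
  ereal_sup [set average mu f B | B in [set B | is_qball rho B /\ B x]].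

Definition maximal_bounded (R : realType) (d : measure_display)
    (T : measurableType d) (rho : T -> T -> R)
    (mu : {measure set T -> \bar R}) (p : T -> \bar R) : Prop :=
  exists2 C : R, 0 < C & forall f : T -> R[i], in_Lp mu p f ->
    (lux_norm mu p (maximal rho mu f) <= C%:E * lux_norm mu p (cabs f))%E.

Definition averaging (R : realType) (d : measure_display)
    (T : measurableType d) (mu : {measure set T -> \bar R})
    (F : set (set T)) (f : T -> R[i]) (x : T) : \bar R :=
  (\esum_(Q in F) (average mu f Q * (\1_Q x)%:E))%E.

(* Main.v *)
Require Import Defs.
From HB Require Import structures.
From mathcomp Require Import all_boot all_order all_algebra.
From mathcomp Require Import all_classical all_reals all_analysis.
From mathcomp Require Import measurable_realfun ess_sup_inf complex ring lra.

Set Implicit Arguments.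
Unset Strict Implicit.
Unset Printing Implicit Defensive.
Import Order.TTheory GRing.Theory Num.Theory.
Import numFieldNormedType.Exports.

(** One implication is pointwise: a dyadic cube lies in a ball of comparable
    measure, so the averages over disjoint cubes are at most a multiple of the
    maximal function ([averaging_le_maximal]).

    For the other implication, norms are replaced by modulars, that is, by
    integrals of [g `^ q], where the real exponent [q] takes values between
    [lo > 1] and [hi]. The hypothesis becomes: if the modular of [g] is at most
    [1], then that of its averages over disjoint cubes is at most [C]
    ([averaging_bounded]). A ball lies in a cube of comparable measure, so the
    maximal function is controlled by the maximal functions of finitely many
    grids, and these by their level sets at the heights [t] that are powers of
    two. Each level set is exhausted by unions of disjoint stopping cubes. If
    the integral of [t `^ q] over it were at most a multiple of the modular of
    [t * G], where [G `^ s] is [2 * f / t] on the set [t < 2 * f] and [s > 1],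
    then the sum over [t] would be geometric, with sum comparable to the
    modular of [f] ([level_sum_bound]). Two things have to be gained for this.

    The first one is the power [s > 1] in the means, that is, the averaging
    bound for the exponent [q / s] ([left_open]). The bound passes to the
    conjugate exponent by duality ([averaging_bounded_conj]). A stopping time
    argument shows that [y `^ q], for [y] constant on the given cubes, satisfies
    a reverse Hoelder inequality with constants independent of the cubes
    ([reverse_holder]); applied with the conjugate exponent and
    dualized, this yields [s]. Lebesgue differentiation along the grid enters
    here, and it is where semiregularity of the measure matters
    ([density_cube]).

    The second one is homogeneity: a modular that is small has to give a bound
    that is proportionally small, although scaling by constants does not act
    on modulars linearly when the exponent varies. For [t >= 1] the homogeneous
    inequality holds on each cube ([high_level]). For [t < 1] it may fail on
    some cubes, but these carry at most [C * t `^ ((1 - s^-1) * lo)] in total,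
    which is summable over the powers of two below [1] ([low_level]). *)

Local Open Scope classical_set_scope.
Local Open Scope ring_scope.

(** * Integrals of nonnegative functions *)

(** Both notions are locked, so that unification treats the integral of a
    real integrand as atomic and never looks through the embedding into
    the extended reals. *)
HB.lock Definition nnm {R : realType} {d : measure_display}
    {T : measurableType d} (h : T -> R) : Prop :=
  measurable_fun [set: T] h /\ forall x, 0 <= h x.

HB.lock Definition integ {R : realType} {d : measure_display}
    {T : measurableType d} (mu : {measure set T -> \bar R}) (A : set T)
    (h : T -> R) : \bar R :=
  (\int[mu]_(x in A) (h x)%:E)%E.

Section Integrals.
Context {R : realType} {d : measure_display} {T : measurableType d}.
Variable mu : {measure set T -> \bar R}.
Local Notation integ := (integ mu).
Implicit Types g h : T -> R.

Lemma nnmP h : nnm h <-> measurable_fun [set: T] h /\ forall x, 0 <= h x.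
Proof. by rewrite nnm.unlock. Qed.

Lemma integE A h : integ A h = (\int[mu]_(x in A) (h x)%:E)%E.
Proof. by rewrite integ.unlock. Qed.

Lemma nnm_ge0 h x : nnm h -> 0 <= h x. Proof. by case/nnmP => _; exact. Qed.

Lemma nnm_meas h : nnm h -> measurable_fun [set: T] h. Proof. by case/nnmP. Qed.

Lemma nnm_cst (c : R) : 0 <= c -> nnm (fun _ : T => c).
Proof. by move=> c0; apply/nnmP; split. Qed.

Lemma nnmD g h : nnm g -> nnm h -> nnm (fun x => g x + h x).
Proof.
move=> /nnmP[mg g0] /nnmP[mh h0]; apply/nnmP; split; first exact: measurable_funD.
by move=> x; rewrite addr_ge0.
Qed.

Lemma nnmM g h : nnm g -> nnm h -> nnm (fun x => g x * h x).
Proof.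
move=> /nnmP[mg g0] /nnmP[mh h0]; apply/nnmP; split; first exact: measurable_funM.
by move=> x; rewrite mulr_ge0.
Qed.

Lemma nnmZ (c : R) h : 0 <= c -> nnm h -> nnm (fun x => c * h x).
Proof. by move=> c0 hh; apply: nnmM => //; exact: nnm_cst. Qed.

Lemma nnm_indic (A : set T) : measurable A -> nnm (fun x => \1_A x : R).
Proof. by move=> mA; apply/nnmP; split => //; exact: measurable_indic. Qed.

Lemma measurable_powR2 (g q : T -> R) : measurable_fun [set: T] g ->
  measurable_fun [set: T] q -> measurable_fun [set: T] (fun x => g x `^ q x).
Proof.
move=> mg mq; rewrite /powR; apply: measurable_fun_ifT.
- exact: measurable_fun_eqr.
- apply: measurableT_comp => //; apply: measurable_fun_ifT => //.
  exact: measurable_fun_eqr.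
- apply: measurableT_comp => //; apply: measurable_funM => //.
  exact: measurableT_comp.
Qed.

Lemma nnm_powR (g q : T -> R) : measurable_fun [set: T] g ->
  measurable_fun [set: T] q -> nnm (fun x => g x `^ q x).
Proof.
move=> mg mq; apply/nnmP.
by split; [exact: measurable_powR2|move=> x; exact: powR_ge0].
Qed.

Lemma nnm_emeas h A : nnm h -> measurable_fun A (fun x => (h x)%:E).
Proof.
by move=> /nnmP[mh _]; apply/measurable_EFinP; apply: measurable_funTS.
Qed.

Lemma integ_ge0 A h : nnm h -> (0 <= integ A h)%E.
Proof. rewrite integE => /nnmP[_ h0]; apply: integral_ge0 => x _.
by rewrite lee_fin.
Qed.

Lemma le_integ A g h : measurable A -> nnm g -> nnm h ->
  (forall x, A x -> g x <= h x) -> (integ A g <= integ A h)%E.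
Proof.
move=> mA gg hh gh; rewrite !integE; apply: ge0_le_integral => //; try exact: nnm_emeas.
by move=> x _; rewrite lee_fin; exact: nnm_ge0.
Qed.

Lemma eq_integ A g h : (forall x, A x -> g x = h x) -> integ A g = integ A h.
Proof.
by move=> gh; rewrite !integE; apply: eq_integral => x /set_mem Ax; rewrite gh.
Qed.

Lemma integZ A h (c : R) : measurable A -> 0 <= c -> nnm h ->
  integ A (fun x => c * h x) = (c%:E * integ A h)%E.
Proof.
move=> mA c0 hh; rewrite !integE -ge0_integralZl_EFin//.
- by move=> x _; rewrite lee_fin; exact: nnm_ge0.
- exact: nnm_emeas.
Qed.

Lemma integD A g h : measurable A -> nnm g -> nnm h ->
  integ A (fun x => g x + h x) = (integ A g + integ A h)%E.
Proof.
move=> mA gg hh; rewrite !integE -ge0_integralD//.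
- by move=> x _; rewrite lee_fin; exact: nnm_ge0.
- exact: nnm_emeas.
- by move=> x _; rewrite lee_fin; exact: nnm_ge0.
- exact: nnm_emeas.
Qed.

Lemma integ_cst A (c : R) : measurable A -> integ A (fun=> c) = (c%:E * mu A)%E.
Proof. by move=> mA; rewrite integE integral_cst. Qed.

Lemma subset_integ A B h : measurable A -> measurable B -> nnm h -> A `<=` B ->
  (integ A h <= integ B h)%E.
Proof.
move=> mA mB hh AB; rewrite !integE; apply: ge0_subset_integral => //; first exact: nnm_emeas.
by move=> x _; rewrite lee_fin; exact: nnm_ge0.
Qed.

Lemma integU A B h : measurable A -> measurable B -> nnm h ->
  A `&` B = set0 -> integ (A `|` B) h = (integ A h + integ B h)%E.
Proof.
move=> mA mB hh AB0; rewrite !integE ge0_integral_setU//.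
- exact: nnm_emeas.
- by move=> x _; rewrite lee_fin; exact: nnm_ge0.
- by apply/eqP.
Qed.

End Integrals.

(** * Integrals over disjoint families *)

Section Families.
Context {R : realType} {d : measure_display} {T : measurableType d}.
Variable mu : {measure set T -> \bar R}.
Implicit Types F : set (set T).

Definition union F : set T := \bigcup_(Q in F) Q.

Definition family F :=
  [/\ countable F, (forall Q, F Q -> measurable Q) &
      (forall Q Q' x, F Q -> F Q' -> Q x -> Q' x -> Q = Q')].

Lemma sub_family F F' : F' `<=` F -> family F -> family F'.
Proof.
move=> FF [cF mF dF]; split; first exact: sub_countable (subset_card_le FF) cF.
  by move=> Q /FF; exact: mF.
by move=> Q Q' x /FF FQ /FF; exact: dF.
Qed.

Let piece F (f : set T -> nat) (n : nat) : set T :=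
  \bigcup_(Q in F `&` [set Q | f Q = n]) Q.

(** Enumerating a countable disjoint family turns integrals over its union
    into series. *)
Lemma piece_family F : family F -> exists S : nat -> set T,
  [/\ trivIset [set: nat] S, \bigcup_n S n = union F,
      (forall n, S n = set0 \/ F (S n)) & (forall n, measurable (S n))].
Proof.
move=> [cF mF dF]; have /countable_injP[f fi] := cF.
have pE n Q : F Q -> f Q = n -> piece F f n = Q.
  move=> FQ fQ; apply/seteqP; split; last by move=> x Qx; exists Q.
  move=> x [Q' [FQ' fQ'] Q'x]; suff -> : Q = Q' by [].
  by apply: fi; rewrite ?inE ?fQ ?fQ'.
have pS n : piece F f n = set0 \/ F (piece F f n).
  have [[Q [FQ fQ]]|nQ] := pselect (exists Q, F Q /\ f Q = n).
    by right; rewrite (pE _ _ FQ fQ).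
  by left; apply/eqP/negPn/negP => /set0P[x [Q [FQ fQ] _]]; apply: nQ; exists Q.
exists (piece F f); split => //.
- move=> i j _ _ [x [[Q [FQ fQ] Qx] [Q' [FQ' fQ'] Q'x]]].
  by rewrite -fQ -fQ' (dF _ _ x FQ FQ').
- apply/seteqP; split => [x [n _ [Q [FQ _] Qx]]|x [Q FQ Qx]]; first by exists Q.
  by exists (f Q) => //; exists Q.
- by move=> n; have [->//|/mF] := pS n.
Qed.

Lemma measurable_union F : family F -> measurable (union F).
Proof.
move=> fF; have [S [_ <- _ mS]] := piece_family fF.
exact: bigcup_measurable.
Qed.

Lemma integ_set0 (h : T -> R) : integ mu set0 h = 0%E.
Proof. by rewrite integE integral_set0. Qed.

Lemma integ_union_le F g h : family F -> nnm g -> nnm h ->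
  (forall Q, F Q -> (integ mu Q g <= integ mu Q h)%E) ->
  (integ mu (union F) g <= integ mu (union F) h)%E.
Proof.
move=> fF gg hh gh; have [S [tS <- FS mS]] := piece_family fF.
rewrite !integE !ge0_integral_bigcup//; try exact: nnm_emeas;
  try by move=> x _; rewrite lee_fin; exact: nnm_ge0.
apply: lee_nneseries => [n _ _|n _].
  by apply: integral_ge0 => x _; rewrite lee_fin; exact: nnm_ge0.
have [->|/gh] := FS n; first by rewrite !integral_set0.
by rewrite !integE.
Qed.

(** Monotone convergence over the finite subfamilies. It reduces a bound to
    the case where the left-hand side is known to be finite. *)
Lemma integ_union_fin F h (C : \bar R) : family F -> nnm h ->
  (forall L : seq (set T), (forall Q, Q \in L -> F Q) ->
    (integ mu (union [set` L]) h <= C)%E) ->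
  (integ mu (union F) h <= C)%E.
Proof.
move=> fF hh hL; have [S [tS SU FS mS]] := piece_family fF.
have C0 : (0 <= C)%E.
  by apply: le_trans (hL [::] _) => //; exact: integ_ge0.
rewrite -SU integE ge0_integral_bigcup//; try exact: nnm_emeas;
  try by move=> x _; rewrite lee_fin; exact: nnm_ge0.
apply: lime_le; first by apply: is_cvg_nneseries => n _ _; rewrite -integE; exact: integ_ge0.
apply: nearW => n.
pose L := [seq S i | i <- iota 0 n & `[< F (S i) >]].
apply: le_trans (hL L _); last first.
  by move=> Q /mapP[m]; rewrite mem_filter => /andP[/asboolP Fi _] ->.
have fL : family [set` L].
  apply: sub_family fF => Q /=.
  by move=> /mapP[m]; rewrite mem_filter => /andP[/asboolP Fi _] ->.
rewrite big_mkord -ge0_integral_bigsetU//=.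
- rewrite -integE; apply: subset_integ => //.
  + exact: bigsetU_measurable.
  + exact: measurable_union.
  + move=> x; rewrite -bigcup_mkord => -[i /= ni Six].
    exists (S i) => //=; apply/mapP; exists i => //.
    rewrite mem_filter mem_iota /= add0n ni andbT; apply/asboolP.
    by have [S0|//] := FS i; rewrite S0 in Six.
- exact: index_enum_uniq.
- by move=> i j _ _ [x [Six Sjx]]; apply/val_inj/tS => //; exists x.
- exact: nnm_emeas.
- by move=> x _; rewrite lee_fin; exact: nnm_ge0.
Qed.

End Families.

(** * Powers, means and Jensen's inequality *)

Section Powers.
Context {R : realType}.
Implicit Types a b c q lo hi t : R.

Lemma powR_le_base q a b : 0 <= q -> 0 <= a -> a <= b -> a `^ q <= b `^ q.
Proof.
by move=> q0 a0 ab; apply: ge0_ler_powR; rewrite ?nnegrE//; exact: le_trans ab.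
Qed.

Lemma powR_lt_base q a b : 0 < q -> 0 <= a -> a < b -> a `^ q < b `^ q.
Proof.
move=> q0 a0 ab; apply: gt0_ltr_powR; rewrite ?nnegrE//.
by rewrite (le_trans a0)// ltW.
Qed.

Lemma powR_le_baseP q a b : 0 < q -> 0 <= a -> 0 <= b ->
  (a `^ q <= b `^ q) = (a <= b).
Proof.
move=> q0 a0 b0; apply/idP/idP => [|ab]; last by apply: powR_le_base => //; exact: ltW.
by apply: contraTT; rewrite -!ltNge; exact: powR_lt_base.
Qed.

Lemma powR_rootK q a : 0 < q -> 0 <= a -> (a `^ q^-1) `^ q = a.
Proof. by move=> q0 a0; rewrite -powRrM mulVf ?gt_eqF// powRr1. Qed.

Lemma powR_Kroot q a : 0 < q -> 0 <= a -> (a `^ q) `^ q^-1 = a.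
Proof. by move=> q0 a0; rewrite -powRrM mulfV ?gt_eqF// powRr1. Qed.

Lemma powR_ge1 q a : 0 <= q -> 1 <= a -> 1 <= a `^ q.
Proof. by move=> q0 a1; rewrite -[leLHS](powRr0 a); exact: ler_powR. Qed.

Lemma powR_le1 q a : 0 <= q -> 0 <= a -> a <= 1 -> a `^ q <= 1.
Proof. by move=> q0 a0 a1; apply: (le_trans (powR_le_base q0 a0 a1)); rewrite powR1. Qed.

Lemma powR_exp_le1 a b q : 0 <= a -> a <= 1 -> 0 < q -> q <= b ->
  a `^ b <= a `^ q.
Proof.
move=> a0 a1 q0 qb; move: a0; rewrite le_eqVlt => /predU1P[<-|a0].
  by rewrite !powR0// gt_eqF// (lt_le_trans q0).
by apply: ger_powR; rewrite ?a0.
Qed.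

Lemma powR_scale_le1 lo q c a : 0 < lo -> lo <= q -> 0 <= c -> c <= 1 ->
  0 <= a -> (c * a) `^ q <= c `^ lo * a `^ q.
Proof.
move=> l0 lq c0 c1 a0; rewrite powRM// ler_wpM2r ?powR_ge0//.
exact: powR_exp_le1.
Qed.

Lemma powR_scale_ge1 hi q c a : q <= hi -> 1 <= c -> 0 <= a ->
  (c * a) `^ q <= c `^ hi * a `^ q.
Proof.
move=> qh c1 a0; rewrite powRM ?(le_trans _ c1)// ler_wpM2r ?powR_ge0//.
exact: ler_powR.
Qed.

(** Convexity of [a `^ t], with [b] the point of tangency; Jensen's
    inequality is the integral of this one, with [b] the mean. *)
Lemma powR_tangent t a b : 1 <= t -> 0 <= a -> 0 < b ->
  t * b `^ (t - 1) * a <= a `^ t + (t - 1) * b `^ t.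
Proof.
rewrite le_eqVlt => /predU1P[<-|t1] a0 b0.
  by rewrite subrr powRr0 !mul1r powRr1// mul0r addr0.
have t0 : 0 < t by lra.
have s0 : 0 < t - 1 by lra.
have h := @conjugate_powR R a (b `^ (t - 1)) t (t / (t - 1)) a0 (powR_ge0 _ _)
  t0 (divr_gt0 t0 s0).
have /h : t^-1 + (t / (t - 1))^-1 = 1 by field; lra.
rewrite -powRrM (_ : (t - 1) * (t / (t - 1)) = t); last by field; lra.
move=> {}h; rewrite -mulrA (mulrC (b `^ _)) -ler_pdivlMl//.
by rewrite (le_trans h)// le_eqVlt; apply/orP; left; apply/eqP; field; lra.
Qed.

Lemma young_powR q a b : 1 < q -> 0 <= a -> 0 <= b ->
  a * b <= a `^ q + b `^ (q / (q - 1)).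
Proof.
move=> q1 a0 b0.
have q0 : 0 < q by lra.
have s0 : 0 < q - 1 by lra.
have r0 : 0 < q / (q - 1) by rewrite divr_gt0.
have /(conjugate_powR a0 b0 q0 r0) h : q^-1 + (q / (q - 1))^-1 = 1.
  by field; lra.
apply: (le_trans h); apply: lerD.
  by rewrite ler_pdivrMr// ler_peMr ?powR_ge0//; lra.
by rewrite ler_pdivrMr// ler_peMr ?powR_ge0// ler_pdivlMr//; lra.
Qed.

End Powers.

HB.lock Definition avg {R : realType} {d : measure_display}
    {T : measurableType d} (mu : {measure set T -> \bar R}) (Q : set T)
    (h : T -> R) : R :=
  fine (integ mu Q h) / fine (mu Q).

Section Averages.
Context {R : realType} {d : measure_display} {T : measurableType d}.
Variable mu : {measure set T -> \bar R}.

Lemma jensen_powR Q h (t y : R) : measurable Q -> (mu Q < +oo)%E -> nnm h ->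
  1 <= t -> 0 <= y -> (y%:E * mu Q <= integ mu Q h)%E ->
  ((y `^ t)%:E * mu Q <= integ mu Q (fun x => h x `^ t)%R)%E.
Proof.
move=> mQ fQ hh t1 y0.
have hp : nnm (fun x => h x `^ t) by apply: nnm_powR => //; exact: nnm_meas.
move: y0; rewrite le_eqVlt => /predU1P[<- _|y0].
  have t0 : t != 0 by rewrite gt_eqF//; lra.
  by rewrite powR0// mul0e; exact: integ_ge0.
have -> : mu Q = (fine (mu Q))%:E by rewrite fineK// ge0_fin_numE.
set m := fine (mu Q) => yQ.
have t0 : 0 <= t - 1 by lra.
have yt0 : 0 <= t * y `^ (t - 1) by rewrite mulr_ge0 ?powR_ge0//; lra.
have : (integ mu Q (fun x => t * y `^ (t - 1) * h x)%R <=
    integ mu Q (fun x => h x `^ t + (t - 1) * y `^ t)%R)%E.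
  apply: le_integ => //; first exact: nnmZ.
    by apply: nnmD => //; apply: nnm_cst; rewrite mulr_ge0 ?powR_ge0.
  by move=> x _; apply: powR_tangent => //; exact: nnm_ge0.
rewrite integZ// integD//; last by apply: nnm_cst; rewrite mulr_ge0 ?powR_ge0.
rewrite integ_cst//.
have -> : mu Q = m%:E by rewrite fineK// ge0_fin_numE.
have := lee_wpmul2l _ yQ; move=> /(_ (t * y `^ (t - 1))%:E) /(_ _).
rewrite lee_fin => /(_ yt0) {}yQ h2; have := le_trans yQ h2.
case: (integ mu Q _) (integ_ge0 mu Q hp) => [r| |]//=; last by move=> *; exact: leey.
rewrite -!EFinM -EFinD !lee_fin => _.
have -> : y `^ t = y * y `^ (t - 1).
  by rewrite mulr_powRB1 ?(ltW y0) ?(lt_le_trans ltr01).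
set w := y `^ _; nra.
Qed.

(** Jensen's inequality, applied to a number [z > y] that would still be
    below the mean of [h]; such a [z] exists even if that mean is infinite. *)
Lemma jensen_root Q h (t y : R) : measurable Q -> (0 < mu Q)%E ->
  (mu Q < +oo)%E -> nnm h -> 1 <= t -> 0 <= y ->
  (integ mu Q (fun x => h x `^ t)%R <= (y `^ t)%:E * mu Q)%E ->
  (integ mu Q h <= y%:E * mu Q)%E.
Proof.
move=> mQ Q0 fQ hh t1 y0 hy; rewrite leNgt; apply/negP => yQ.
have t0 : 0 < t by lra.
have mE : mu Q = (fine (mu Q))%:E by rewrite fineK// ge0_fin_numE.
have m0 : 0 < fine (mu Q) by rewrite fine_gt0// Q0.
have [z yz zQ] : exists2 z, y < z & (z%:E * mu Q <= integ mu Q h)%E.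
  move: yQ; rewrite mE; case: (integ mu Q h) => [r| |]//=.
    rewrite -EFinM lte_fin => yr; exists (r / fine (mu Q)).
      by rewrite ltr_pdivlMr.
    by rewrite -EFinM lee_fin divfK// gt_eqF.
  by move=> _; exists (y + 1); [lra|rewrite leey].
have z0 : 0 <= z by lra.
have := le_trans (jensen_powR mQ fQ hh t1 z0 zQ) hy.
rewrite mE -!EFinM lee_fin ler_pM2r// leNgt => /negP; apply.
exact: powR_lt_base.
Qed.

(** A function that is constant on each member of [F] is written
    [phi (cubeof F x)]. The value [set0] off the union makes it measurable
    for every [phi]. *)
Definition cubeof (F : set (set T)) (x : T) : set T :=
  xget set0 [set Q | F Q /\ Q x].

Lemma cubeofE F Q x : family F -> F Q -> Q x -> cubeof F x = Q.
Proof.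
move=> [_ _ dF] FQ Qx; rewrite /cubeof; apply: xget_unique => //= Q' [FQ' Q'x].
exact: dF Q'x Qx.
Qed.

Lemma cubeof_out F x : ~ union F x -> cubeof F x = set0.
Proof.
move=> nF; rewrite /cubeof; case: xgetP => // Q _ [FQ Qx].
by case: nF; exists Q.
Qed.

Lemma measurable_cubeof F (phi : set T -> R) : family F ->
  measurable_fun [set: T] (fun x => phi (cubeof F x)).
Proof.
move=> fF _ B mB; rewrite setTI.
have -> : (fun x => phi (cubeof F x)) @^-1` B =
    union (F `&` [set Q | B (phi Q)]) `|`
    (~` union F `&` [set _ | B (phi set0)]).
  apply/seteqP; split => [x /= Bx|x [[Q [FQ BQ] Qx]|[nF B0]]]; last 2 first.
  - by rewrite /= (cubeofE fF FQ Qx).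
  - by rewrite /= cubeof_out.
  have [[Q FQ Qx]|nF] := pselect (union F x).
    by left; exists Q => //; split => //; rewrite /= -(cubeofE fF FQ Qx).
  by right; split => //; rewrite /= -(cubeof_out nF).
apply: measurableU; first by apply: measurable_union; apply: sub_family fF => Q [].
apply: measurableI; first by apply: measurableC; exact: measurable_union.
have [B0|B0] := pselect (B (phi set0)).
  rewrite (_ : [set _ | _] = setT); first exact: measurableT.
  by apply/seteqP; split.
rewrite (_ : [set _ | _] = set0); first exact: measurable0.
by apply/seteqP; split.
Qed.

Lemma nnm_cubeof F (phi : set T -> R) : family F -> (forall Q, 0 <= phi Q) ->
  nnm (fun x => phi (cubeof F x)).
Proof. by move=> fF p0; apply/nnmP; split => //; exact: measurable_cubeof. Qed.

Lemma avg_ge0 Q h : nnm h -> 0 <= avg mu Q h.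
Proof.
by move=> hh; rewrite avg.unlock divr_ge0// fine_ge0//; exact: integ_ge0.
Qed.

Lemma avgE Q h : (0 < mu Q)%E -> (mu Q < +oo)%E -> nnm h ->
  (integ mu Q h < +oo)%E -> ((avg mu Q h)%:E * mu Q)%E = integ mu Q h.
Proof.
move=> Q0 fQ hh fh; rewrite -[X in (_ * X)%E]fineK ?ge0_fin_numE//.
rewrite -[RHS]fineK ?ge0_fin_numE//; last exact: integ_ge0.
by rewrite -EFinM avg.unlock divfK// gt_eqF// fine_gt0// Q0.
Qed.

End Averages.

(** * Duality for modulars *)

(** Double [k0] until [phi] exceeds [1]. This replaces the intermediate value
    theorem for modulars [phi], which satisfy [phi (2 k) <= 2 `^ hi * phi k]:
    then [phi k] lies in a fixed interval around [1]. *)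
Lemma crossing {R : realType} (phi : R -> \bar R) (k0 k1 : R) : 0 < k0 ->
  (forall a b, 0 < a -> a <= b -> (phi a <= phi b)%E) ->
  (phi k0 <= 1)%E -> 0 < k1 -> (1 < phi k1)%E ->
  exists k, [/\ k0 <= k, (phi k <= 1)%E & (1 < phi (2 * k)%R)%E].
Proof.
move=> k0_gt0 phi_le phi0 k1_gt0 phi1.
have exn : exists n, (1 < phi (k0 * 2 ^+ n)%R)%E.
  exists (Num.truncn (k1 / k0)).+1; apply: lt_le_trans phi1 _; apply: phi_le => //.
  rewrite -ler_pdivrMl// mulrC (le_trans (ltW (truncnS_gt _)))//.
  by rewrite -natrX ler_nat ltnW// ltn_expl.
case: (ex_minnP exn) => -[|m]; first by rewrite expr0 mulr1 ltNge phi0.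
rewrite exprS mulrCA => gt1 min_m; exists (k0 * 2 ^+ m); split => //.
  by apply: ler_peMr; [exact: ltW|rewrite exprn_ege1// ler1n].
by rewrite leNgt; apply/negP => /min_m; rewrite ltnn.
Qed.

Lemma conj_antimono {R : realType} (a b : R) : 1 < a -> a <= b ->
  b / (b - 1) <= a / (a - 1).
Proof.
move=> a1 ab; have -> : b / (b - 1) = 1 + (b - 1)^-1 by field; lra.
have -> : a / (a - 1) = 1 + (a - 1)^-1 by field; lra.
by rewrite lerD2l lef_pV2 ?posrE; lra.
Qed.

Section Duality.
Context {R : realType} {d : measure_display} {T : measurableType d}.
Variable mu : {measure set T -> \bar R}.
Variables (q : T -> R) (lo hi : R).
Hypotheses (mq : measurable_fun [set: T] q) (lo1 : 1 < lo) (lohi : lo <= hi)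
  (loq : forall x, lo <= q x) (qhi : forall x, q x <= hi).

Let q1 x : 1 < q x. Proof. exact: lt_le_trans (loq x). Qed.
Let q0 x : 0 < q x. Proof. by apply: lt_trans (q1 x). Qed.

Lemma nnm_pow h : nnm h -> nnm (fun x => h x `^ q x).
Proof. by move=> hh; apply: nnm_powR => //; exact: nnm_meas. Qed.

Lemma measurable_conj : measurable_fun [set: T] (fun x => q x / (q x - 1)).
Proof.
rewrite (_ : (fun x => _) = (fun x => q x * (q x - 1) `^ (-1))).
  apply: measurable_funM => //; apply: measurable_powR2 => //.
  exact: measurable_funB.
by apply/funext => x; rewrite powR_inv1// subr_ge0 ltW.
Qed.

Lemma conj_ge x : hi / (hi - 1) <= q x / (q x - 1).
Proof.
exact: conj_antimono (qhi x).
Qed.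

Lemma conj_le x : q x / (q x - 1) <= lo / (lo - 1).
Proof.
exact: conj_antimono (loq x).
Qed.

Lemma conj_gt1 x : 1 < q x / (q x - 1).
Proof. by have h1 := q1 x; rewrite ltr_pdivlMr; lra. Qed.

Lemma integ_pow_scale_le1 A h c : measurable A -> nnm h -> 0 <= c -> c <= 1 ->
  (integ mu A (fun x => (c * h x) `^ q x)%R <=
   (c `^ lo)%:E * integ mu A (fun x => h x `^ q x)%R)%E.
Proof.
move=> mA hh c0 c1; rewrite -integZ ?powR_ge0//; last exact: nnm_pow.
apply: le_integ => //; first by apply: nnm_pow; exact: nnmZ.
  by apply: nnmZ; [exact: powR_ge0|exact: nnm_pow].
move=> x _; apply: powR_scale_le1 => //; last exact: nnm_ge0.
by apply: lt_trans lo1.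
Qed.

Lemma integ_pow_scale_ge1 A h c : measurable A -> nnm h -> 1 <= c ->
  (integ mu A (fun x => (c * h x) `^ q x)%R <=
   (c `^ hi)%:E * integ mu A (fun x => h x `^ q x)%R)%E.
Proof.
move=> mA hh c1; rewrite -integZ ?powR_ge0//; last exact: nnm_pow.
have c0 : 0 <= c by lra.
apply: le_integ => //; first by apply: nnm_pow; exact: nnmZ.
  by apply: nnmZ; [exact: powR_ge0|exact: nnm_pow].
by move=> x _; apply: powR_scale_ge1 => //; exact: nnm_ge0.
Qed.

Lemma le_integ_pow A g h : measurable A -> nnm g -> nnm h ->
  (forall x, A x -> g x <= h x) ->
  (integ mu A (fun x => g x `^ q x)%R <= integ mu A (fun x => h x `^ q x)%R)%E.
Proof.
move=> mA gg hh gh; apply: le_integ => //; try exact: nnm_pow.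
move=> x Ax; apply: powR_le_base (gh _ Ax); last exact: nnm_ge0.
exact: ltW.
Qed.

(** The converse of Hoelder's inequality. Choose [c] so that the modular of
    [c * u] is comparable to [1]. By Young's inequality, with the large
    parameter [E], the pairing of [c * h] with [Y] is at most
    [c * E `^ hi + C / E]. The last term is too small to account for the
    modular of [c * u], so [c] is bounded below, and the modular of [u] is
    bounded above. *)
Lemma modular_of_duality (C : R) : 1 <= C -> exists C', 1 <= C' /\
  forall A u h, measurable A -> nnm u -> nnm h ->
  (integ mu A (fun x => h x `^ q x)%R <= 1)%E ->
  (integ mu A (fun x => u x `^ q x)%R < +oo)%E ->
  (forall c, 0 < c -> c <= 1 ->
    (integ mu A (fun x => (c * u x) `^ q x)%R <= 1)%E ->
    exists Y, [/\ nnm Y,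
      (integ mu A (fun x => Y x `^ (q x / (q x - 1)))%R <= C%:E)%E &
      (integ mu A (fun x => (c * u x) `^ q x)%R <=
        integ mu A (fun x => c * h x * Y x)%R)%E]) ->
  (integ mu A (fun x => u x `^ q x)%R <= C'%:E)%E.
Proof.
move=> C1; pose B : R := 2 `^ hi; pose E := 2 * B * C.
pose c0 : R := (2 * B * E `^ hi)^-1.
have hi0 : 0 <= hi.
  by apply: le_trans lohi; apply: ltW; apply: lt_trans lo1.
have B1 : 1 <= B by apply: powR_ge1 => //; rewrite ler1n.
have E1 : 1 <= E by have := mulr_ege1 B1 C1; rewrite /E -mulrA; lra.
have Eh0 : 1 <= E `^ hi by apply: powR_ge1.
have BE1 : 1 <= 2 * B * E `^ hi.
  by have := mulr_ege1 B1 Eh0; rewrite -mulrA; lra.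
have BE : 0 < 2 * B * E `^ hi by lra.
have c00 : 0 < c0 by rewrite invr_gt0.
have c01 : c0 <= 1 by rewrite invf_le1.
exists (Num.max 1 (c0^-1 `^ hi)); split; first by rewrite le_max lexx.
move=> A u h mA uu hh h1 ufin dual.
pose J c := integ mu A (fun x => (c * u x) `^ q x).
have J1 : J 1 = integ mu A (fun x => u x `^ q x).
  by apply: eq_integ => x _; rewrite mul1r.
have nJ c : 0 <= c -> nnm (fun x => (c * u x) `^ q x).
  by move=> ?; apply: nnm_pow; exact: nnmZ.
rewrite -J1 in ufin *; have [JJ1|JJ1] := leP (J 1) 1%E.
  by rewrite (le_trans JJ1)// lee_fin le_max lexx.
have Jle a b : 0 < a -> a <= b -> (J a <= J b)%E.
  move=> a0 ab; have b0 : 0 < b by apply: lt_le_trans ab.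
  apply: le_integ_pow => //; try exact/nnmZ/uu/ltW.
  by move=> x _; rewrite ler_wpM2r// nnm_ge0.
have J1E : J 1 = (fine (J 1))%:E.
  by rewrite fineK// ge0_fin_numE//; exact/integ_ge0/nJ.
have F1 : 1 < fine (J 1) by rewrite -lte_fin -J1E.
have F0 : 0 < (fine (J 1))^-1 by rewrite invr_gt0; lra.
have Fle1 : (fine (J 1))^-1 <= 1 by rewrite invf_le1; lra.
have Jk0 : (J (fine (J 1))^-1%R <= 1)%E.
  apply: le_trans (integ_pow_scale_le1 mA uu (ltW F0) Fle1) _.
  rewrite -J1 J1E -EFinM lee_fin.
  apply: (@le_trans _ _ ((fine (J 1))^-1 * fine (J 1))); last first.
    by rewrite mulVf// gt_eqF//; lra.
  rewrite ler_pM2r; last lra.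
  by rewrite -[leRHS]powRr1 ?(ltW F0)//; apply: powR_exp_le1 => //; exact: ltW.
have [c [kc Jc Jc2]] := crossing F0 Jle Jk0 ltr01 JJ1.
have cp : 0 < c by apply: lt_le_trans kc.
have c1 : c <= 1.
  rewrite leNgt; apply/negP => c1.
  by have := lt_le_trans JJ1 (Jle _ _ ltr01 (ltW c1)); rewrite ltNge Jc.
have JB : (1 < B%:E * J c)%E.
  apply: lt_le_trans Jc2 _; rewrite /J.
  under eq_integ do rewrite -mulrA.
  apply: integ_pow_scale_ge1 => //; [exact/nnmZ/uu/ltW|lra].
have [Y [hY YC uY]] := dual c cp c1 Jc.
have E0 : 0 < E by lra.
have Ei1 : E^-1 <= 1 by rewrite invf_le1.
have Ei0 : 0 < E^-1 by rewrite invr_gt0.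
have mY : nnm (fun x => Y x `^ (q x / (q x - 1))).
  by apply: nnm_powR; [exact: nnm_meas|exact: measurable_conj].
have : (J c <= integ mu A (fun x => c * E `^ hi * (h x `^ q x) +
    E^-1 * (Y x `^ (q x / (q x - 1))))%R)%E.
  apply: le_trans uY _; apply: le_integ => //.
  - by apply: nnmM => //; apply: nnmZ => //; exact: ltW.
  - by apply: nnmD; apply: nnmZ => //; try exact: nnm_pow;
      rewrite ?mulr_ge0 ?powR_ge0 ?ltW.
  move=> x _; have hx := nnm_ge0 x hh; have Yx := nnm_ge0 x hY.
  have E00 := ltW E0; have Ei00 := ltW Ei0; have cp0 := ltW cp.
  have -> : c * h x * Y x = (c * (E * h x)) * (E^-1 * Y x) by field; lra.
  have Eh : 0 <= E * h x by rewrite mulr_ge0.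
  have cEh : 0 <= c * (E * h x) by rewrite mulr_ge0.
  have EY : 0 <= E^-1 * Y x by rewrite mulr_ge0.
  apply: le_trans (young_powR (q1 x) cEh EY) _; apply: lerD.
    apply: le_trans (powR_scale_le1 ltr01 (ltW (q1 x)) cp0 c1 Eh) _.
    by rewrite powRr1// -mulrA ler_pM2l//; exact: powR_scale_ge1.
  apply: le_trans (powR_scale_le1 ltr01 (ltW (conj_gt1 x)) Ei00 Ei1 Yx) _.
  by rewrite powRr1.
rewrite integD//; last 2 first.
  by apply: nnmZ; [rewrite mulr_ge0 ?powR_ge0 ?ltW|exact: nnm_pow].
  by apply: nnmZ => //; exact: ltW.
rewrite !integZ ?mulr_ge0 ?powR_ge0 ?(ltW cp) ?(ltW Ei0)//; last exact: nnm_pow.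
move=> Jle2.
have cp0 := ltW cp; have Ei00 := ltW Ei0.
have cE0 : 0 <= c * E `^ hi by rewrite mulr_ge0// powR_ge0.
have {}Jle2 : (J c <= (c * E `^ hi + E^-1 * C)%:E)%E.
  apply: le_trans Jle2 _; rewrite EFinD; apply: leeD.
    by rewrite -[leRHS]mule1; apply: lee_wpmul2l; rewrite ?lee_fin.
  by rewrite EFinM; apply: lee_wpmul2l; rewrite ?lee_fin.
have JcE : J c = (fine (J c))%:E.
  rewrite fineK// ge0_fin_numE; first by apply: le_lt_trans Jc _; rewrite ltry.
  exact/integ_ge0/nJ.
(* [E] was chosen to make [B * C / E] equal to one half. *)
have c0c : c0 <= c.
  move: JB Jle2; rewrite JcE -EFinM lte_fin lee_fin => JB Jle2.
  have EC : E^-1 * C = (2 * B)^-1 by rewrite /E; field; lra.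
  have B2 : B * (2 * B)^-1 = 1 / 2 by field; lra.
  have : B * fine (J c) <= B * (c * E `^ hi) + B * (2 * B)^-1.
    by rewrite -mulrDr -EC ler_pM2l//; lra.
  rewrite B2 => hB; rewrite /c0 -div1r ler_pdivrMr//; lra.
have ci0 : 0 <= c^-1 by rewrite invr_ge0.
have hcu : nnm (fun x => c * u x) by exact: nnmZ.
have ci1 : 1 <= c^-1 by rewrite invf_ge1.
apply: (@le_trans _ _ ((c^-1 `^ hi)%:E * J c)%E).
  rewrite J1; apply: le_trans (_ : _ <= integ mu A
    (fun x => (c^-1 * (c * u x)) `^ q x)%R)%E _.
    apply: le_integ_pow => //; first exact: nnmZ.
    by move=> x _; rewrite mulKf// gt_eqF.
  exact: integ_pow_scale_ge1.
rewrite -[leRHS]mule1; apply: lee_pmul => //.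
- by rewrite lee_fin powR_ge0.
- exact/integ_ge0/nJ.
rewrite lee_fin le_max; apply/orP; right; apply: powR_le_base => //.
by rewrite lef_pV2.
Qed.

End Duality.

(** * Averaging over disjoint cubes of a grid *)

Section SeqUnion.
Context {R : realType} {d : measure_display} {T : measurableType d}.
Variable mu : {measure set T -> \bar R}.

Lemma integU_le A B (h : T -> R) : measurable A -> measurable B -> nnm h ->
  (integ mu (A `|` B) h <= integ mu A h + integ mu B h)%E.
Proof.
move=> mA mB hh; have -> : A `|` B = A `|` (B `\` A).
  apply/seteqP; split => x [Ax|]; [by left| |by left|by case; right].
  by move=> Bx; have [Ax|nAx] := pselect (A x); [left|right].
rewrite integU//; [|exact: measurableD|by rewrite setDIK].
by rewrite leeD2l//; apply: subset_integ => //; exact: measurableD.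
Qed.

Lemma union_cons (Q : set T) L : union [set` Q :: L] = Q `|` union [set` L].
Proof.
apply/seteqP; split => [x [P /=]|x [Qx|[P /= PL Px]]].
- by rewrite inE => /predU1P[-> Qx|PL Px]; [left|right; exists P].
- by exists Q => //=; rewrite mem_head.
- by exists P => //=; rewrite inE PL orbT.
Qed.

Lemma union_nil : union [set` [::] : seq (set T)] = set0.
Proof. by apply/seteqP; split => // x [P]. Qed.

Lemma union_seq_fin (L : seq (set T)) h : nnm h ->
  (forall Q, Q \in L -> measurable Q /\ (integ mu Q h < +oo)%E) ->
  measurable (union [set` L]) /\ (integ mu (union [set` L]) h < +oo)%E.
Proof.
move=> hh; elim: L => [|Q L IH] hL; first by rewrite union_nil integ_set0.
have [mQ fQ] := hL Q (mem_head _ _).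
have [mL fL] : measurable (union [set` L]) /\
    (integ mu (union [set` L]) h < +oo)%E.
  by apply: IH => P PL; apply: hL; rewrite inE PL orbT.
rewrite union_cons; split; first exact: measurableU.
by apply: le_lt_trans (integU_le mQ mL hh) _; rewrite lte_add_pinfty.
Qed.

End SeqUnion.

Section Grids.
Context {R : realType} {d : measure_display} {T : measurableType d}.
Variable mu : {measure set T -> \bar R}.

Definition cube (D : int -> set (set T)) (Q : set T) := exists k, D k Q.

(** The part of the structure of one dyadic grid on which the estimates
    rest. *)
Record grid (D : int -> set (set T)) (eps : R) : Prop := Grid {
  grid_eps : 0 < eps <= 1 ;
  grid_measurable : forall Q, cube D Q -> measurable Q ;
  grid_gt0 : forall Q, cube D Q -> (0 < mu Q)%E ;
  grid_fin : forall Q, cube D Q -> (mu Q < +oo)%E ;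
  grid_countable : countable (cube D) ;
  grid_cover : forall k x, exists2 Q, D k Q & Q x ;
  grid_nested : forall k l Q Q' x, (k <= l)%R -> D k Q -> D l Q' ->
    Q x -> Q' x -> Q' `<=` Q ;
  grid_child : forall k Q Q', D k Q -> D (k + 1)%R Q' -> Q' `<=` Q ->
    (eps%:E * mu Q <= mu Q')%E }.

Definition packing (D : int -> set (set T)) (F : set (set T)) :=
  F `<=` cube D /\ forall Q Q' x, F Q -> F Q' -> Q x -> Q' x -> Q = Q'.

(** Boundedness of the averaging operators, in modular form. The function [v]
    stands for the means of [g] over the cubes of [F]. *)
Definition averaging_bounded (D : int -> set (set T)) (q : T -> R) (C : R) :=
  forall F g v, packing D F -> nnm g -> nnm v ->
    (integ mu (union F) (fun x => g x `^ q x)%R <= 1)%E ->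
    (forall Q x, F Q -> Q x -> ((v x)%:E * mu Q <= integ mu Q g)%E) ->
    (integ mu (union F) (fun x => v x `^ q x)%R <= C%:E)%E.

(** The same for means in [L^s]. This is boundedness of the averaging
    operators for the exponent [q / s], as one sees by writing [g] for
    [g `^ s]. *)
Definition power_averaging_bounded (D : int -> set (set T)) (q : T -> R)
    (s C : R) :=
  forall F g u, packing D F -> nnm g -> nnm u ->
    (integ mu (union F) (fun x => g x `^ q x)%R <= 1)%E ->
    (forall Q x, F Q -> Q x ->
      ((u x `^ s)%:E * mu Q <= integ mu Q (fun x => g x `^ s)%R)%E) ->
    (integ mu (union F) (fun x => u x `^ q x)%R <= C%:E)%E.

Variables (D : int -> set (set T)) (eps : R).
Hypothesis gD : grid D eps.

Lemma cube_measure Q : cube D Q -> exists2 m : R, 0 < m & mu Q = m%:E.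
Proof.
move=> cQ; have Q0 := grid_gt0 gD cQ; have Qf := grid_fin gD cQ.
have E : mu Q = (fine (mu Q))%:E by rewrite fineK// ge0_fin_numE// ltW.
by exists (fine (mu Q)) => //; rewrite -lte_fin -E.
Qed.

Lemma same_generation k Q Q' x : D k Q -> D k Q' -> Q x -> Q' x -> Q = Q'.
Proof.
move=> DQ DQ' Qx Q'x; apply/seteqP; split.
  exact: (grid_nested gD (lexx k) DQ' DQ Q'x Qx).
exact: (grid_nested gD (lexx k) DQ DQ' Qx Q'x).
Qed.

Lemma generation_packing k F : F `<=` D k -> packing D F.
Proof.
move=> FD; split => [Q /FD DQ|Q Q' x /FD DQ /FD DQ' Qx Q'x].
  by exists k.
exact (same_generation DQ DQ' Qx Q'x).
Qed.

Lemma packing_family F : packing D F -> family F.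
Proof.
move=> [FD dF]; split => // [|Q /FD]; last exact: (grid_measurable gD).
exact: sub_countable (subset_card_le FD) (grid_countable gD).
Qed.

Lemma sub_packing F F' : F' `<=` F -> packing D F -> packing D F'.
Proof.
move=> FF [FD dF]; split; first exact: subset_trans FD.
by move=> Q Q' x /FF FQ /FF; exact: dF.
Qed.

Lemma packing1 Q : cube D Q -> packing D [set Q].
Proof. by move=> cQ; split => [_ -> //|_ _ x -> ->]. Qed.

Lemma union1 (Q : set T) : union [set Q] = Q.
Proof. by rewrite /union bigcup_set1. Qed.

Section Exponent.
Variables (q : T -> R) (lo : R).
Hypotheses (mq : measurable_fun [set: T] q) (lo1 : 1 < lo)
  (loq : forall x, lo <= q x).

Let q1 x : 1 < q x. Proof. exact: lt_le_trans (loq x). Qed.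

Lemma integ_fin_of_pow Q h : cube D Q -> nnm h ->
  (integ mu Q (fun x => h x `^ q x)%R < +oo)%E -> (integ mu Q h < +oo)%E.
Proof.
move=> cQ hh fh; have mQ := grid_measurable gD cQ.
have n1 : nnm (fun _ : T => 1 : R) by exact: nnm_cst.
have np : nnm (fun x => h x `^ q x) by exact: nnm_pow.
apply: (@le_lt_trans _ _ (integ mu Q (fun x => 1 + h x `^ q x)%R)).
  apply: le_integ => //; first exact: nnmD.
  move=> x _; have [h1|h1] := leP 1 (h x).
    rewrite (le_trans (le1r_powR h1 (ltW (q1 x))))//; lra.
  by rewrite (le_trans (ltW h1))// lerDl powR_ge0.
by rewrite integD// lte_add_pinfty// integ_cst// mul1e (grid_fin gD).
Qed.

End Exponent.

Section ConjugateExponent.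
Variables (q : T -> R) (lo hi : R).
Hypotheses (mq : measurable_fun [set: T] q) (lo1 : 1 < lo) (lohi : lo <= hi)
  (loq : forall x, lo <= q x) (qhi : forall x, q x <= hi).

Let q1 x : 1 < q x. Proof. exact: lt_le_trans (loq x). Qed.

Lemma cubeof_nnm F (phi : set T -> R) : packing D F ->
  (forall Q, 0 <= phi Q) -> nnm (fun x => phi (cubeof F x)).
Proof. by move=> pF; exact/nnm_cubeof/packing_family. Qed.

Lemma cube_avgE Q h : cube D Q -> nnm h -> (integ mu Q h < +oo)%E ->
  ((avg mu Q h)%:E * mu Q)%E = integ mu Q h.
Proof.
by move=> cQ hh fh; apply: avgE => //; [exact: (grid_gt0 gD)|exact: (grid_fin gD)].
Qed.

Lemma integ_cst_fin Q (h : T -> R) (c : R) : cube D Q ->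
  (forall x, Q x -> h x = c) -> (integ mu Q h < +oo)%E.
Proof.
move=> cQ hc; rewrite (@eq_integ _ _ _ mu Q h (fun=> c))//.
rewrite integ_cst; last exact: (grid_measurable gD).
rewrite -[mu Q]fineK ?ge0_fin_numE//; last exact: (grid_fin gD).
by rewrite -EFinM ltry.
Qed.

Let q' x := q x / (q x - 1).

(** Let [w] be the [L^s] mean of [g] on the cubes of [F], and let [y] be the
    mean of [f = (c * w) `^ (q - 1)], whose modular for the conjugate exponent
    is controlled by the averaging operators for that exponent. On each cube
    the integral of [(c * w) `^ q] equals that of
    [c * g * (y * (g / w) `^ (s - 1))]. With [k = (g / w) `^ s], which has mean
    at most [1], the last factor is [k `^ ((s - 1) / s)], so duality applies
    as soon as this factor does no harm to [y]. *)
Lemma power_averaging_of_dual (s C2 C4 : R) : 1 <= s -> s <= lo -> 1 <= C4 ->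
  averaging_bounded D q' C2 ->
  (forall F y k, packing D F -> nnm y -> nnm k ->
    (forall Q x x', F Q -> Q x -> Q x' -> y x = y x') ->
    (forall Q, F Q -> (integ mu Q k <= mu Q)%E) ->
    (integ mu (union F) (fun x => y x `^ q' x)%R <= C2%:E)%E ->
    (integ mu (union F) (fun x => (y x * k x `^ ((s - 1) / s)) `^ q' x)%R <=
      C4%:E)%E) ->
  exists C', 1 <= C' /\ power_averaging_bounded D q s C'.
Proof.
move=> s1 slo C41 HA' HY.
have hi1 : 1 < hi by apply: lt_le_trans lohi.
have l1 : 1 < hi / (hi - 1) by rewrite ltr_pdivlMr; lra.
have mq' : measurable_fun setT q' := measurable_conj mq lo1 loq.
have lq' : forall x, hi / (hi - 1) <= q' x := conj_ge lo1 loq qhi.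
have [C5 [C51 dual]] := modular_of_duality mu mq lo1 lohi loq qhi C41.
exists C5; split => // F g u pF hg hu g1 hug.
have s0 : 0 < s by lra.
have pw (f : T -> R) (e : R) : nnm f -> nnm (fun x => f x `^ e).
  by move=> hf; apply: nnm_powR => //; exact: nnm_meas.
have pq (f : T -> R) : nnm f -> nnm (fun x => f x `^ q x) by exact: nnm_pow.
(* Over finitely many cubes the modular of [w] is finite, which the duality
   lemma needs. *)
apply: (integ_union_fin (packing_family pF) (pq _ hu)).
move=> Ls LF; set G := [set` Ls].
have GF : G `<=` F by move=> Q /LF.
have pG := sub_packing GF pF; have fG := packing_family pG.
have mG := measurable_union fG.
have mF := measurable_union (packing_family pF).
have UG : union G `<=` union F by move=> x [Q GQ Qx]; exists Q => //; exact: GF.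
have gG1 : (integ mu (union G) (fun x => g x `^ q x)%R <= 1)%E.
  by apply: le_trans g1; apply: subset_integ => //; exact: pq.
have n1 : nnm (fun _ : T => 1 : R) by exact: nnm_cst.
have hgs := pw _ s hg.
have gsQ Q : G Q -> (integ mu Q (fun x => g x `^ s)%R < +oo)%E.
  move=> GQ; have cQ := pG.1 _ GQ; have mQ := grid_measurable gD cQ.
  apply: (@le_lt_trans _ _ (integ mu Q (fun x => 1 + g x `^ q x))).
    apply: le_integ => //; first by apply: nnmD => //; exact: pq.
    move=> x Qx; have gx := nnm_ge0 x hg; have sq : s <= q x by exact: le_trans (loq x).
    have [ge1|/ltW gle1] := leP 1 (g x).
      by apply: le_trans (ler_powR ge1 sq) _; rewrite lerDr.
    by apply: le_trans (powR_le1 (ltW s0) gx gle1) _; rewrite lerDl powR_ge0.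
  rewrite integD//; last exact: pq.
  rewrite lte_add_pinfty// ?integ_cst// ?mul1e ?(grid_fin gD)//.
  apply: le_lt_trans (ltry 1); apply: le_trans gG1; apply: subset_integ => //.
    exact: pq.
  by move=> x Qx; exists Q.
pose phi Q := avg mu Q (fun x => g x `^ s) `^ s^-1.
pose w x := phi (cubeof G x).
have hw : nnm w by apply: (cubeof_nnm (phi := phi)) => // Q; exact: powR_ge0.
have wE Q x : G Q -> Q x -> w x = phi Q.
  by move=> GQ Qx; rewrite /w (cubeofE fG GQ Qx).
have phis Q : G Q -> ((phi Q `^ s)%:E * mu Q = integ mu Q (fun x => g x `^ s)%R)%E.
  move=> GQ; rewrite powR_rootK//; last exact: avg_ge0.
  by rewrite (cube_avgE (pG.1 _ GQ))//; exact: gsQ.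
apply: (@le_trans _ _ (integ mu (union G) (fun x => w x `^ q x))).
  apply: (le_integ_pow mu mq lo1 loq) => // x [Q GQ Qx].
  have cQ := pG.1 _ GQ; have := hug Q x (GF _ GQ) Qx.
  rewrite -(phis _ GQ) (wE _ _ GQ Qx); have [m m0 ->] := cube_measure cQ.
  rewrite -!EFinM lee_fin ler_pM2r//.
  by rewrite powR_le_baseP//; [exact: nnm_ge0|exact: powR_ge0].
apply: (dual _ _ g) => //.
  have [] // := @union_seq_fin _ _ _ mu Ls (fun x => w x `^ q x) _ _.
    exact: pq.
  move=> Q LQ; have cQ := pG.1 _ LQ; split; first exact: (grid_measurable gD).
  pose K := (1 + phi Q) `^ hi.
  apply: le_lt_trans (integ_cst_fin (h := fun=> K) cQ _) => //.
  apply: le_integ => //; [exact: (grid_measurable gD)|exact: pq| |].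
    by apply: nnm_cst; exact: powR_ge0.
  have a0 : 0 <= phi Q by exact: powR_ge0.
  move=> x Qx; rewrite (wE _ _ LQ Qx) /K.
  apply: (@le_trans _ _ ((1 + phi Q) `^ q x)).
    by apply: powR_le_base => //; [rewrite ltW// (lt_trans ltr01)|lra].
  by apply: ler_powR => //; lra.
move=> c c0 c1 cw1; have c00 := ltW c0.
pose f x := (c * w x) `^ (q x - 1).
have hf : nnm f.
  apply: nnm_powR; first exact/nnm_meas/nnmZ.
  exact: measurable_funB.
pose y x := avg mu (cubeof G x) f.
have hy : nnm y by apply: (cubeof_nnm (phi := fun Q => avg mu Q f)) => // Q; exact: avg_ge0.
have fE x : f x `^ q' x = (c * w x) `^ q x.
  rewrite /f /q' -powRrM; congr (_ `^ _); have := q1 x => ?; field; lra.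
have fQ Q : G Q -> (integ mu Q f < +oo)%E.
  move=> GQ; have cQ := pG.1 _ GQ; have mQ := grid_measurable gD cQ.
  apply: (integ_fin_of_pow mq' l1 lq') => //.
  under eq_integ do rewrite fE.
  apply: le_lt_trans (ltry 1); apply: le_trans cw1; apply: subset_integ => //.
    by apply: pq; exact: nnmZ.
  by move=> x Qx; exists Q.
have yE Q x : G Q -> Q x -> y x = avg mu Q f.
  by move=> GQ Qx; rewrite /y (cubeofE fG GQ Qx).
have y1 : (integ mu (union G) (fun x => y x `^ q' x)%R <= C2%:E)%E.
  apply: (HA' G f) => //.
    by under eq_integ do rewrite fE.
  by move=> Q x GQ Qx; rewrite (yE _ _ GQ Qx) cube_avgE//; [exact: pG.1|exact: fQ].
have hwi : nnm (fun x => (w x)^-1).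
  rewrite (_ : (fun x => _) = fun x => w x `^ (-1)); first exact: pw.
  by apply/funext => x; rewrite powR_inv1// nnm_ge0.
have hgw : nnm (fun x => g x * (w x)^-1) by exact: nnmM.
pose k x := (g x * (w x)^-1) `^ s; have hk : nnm k by exact: pw.
have kQ Q : G Q -> (integ mu Q k <= mu Q)%E.
  move=> GQ; have cQ := pG.1 _ GQ; have mQ := grid_measurable gD cQ.
  rewrite (@eq_integ _ _ _ mu Q _ (fun x => ((phi Q)^-1) `^ s * g x `^ s)).
    rewrite integZ ?powR_ge0// -phis// muleA -EFinM -powRM ?invr_ge0 ?powR_ge0//.
    rewrite -[leRHS]mul1e; apply: lee_wpmul2r; first exact: measure_ge0.
    rewrite lee_fin; apply: powR_le1; [exact: ltW|by rewrite mulr_ge0 ?invr_ge0 ?powR_ge0|].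
    have [->|p0] := eqVneq (phi Q) 0; first by rewrite mulr0.
    by rewrite mulVf.
  move=> x Qx; rewrite /k (wE _ _ GQ Qx) mulrC powRM ?invr_ge0 ?powR_ge0//.
  exact: nnm_ge0.
have nY : nnm (fun x => y x * k x `^ ((s - 1) / s)) by apply: nnmM => //; exact: pw.
exists (fun x => y x * k x `^ ((s - 1) / s)); split => //.
  apply: HY => // Q x x' GQ Qx Qx'; by rewrite (yE _ _ GQ Qx) (yE _ _ GQ Qx').
apply: integ_union_le => //.
- by apply: pq; exact: nnmZ.
- by apply: nnmM => //; exact: nnmZ.
move=> Q GQ; have cQ := pG.1 _ GQ; have mQ := grid_measurable gD cQ.
have a0 := avg_ge0 mu Q hf; have p0 : 0 <= phi Q by exact: powR_ge0.
have cp0 : 0 <= c * phi Q by exact: mulr_ge0.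
have -> : integ mu Q (fun x => (c * w x) `^ q x) =
    integ mu Q (fun x => c * phi Q * f x).
  apply: eq_integ => x Qx; rewrite -(wE _ _ GQ Qx) /f mulr_powRB1//.
    by rewrite mulr_ge0// nnm_ge0.
  by rewrite (lt_trans ltr01).
rewrite (integZ mu mQ cp0 hf) -(cube_avgE cQ hf (fQ _ GQ)).
have cy0 : 0 <= c * avg mu Q f * phi Q `^ (1 - s).
  by rewrite mulr_ge0 ?powR_ge0// mulr_ge0.
have [pz|pnz] := eqVneq (phi Q) 0.
  rewrite pz mulr0 mul0e; apply: integ_ge0.
  by apply: nnmM => //; exact: nnmZ.
have -> : integ mu Q (fun x => c * g x * (y x * k x `^ ((s - 1) / s))) =
    integ mu Q (fun x => c * avg mu Q f * phi Q `^ (1 - s) * g x `^ s).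
  apply: eq_integ => x Qx; rewrite /k (yE _ _ GQ Qx) (wE _ _ GQ Qx).
  have gx := nnm_ge0 x hg; rewrite -powRrM mulrC (mulrCA s) mulfV ?gt_eqF// mulr1.
  rewrite powRM ?invr_ge0// -(mulr_powRB1 gx s0) -powR_inv1// -powRrM.
  have -> : -1 * (s - 1) = 1 - s by ring.
  by ring.
rewrite (integZ mu mQ cy0 hgs) -(phis _ GQ) !muleA -!EFinM.
rewrite le_eqVlt; apply/orP; left; apply/eqP; congr (_%:E * _)%E.
rewrite -[RHS]mulrA -powRD ?pnz ?implybT//.
by rewrite subrK powRr1//; ring.
Qed.

End ConjugateExponent.

Section Conjugate.
Variables (q : T -> R) (lo hi : R).
Hypotheses (mq : measurable_fun [set: T] q) (lo1 : 1 < lo) (lohi : lo <= hi)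
  (loq : forall x, lo <= q x) (qhi : forall x, q x <= hi).

(** Averaging operators are self-adjoint: this is the case [s = 1] of the
    previous lemma, with the two exponents interchanged. *)
Lemma averaging_bounded_conj (C : R) : 1 <= C -> averaging_bounded D q C ->
  exists C', 1 <= C' /\ averaging_bounded D (fun x => q x / (q x - 1)) C'.
Proof.
move=> C1 HA.
have hi1 : 1 < hi by apply: lt_le_trans lohi.
have l1 : 1 < hi / (hi - 1) by rewrite ltr_pdivlMr; lra.
have lh : hi / (hi - 1) <= lo / (lo - 1) by exact: conj_antimono.
have qK : (fun x => q x / (q x - 1) / (q x / (q x - 1) - 1)) = q.
  by apply/funext => x; have ? := lt_le_trans lo1 (loq x); field; lra.
have := @power_averaging_of_dual _ _ _ (measurable_conj mq lo1 loq) l1 lh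
  (conj_ge lo1 loq qhi) (conj_le lo1 loq) 1 C C (lexx 1) (ltW l1) C1.
rewrite qK => /(_ HA)[F y k pF hy hk yc kQ yC|C' [C'1 H]].
  apply: le_trans yC; rewrite le_eqVlt; apply/orP; left; apply/eqP.
  apply: eq_integ => x _; rewrite subrr mul0r powRr0 mulr1.
  by have := congr1 (@^~ x) qK => /= ->.
exists C'; split => // F g v pF hg hv g1 vg; apply: (H F g v) => // Q x FQ Qx.
rewrite powRr1; last exact: nnm_ge0.
rewrite (@eq_integ _ _ _ mu Q _ g); first exact: vg.
by move=> z _; rewrite powRr1// nnm_ge0.
Qed.

End Conjugate.
End Grids.

(** * Stopping cubes *)

Section Stopping.
Context {R : realType} {d : measure_display} {T : measurableType d}.
Variable mu : {measure set T -> \bar R}.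
Variables (D : int -> set (set T)) (eps : R).
Hypothesis gD : grid mu D eps.

Lemma cube_nonempty Q : cube D Q -> exists x, Q x.
Proof.
move=> cQ; apply/set0P/eqP => Q0; have := grid_gt0 gD cQ.
by rewrite Q0 measure0 ltxx.
Qed.

Lemma cube_cmp Q Q' x : cube D Q -> cube D Q' -> Q x -> Q' x ->
  Q `<=` Q' \/ Q' `<=` Q.
Proof.
move=> [k Dk] [l Dl] Qx Q'x; have [kl|/ltW lk] := leP k l.
  by right; exact: (grid_nested gD kl Dk Dl Qx Q'x).
by left; exact: (grid_nested gD lk Dl Dk Q'x Qx).
Qed.

Variables (F : set (set T)) (h : T -> R) (lam : R).
Hypotheses (pF : packing D F) (hh : nnm h) (lam0 : 0 <= lam).

Definition hit (C : set T) := [/\ cube D C, exists2 Q, F Q & C `<=` Q &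
  (lam%:E * mu C < integ mu C h)%E].

Definition stopping := [set C | hit C /\
  forall C', hit C' -> C `<=` C' -> C' = C].

Lemma stopping_packing : packing D stopping.
Proof.
split=> [C [[]] //|C C' x [hC mC] [hC' mC'] Cx C'x].
have [cC _ _] := hC; have [cC' _ _] := hC'.
have [s|s] := cube_cmp cC cC' Cx C'x; first by rewrite (mC _ hC' s).
by rewrite (mC' _ hC s).
Qed.

(** Starting from the cube of [F] that contains [x], go down the generations
    and stop at the first hit. If this is not the cube of [F] itself, then its
    predecessor is no hit, and has measure at most [eps^-1] times larger. *)
Lemma hit_stopping C x : hit C -> C x -> exists C', [/\ stopping C', C `<=` C' &
  F C' \/ (integ mu C' h <= (lam / eps)%:E * mu C')%E].
Proof.
move=> hC Cx; have [cC [Q FQ CQ] lC] := hC.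
have cQ := pF.1 _ FQ; have [n Dn] := cQ; have [m Dm] := cC.
have Qx := CQ _ Cx.
pose P (j : nat) := `[< exists C', [/\ D (n + j%:Z) C', C' x & hit C'] >].
have CQE : m <= n -> C = Q.
  by move=> mn; apply/seteqP; split => //; exact: (grid_nested gD mn Dm Dn Cx Qx).
have exP : exists j, P j.
  have [mn|nm] := leP m n.
    exists 0%N; apply/asboolP; exists C; split => //.
    by rewrite addr0 (CQE mn).
  exists `|m - n|%N; apply/asboolP; exists C; split => //.
  by rewrite gez0_abs ?subr_ge0 1?ltW// addrCA subrr addr0.
case: (ex_minnP exP) => j /asboolP[C' [Dj C'x hC']] minj.
have Pbelow k C'' : D k C'' -> C'' x -> hit C'' -> n <= k -> n + j%:Z <= k.
  move=> Dk C''x h'' nk.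
  have kE : k = n + `|k - n|%N%:Z by rewrite gez0_abs ?subr_ge0// addrCA subrr addr0.
  rewrite kE lerD2l lez_nat; apply: minj; apply/asboolP; exists C''.
  by rewrite -kE.
have DnE C'' : D n C'' -> C'' x -> C'' = Q.
  move=> Dn'' C''x; apply/seteqP; split.
    exact: (grid_nested gD (lexx n) Dn Dn'' Qx C''x).
  exact: (grid_nested gD (lexx n) Dn'' Dn C''x Qx).
have above k C'' : D k C'' -> C'' x -> hit C'' -> k < n -> C'' = Q.
  move=> Dk C''x [_ [Q'' FQ'' CQ''] _] kn; apply/seteqP; split.
    by rewrite (pF.2 _ _ _ FQ FQ'' Qx (CQ'' _ C''x)).
  exact: (grid_nested gD (ltW kn) Dk Dn C''x Qx).
have hQj0 : hit Q -> C' = Q.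
  move=> hQ; have : n + j%:Z <= n by exact: (Pbelow n Q).
  rewrite gerDl lez_nat leqn0 => /eqP j0; apply: DnE => //.
  by rewrite j0 addr0 in Dj.
have sub C'' : hit C'' -> C'' x -> C'' `<=` C'.
  move=> h'' C''x; have [[k Dk] _ _] := h''.
  have [nk|kn] := leP n k.
    exact: (grid_nested gD (Pbelow k C'' Dk C''x h'' nk) Dj Dk C'x C''x).
  have E := above k C'' Dk C''x h'' kn; rewrite E in h'' *.
  by rewrite (hQj0 h'').
exists C'; split.
- split => // C'' h'' s; apply/seteqP; split => //; apply: sub => //.
  exact: s.
- exact: sub.
case: j => [|j] in Dj minj Pbelow hQj0 *.
  by left; rewrite (DnE C')//; rewrite addr0 in Dj.
right; have [P' DP P'x] := grid_cover gD (n + j%:Z) x.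
have DE : n + j.+1%:Z = n + j%:Z + 1 by rewrite -addrA -PoszD addn1.
have C'P : C' `<=` P'.
  apply: (grid_nested gD _ DP Dj P'x C'x).
  by rewrite lerD2l lez_nat.
have P'Q : P' `<=` Q.
  by apply: (grid_nested gD _ Dn DP Qx P'x); rewrite lerDl.
have cP : cube D P' by exists (n + j%:Z).
have nh : ~ hit P'.
  move=> hP; have : n + j.+1%:Z <= n + j%:Z by apply: Pbelow hP _ => //; rewrite lerDl.
  by rewrite lerD2l lez_nat ltnn.
have PI : (integ mu P' h <= lam%:E * mu P')%E.
  by rewrite leNgt; apply/negP => lP; apply: nh; split => //; exists Q.
have /andP[e0 e1] := grid_eps gD.
have cC' : cube D C' by case: hC'.
have := subset_integ mu (grid_measurable gD cC') (grid_measurable gD cP) hh C'P.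
move=> /le_trans; apply; apply: (le_trans PI).
rewrite EFinM -muleA; apply: lee_wpmul2l; first by rewrite lee_fin.
rewrite DE in Dj; have := grid_child gD DP Dj C'P.
rewrite -[mu P']fineK ?ge0_fin_numE ?(grid_fin gD)//.
rewrite -[mu C']fineK ?ge0_fin_numE ?(grid_fin gD)//.
by rewrite -!EFinM !lee_fin ler_pdivlMl.
Qed.

Lemma stopping_sub C : stopping C -> exists2 Q, F Q & C `<=` Q.
Proof. by case=> -[]. Qed.

Lemma stopping_low C : stopping C -> (lam%:E * mu C <= integ mu C h)%E.
Proof. by case=> -[_ _ /ltW]. Qed.

Lemma stopping_high C : stopping C ->
  F C \/ (integ mu C h <= (lam / eps)%:E * mu C)%E.
Proof.
move=> sC; have [hC mC] := sC; have [cC _ _] := hC.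
have [x Cx] := cube_nonempty cC.
have [C' [[hC' _] CC' H]] := hit_stopping hC Cx.
by rewrite -(mC _ hC' CC').
Qed.

End Stopping.

(** * A reverse Hoelder inequality *)

Section ReverseHolder.
Context {R : realType} {d : measure_display} {T : measurableType d}.
Variable mu : {measure set T -> \bar R}.
Variables (D : int -> set (set T)) (eps : R).
Hypothesis gD : grid mu D eps.

(** The consequence of Lebesgue's differentiation theorem that the stopping
    time arguments use: almost everywhere, [h] does not exceed a bound for
    all the means over small cubes around the point. *)
Definition differentiates := forall Q (h : T -> R) (lam : R) E, cube D Q ->
  nnm h -> 0 <= lam -> measurable E -> E `<=` Q -> (forall x, E x -> lam < h x) ->
  (forall C x, cube D C -> C `<=` Q -> C x -> E x ->
    (integ mu C h <= lam%:E * mu C)%E) -> mu E = 0%E.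

Hypothesis dD : differentiates.

Lemma integ_indic A E h : measurable A -> measurable E ->
  integ mu A (fun x => h x * \1_E x) = integ mu (A `&` E) h.
Proof.
move=> mA mE; rewrite !integE integral_mkcondr; apply: eq_integral => x _.
by rewrite patchE indicE; case: (x \in E); rewrite ?mulr1 ?mulr0.
Qed.

Lemma integ_null A h : measurable A -> nnm h -> mu A = 0%E -> integ mu A h = 0%E.
Proof.
by move=> mA hh A0; rewrite integE null_set_integral//; exact: nnm_emeas.
Qed.

(** Passing from the threshold [lam] to a threshold so much larger that a
    stopping cube at [lam] has mean at most half of it, at most half of each
    stopping cube survives, by Chebyshev. *)
Lemma stopping_half F k (lam lam' : R) C : packing D F -> nnm k ->
  (forall Q, F Q -> (integ mu Q k <= mu Q)%E) ->
  0 < lam -> 2 <= lam' -> lam / eps <= lam' / 2 ->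
  stopping mu D F k lam C ->
  (mu (C `&` union (stopping mu D F k lam')) <= (1 / 2)%:E * mu C)%E.
Proof.
move=> pF hk kF lam0 lam2 lam_le sC; set S := stopping mu D F k lam'.
have lam'0 : 0 < lam' by lra.
have /andP[e0 e1] := grid_eps gD.
have ll : lam <= lam'.
  have : lam <= lam / eps by rewrite ler_pdivlMr// ler_piMr// ltW.
  lra.
have pS : packing D S by exact: (stopping_packing gD).
have [[cC [Q FQ CQ] lC] maxC] := sC.
have mC := grid_measurable gD cC.
pose S' := S `&` [set C' | C' `<=` C].
have pS' : packing D S' by apply: sub_packing pS => C' [].
have fS' := packing_family gD pS'.
have mS' := measurable_union fS'.
have CS : C `&` union S `<=` union S'.
  move=> x [Cx [C' SC' C'x]]; exists C' => //; split => //=.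
  have [[cC' FC' lC'] _] := SC'.
  have [//|CC'] := cube_cmp gD cC' cC C'x Cx.
  suff -> : C' = C by [].
  apply: maxC => //; split => //; apply: le_lt_trans lC'.
  by apply: lee_wpmul2r; rewrite ?lee_fin// measure_ge0.
have S'C : union S' `<=` C by move=> x [C' [_ C'C]]; exact: C'C.
have mS := measurable_union (packing_family gD pS).
have kC : (integ mu C k <= (lam' / 2)%:E * mu C)%E.
  have [/kF FC|hC] := stopping_high gD pF hk (ltW lam0) sC.
    apply: le_trans FC _; rewrite -[leLHS]mul1e.
    by apply: lee_wpmul2r; rewrite ?lee_fin ?measure_ge0//; lra.
  by apply: le_trans hC _; apply: lee_wpmul2r; rewrite ?lee_fin ?measure_ge0.
have h1 : (lam'%:E * mu (union S') <= integ mu C k)%E.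
  rewrite -integ_cst//; apply: le_trans (subset_integ mu mS' mC hk S'C).
  apply: integ_union_le => //; first by apply: nnm_cst; exact: ltW.
  move=> C' [SC' _]; rewrite integ_cst; first exact: stopping_low SC'.
  by apply: (grid_measurable gD); case: SC' => -[].
have h2 := le_trans h1 kC.
apply: (@le_trans _ _ (mu (union S'))).
  by apply: le_measure; rewrite ?inE//; exact: measurableI.
have fin := grid_fin gD cC.
have fS : (mu (union S') < +oo)%E.
  by apply: le_lt_trans fin; apply: le_measure; rewrite ?inE.
move: h2; rewrite -[mu C]fineK ?ge0_fin_numE// -[mu (union S')]fineK ?ge0_fin_numE//.
rewrite -!EFinM !lee_fin => {}h2; rewrite -(ler_pM2l lam'0).
by apply: le_trans h2 _; lra.
Qed.

End ReverseHolder.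

Section Decay.
Context {R : realType} {d : measure_display} {T : measurableType d}.
Variable mu : {measure set T -> \bar R}.
Variables (D : int -> set (set T)) (eps : R).
Hypothesis gD : grid mu D eps.
Variables (q : T -> R) (lo hi : R).
Hypotheses (mq : measurable_fun [set: T] q) (lo1 : 1 < lo) (lohi : lo <= hi)
  (loq : forall x, lo <= q x) (qhi : forall x, q x <= hi).

Let q1 x : 1 < q x. Proof. exact: lt_le_trans (loq x). Qed.
Let lo0 : 0 < lo. Proof. by apply: lt_trans lo1. Qed.
Let hi0 : 0 < hi. Proof. exact: lt_le_trans lohi. Qed.

(** [e] converts between modulars and norms for the extreme exponents: with
    [B = 2 `^ hi] the constant [z] makes the final product [B * z * C] equal to
    one half. *)
Let decay_constants (B C : R) : 1 <= B -> 1 <= C -> exists z e eta c,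
  [/\ z = (2 * B * C)^-1, e `^ lo = z, e `^ hi = eta & c `^ hi = (1 - eta)^-1] /\
  [/\ 0 < e, e <= 1, 0 < eta, eta <= 1 / 2 & 1 < c].
Proof.
move=> B1 C1; have BC1 := mulr_ege1 B1 C1.
have [z zE] : exists z, z = (2 * B * C)^-1 by eexists.
have z0 : 0 < z by rewrite zE invr_gt0 -mulrA; lra.
have z2 : z <= 1 / 2.
  by rewrite zE div1r lef_pV2// ?posrE// -mulrA; lra.
have [e eE] : exists e, e = z `^ lo^-1 by eexists.
have e0 : 0 < e by rewrite eE; exact: powR_gt0.
have e1 : e <= 1.
  by rewrite eE; apply: powR_le1; [rewrite invr_ge0 ltW|exact: ltW|lra].
have elo : e `^ lo = z by rewrite eE; apply: powR_rootK => //; exact: ltW.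
have [eta etaE] : exists eta, eta = e `^ hi by eexists.
have eta0 : 0 < eta by rewrite etaE; exact: powR_gt0.
have eta2 : eta <= 1 / 2.
  by apply: le_trans z2; rewrite -elo etaE; apply: powR_exp_le1 => //; exact: ltW.
have ei1 : 1 < (1 - eta)^-1 by rewrite invf_gt1; lra.
exists z, e, eta, ((1 - eta)^-1 `^ hi^-1); split; split => //.
  by apply: powR_rootK => //; lra.
have hi'0 : 0 < hi^-1 by rewrite invr_gt0.
by have := powR_lt_base hi'0 ler01 ei1; rewrite powR1.
Qed.

(** A gain by a factor [c] at each step. Put [w = c ^+ m * y], and let [E] be
    the part of the [m]-th stopping set that is outside the next one. If [E]
    carries the share [eta] of the modular of [w], the next stopping set
    carries at most [1 - eta], which pays for the factor [c]. If not, then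
    [w] restricted to [E] and divided by [e] has modular at most [1]. Its mean
    on every stopping cube is at least [w / (2 * e)], because [E] fills half of
    the cube and [w] is constant there, and the averaging operators make
    the modular of [w] at most one half on the whole stopping set. *)
Lemma stopping_decay (C : R) : 1 <= C -> averaging_bounded mu D q C ->
  exists2 c : R, 1 < c & forall F k y (lam : nat -> R), packing D F -> nnm k ->
  nnm y -> (forall Q x x', F Q -> Q x -> Q x' -> y x = y x') ->
  (forall Q, F Q -> (integ mu Q k <= mu Q)%E) ->
  (forall m, [/\ 0 < lam m, 2 <= lam m.+1 & lam m / eps <= lam m.+1 / 2]) ->
  (integ mu (union F) (fun x => y x `^ q x)%R <= 1)%E ->
  forall m, (integ mu (union (stopping mu D F k (lam m)))
    (fun x => (c ^+ m * y x) `^ q x)%R <= 1)%E.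
Proof.
move=> C1 HA; have h2 : (1 : R) <= 2 by rewrite ler1n.
have [B BE] : exists B, B = 2 `^ hi :> R by eexists.
have B1 : 1 <= B by rewrite BE; apply: powR_ge1 => //; exact: ltW.
have BC1 := mulr_ege1 B1 C1.
have [z [e [eta [c [[zE elo ehi chi] [e0 e1 eta0 eta2 c1]]]]]] :=
  decay_constants B1 C1.
exists c => // F k y lam pF hk hy yc kF hlam y1.
pose Om m := union (stopping mu D F k (lam m)).
have pS m : packing D (stopping mu D F k (lam m)) by exact: (stopping_packing gD).
have mOm m : measurable (Om m) by exact: measurable_union (packing_family gD (pS m)).
have c0 : 0 <= c by rewrite ltW// (lt_trans ltr01).
have cm0 m : 0 <= c ^+ m by exact: exprn_ge0.
have npw m : nnm (fun x => (c ^+ m * y x) `^ q x).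
  by apply: nnm_pow => //; exact: nnmZ.
have OmU m : Om m `<=` union F.
  by move=> x [C' /stopping_sub[Q FQ CQ] C'x]; exists Q => //; exact: CQ.
have mU := measurable_union (packing_family gD pF).
have ep0 : 0 < eps by case/andP: (grid_eps gD).
have ep1 : eps <= 1 by case/andP: (grid_eps gD).
have lamS m : lam m <= lam m.+1.
  have [l0 l2 le] := hlam m.
  have : lam m <= lam m / eps by rewrite ler_pdivlMr// ler_piMr// ltW.
  lra.
have OmS m : Om m.+1 `<=` Om m.
  move=> x [C' [[cC' FC' lC'] _] C'x]; have [l0 _ _] := hlam m.
  have hC' : hit mu D F k (lam m) C'.
    split => //; apply: le_lt_trans lC'.
    by apply: lee_wpmul2r; rewrite ?lee_fin ?measure_ge0.
  have [C'' [S'' C'C'' _]] := hit_stopping gD pF hk (ltW l0) hC' C'x.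
  by exists C'' => //; exact: C'C''.
elim=> [|m IH].
  apply: le_trans y1; under eq_integ do rewrite expr0 mul1r.
  exact: (subset_integ mu (mOm 0) mU (nnm_pow mq hy) (OmU 0)).
pose w x := c ^+ m * y x; have hw : nnm w by exact: nnmZ.
pose E := Om m `\` Om m.+1; have mE : measurable E by exact: measurableD.
have EOm : E `<=` Om m by move=> x [].
have OmE : Om m = Om m.+1 `|` E.
  apply/seteqP; split => [x Omx|x [/OmS//|/EOm//]].
  by have [?|?] := pselect (Om m.+1 x); [left|right].
suff hS : (integ mu (Om m.+1) (fun x => w x `^ q x)%R <= (1 - eta)%:E)%E.
  apply: (@le_trans _ _ ((c `^ hi)%:E * (1 - eta)%:E)%E); last first.
    by rewrite -EFinM lee_fin chi mulVf// gt_eqF//; lra.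
  apply: (@le_trans _ _ (integ mu (Om m.+1) (fun x => (c * w x) `^ q x))).
    by rewrite (@eq_integ _ _ _ mu (Om m.+1) _ (fun x => (c * w x) `^ q x))// =>
      x _; rewrite /w exprS mulrA.
  apply: le_trans (integ_pow_scale_ge1 mu mq qhi (mOm _) hw (ltW c1)) _.
  by apply: lee_wpmul2l; rewrite ?lee_fin// powR_ge0.
have IHw : (integ mu (Om m) (fun x => w x `^ q x)%R <= 1)%E by exact: IH.
have [big|small] := leP eta%:E (integ mu E (fun x => w x `^ q x)).
  move: IHw; rewrite OmE integU//; [|exact: nnm_pow|]; last first.
    by rewrite /E setDIK.
  move=> IHw; rewrite EFinB leeBrDr//; apply: le_trans IHw.
  by rewrite leeD2l.
have g1 : 1 <= e^-1 by rewrite invf_ge1.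
pose g x := e^-1 * (w x * \1_E x).
have gg : nnm g.
  by apply: nnmZ; [lra|apply: nnmM => //; exact: nnm_indic].
have v0 : 0 <= e^-1 / 2 by lra.
have gint : (integ mu (Om m) (fun x => g x `^ q x)%R <= 1)%E.
  rewrite (@eq_integ _ _ _ mu (Om m) _
    (fun x => (e^-1 * w x) `^ q x * \1_E x)); last first.
    move=> x _; rewrite /g indicE; case: (x \in E); rewrite ?mulr1 ?mulr0//.
    by rewrite powR0// gt_eqF// (lt_trans ltr01).
  rewrite integ_indic// setIidr//.
  apply: le_trans (integ_pow_scale_ge1 mu mq qhi mE hw g1) _.
  have -> : e^-1 `^ hi = eta^-1.
    by rewrite -ehi -powR_inv1 ?(ltW e0)// powRAC powR_inv1// powR_ge0.
  apply: (@le_trans _ _ (eta^-1%:E * eta%:E)%E); last first.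
    by rewrite -EFinM lee_fin mulVf// gt_eqF.
  by apply: lee_wpmul2l; [rewrite lee_fin invr_ge0 ltW|exact: ltW].
have HAv := HA _ g (fun x => e^-1 / 2 * w x) (pS m) gg (nnmZ v0 hw) gint.
have {}HAv : (integ mu (Om m) (fun x => (e^-1 / 2 * w x) `^ q x)%R <= C%:E)%E.
  apply: HAv => Q x SQ Qx; have [[cQ [P FP QP] lQ] _] := SQ.
  have mQ := grid_measurable gD cQ.
  have [l0 l2 le] := hlam m.
  have half := stopping_half gD pF hk kF l0 l2 le SQ.
  rewrite (@eq_integ _ _ _ mu Q g (fun z => e^-1 * w x * \1_E z)); last first.
    move=> z' Qz'; rewrite /g mulrA; congr (_ * (_ * _) * _).
    by apply: yc FP _ _; exact: QP.
  rewrite integ_indic// integ_cst; last exact: measurableI.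
  have QE : Q `&` E = Q `\` (Q `&` Om m.+1).
    apply/seteqP; split => [u [Qu [_ nOu]]|u [Qu nOu]]; first by split => // -[].
    split => //; split; first by exists Q.
    by move=> Ou; apply: nOu.
  have fQ := grid_fin gD cQ.
  have mI : measurable (Q `&` Om m.+1) by exact: measurableI.
  have fI : (mu (Q `&` Om m.+1) < +oo)%E.
    by apply: le_lt_trans fQ; apply: le_measure; rewrite ?inE//; exact: subIsetl.
  have [M ME] : exists M, mu Q = M%:E.
    by exists (fine (mu Q)); rewrite fineK ?ge0_fin_numE.
  have [N NE] : exists N, mu (Q `&` Om m.+1) = N%:E.
    by exists (fine (mu (Q `&` Om m.+1))); rewrite fineK ?ge0_fin_numE.
  have muE : mu (Q `&` E) = (M - N)%:E.
    by rewrite EFinB -ME -NE QE [LHS](measureD mQ mI)// setIA setIid.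
  rewrite muE ME; move: half; rewrite -/(Om m.+1) ME NE -!EFinM !lee_fin => half.
  have V0 : 0 <= e^-1 * w x by rewrite mulr_ge0 ?invr_ge0 ?(ltW e0) ?nnm_ge0.
  have -> : e^-1 / 2 * w x * M = e^-1 * w x * (M / 2) by ring.
  by apply: ler_wpM2l => //; lra.
apply: (@le_trans _ _ (integ mu (Om m) (fun x => w x `^ q x))).
  exact: (subset_integ mu (mOm m.+1) (mOm m) (nnm_pow mq hw) (OmS m)).
apply: (@le_trans _ _ (B%:E * (z%:E * C%:E))%E); last first.
  rewrite -!EFinM lee_fin.
  have -> : B * (z * C) = 1 / 2 by rewrite zE; field; lra.
  lra.
have B0 : (0 <= B%:E)%E by rewrite lee_fin; lra.
rewrite BE in B0 *.
apply: (@le_trans _ _ ((2 `^ hi)%:E * integ mu (Om m)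
    (fun x => (e * (e^-1 / 2 * w x)) `^ q x)%R)%E).
  rewrite (@eq_integ _ _ _ mu (Om m) _
    (fun x => (2 * (e * (e^-1 / 2 * w x))) `^ q x)); last first.
    by move=> x _; congr (_ `^ _); field; rewrite gt_eqF.
  apply: (integ_pow_scale_ge1 mu mq qhi) => //.
  exact: (nnmZ (ltW e0) (nnmZ v0 hw)).
apply: lee_wpmul2l => //.
rewrite -elo.
apply: le_trans (integ_pow_scale_le1 mu mq lo1 loq (mOm m) (nnmZ v0 hw)
  (ltW e0) e1) _.
by apply: lee_wpmul2l; rewrite ?lee_fin ?powR_ge0.
Qed.

End Decay.

Section ReverseHolder2.
Context {R : realType} {d : measure_display} {T : measurableType d}.
Variable mu : {measure set T -> \bar R}.

Lemma integ_bigcup_le (A : nat -> set T) (h : T -> R) (C : \bar R) :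
  (forall n, measurable (A n)) -> {homo A : n m / (n <= m)%N >-> (n <= m)%O} ->
  nnm h -> (forall n, (integ mu (A n) h <= C)%E) ->
  (integ mu (\bigcup_n A n) h <= C)%E.
Proof.
move=> mA ndA hh hC; rewrite integE.
have cv : (\int[mu]_(x in A i) (h x)%:E)%E @[i --> \oo] -->
    (\int[mu]_(x in \bigcup_i A i) (h x)%:E)%E.
  apply: ge0_nondecreasing_set_cvg_integral => //.
    by move=> i; exact: nnm_emeas.
  by move=> i x _; rewrite lee_fin; exact: nnm_ge0.
rewrite -(cvg_lim _ cv)//; apply: lime_le; first by apply/cvg_ex; eexists; exact: cv.
by apply: nearW => n; rewrite -integE.
Qed.

Lemma geometric_sum_le (r : R) M : 0 <= r -> r < 1 ->
  \sum_(m < M) r ^+ m <= (1 - r)^-1.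
Proof.
move=> r0 r1; have r10 : 0 < 1 - r by lra.
rewrite -[leRHS]mul1r ler_pdivlMr//.
suff -> : (\sum_(m < M) r ^+ m) * (1 - r) = 1 - r ^+ M.
  by rewrite gerBl exprn_ge0.
elim: M => [|M IH]; first by rewrite big_ord0 expr0 mul0r subrr.
by rewrite big_ord_recr/= mulrDl IH exprS; ring.
Qed.

Variables (D : int -> set (set T)) (eps : R).
Hypotheses (gD : grid mu D eps) (dD : differentiates mu D).
Variables (q : T -> R) (lo hi : R).
Hypotheses (mq : measurable_fun [set: T] q) (lo1 : 1 < lo) (lohi : lo <= hi)
  (loq : forall x, lo <= q x) (qhi : forall x, q x <= hi).

(** Off the stopping cubes all means over small cubes are at most [lam]. *)
Lemma exceptional_null F k (lam : R) : packing D F -> nnm k -> 0 <= lam ->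
  let N := [set x | lam < k x] `&`
    (union F `\` union (stopping mu D F k lam)) in
  measurable N /\ mu N = 0%E.
Proof.
move=> pF hk lam0 N.
have mU := measurable_union (packing_family gD pF).
have mO := measurable_union (packing_family gD (stopping_packing gD F k lam)).
have mN : measurable N.
  apply: measurableI; last exact: measurableD.
  rewrite -[X in measurable X]setTI.
  have -> : [set x | lam < k x] = k @^-1` `]lam, +oo[.
    by apply/seteqP; split => x; rewrite /= in_itv/= andbT.
  exact: (nnm_meas hk).
split => //; apply/eqP; rewrite -measure_le0.
have n0 : nnm (fun _ : T => 0 : R) by exact: nnm_cst.
have n1 : nnm (fun _ : T => 1 : R) by exact: nnm_cst.
have NU : N `<=` union F by move=> x [_ []].
have := @integ_union_le _ _ _ mu F (fun x => 1 * \1_N x) (fun=> 0).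
move=> /(_ (packing_family gD pF)) /(_ _) /(_ n0).
rewrite integ_indic// integ_cst; last exact: measurableI.
rewrite mul1e setIidr// integ_cst// mul0e; apply.
  by apply: nnmM => //; exact: nnm_indic.
move=> Q FQ; have cQ := pF.1 _ FQ; have mQ := grid_measurable gD cQ.
rewrite integ_indic// integ_cst; last exact: measurableI.
rewrite mul1e integ_cst// mul0e measure_le0; apply/eqP.
apply: (dD cQ hk lam0); first exact: measurableI.
- by move=> x [].
- by move=> x [_ []].
move=> C x cC CQ Cx [_ [_ [_ nO]]]; rewrite leNgt; apply/negP => lC.
have hC : hit mu D F k lam C by split => //; exists Q.
have [C' [sC' CC' _]] := hit_stopping gD pF hk lam0 hC Cx.
by apply: nO; exists C' => //; exact: CC'.
Qed.

(** The weights [y `^ q], with [y] constant on the cubes of [F], behave like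
    weights of class A_infinity. Up to a null set, [k > a ^+ m / 2] holds only
    on the [m]-th stopping set, where the modular of [y] is at most
    [c ^- (m * lo)]. With [delta] defined by [a `^ delta = c `^ (lo / 2)] the sum
    over [m] is a geometric series. *)
Lemma reverse_holder (C : R) : 1 <= C -> averaging_bounded mu D q C ->
  exists delta C' : R, [/\ 0 < delta, 1 <= C' & forall F k y, packing D F ->
  nnm k -> nnm y -> (forall Q x x', F Q -> Q x -> Q x' -> y x = y x') ->
  (forall Q, F Q -> (integ mu Q k <= mu Q)%E) ->
  (integ mu (union F) (fun x => y x `^ q x)%R <= 1)%E ->
  (integ mu (union F) (fun x => y x `^ q x * k x `^ delta)%R <= C'%:E)%E].
Proof.
move=> C1 HA.
have [c c1 decay] := stopping_decay gD mq lo1 lohi loq qhi C1 HA.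
have /andP[ep0 ep1] := grid_eps gD.
have [a aE] : exists a, a = Num.max 4 (2 / eps) by eexists.
have a4 : 4 <= a by rewrite aE le_max lexx.
have ae : 2 / eps <= a by rewrite aE le_max lexx orbT.
have a0 : 0 < a by lra.
have a1 : 1 <= a by lra.
have lo0 : 0 < lo by exact: lt_trans lo1.
have c0 : 0 < c by lra.
have [s sE] : exists s, s = c `^ (lo / 2) by eexists.
have s1 : 1 < s.
  have l20 : 0 < lo / 2 by rewrite divr_gt0.
  by have := powR_lt_base l20 ler01 c1; rewrite powR1 sE.
have ss : (c^-1) `^ lo = s^-1 * s^-1.
  rewrite -powR_inv1 ?(ltW c0)// powRAC powR_inv1 ?powR_ge0// -invfM sE -powRD.
    by congr ((_ `^ _)^-1); lra.
  by rewrite gt_eqF ?implybT//; lra.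
have lna : 0 < ln a by rewrite ln_gt0//; lra.
have [delta dE] : exists delta, delta = ln s / ln a by eexists.
have delta0 : 0 < delta by rewrite dE divr_gt0// ln_gt0.
have ads : a `^ delta = s.
  rewrite /powR gt_eqF// dE divfK ?gt_eqF// lnK// posrE; lra.
pose lam m : R := a ^+ m / 2.
have am m : 1 <= a ^+ m by exact: exprn_ege1.
have lam0 m : 0 < lam m by rewrite /lam; have := am m; lra.
have hlam m : [/\ 0 < lam m, 2 <= lam m.+1 & lam m / eps <= lam m.+1 / 2].
  split => //; rewrite /lam exprS.
    have : a * 1 <= a * a ^+ m by rewrite ler_pM2l.
    lra.
  have : a ^+ m * (2 / eps) <= a ^+ m * a by rewrite ler_wpM2l// exprn_ge0// ltW.
  have -> : a ^+ m / 2 / eps = a ^+ m * (2 / eps) / 4 by field; rewrite gt_eqF.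
  lra.
have si0 : 0 < s^-1 by rewrite invr_gt0; lra.
have si1 : s^-1 < 1 by rewrite invf_lt1; lra.
exists delta, (1 + s * (1 - s^-1)^-1); split => //.
  by rewrite lerDl mulr_ge0// ?invr_ge0; lra.
move=> F k y pF hk hy yc kF y1.
have dec := decay F k y lam pF hk hy yc kF hlam y1.
pose Om m := union (stopping mu D F k (lam m)).
pose N m := [set x | lam m < k x] `&` (union F `\` Om m).
have mU := measurable_union (packing_family gD pF).
have mOm m : measurable (Om m).
  exact: measurable_union (packing_family gD (stopping_packing gD F k (lam m))).
have OmU m : Om m `<=` union F.
  by move=> x [C' /stopping_sub[Q FQ CQ] C'x]; exists Q => //; exact: CQ.
have NU m : N m `<=` union F by move=> x [_ []].
have HN m : measurable (N m) /\ mu (N m) = 0%E.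
  exact: exceptional_null pF hk (ltW (lam0 m)).
have hyq : nnm (fun x => y x `^ q x) by exact: nnm_pow.
have hkd : nnm (fun x => k x `^ delta).
  by apply: nnm_powR => //; exact: nnm_meas.
have Omy m : (integ mu (Om m) (fun x => y x `^ q x)%R <=
    ((s^-1 * s^-1) ^+ m)%:E)%E.
  have cm0 : 0 <= c ^+ m by rewrite exprn_ge0// ltW.
  have cim0 : 0 <= (c^-1) ^+ m by rewrite exprn_ge0// invr_ge0 ltW.
  have cim1 : (c^-1) ^+ m <= 1.
    by rewrite exprn_ile1// ?invr_ge0 ?invf_le1// ltW.
  rewrite (@eq_integ _ _ _ mu (Om m) _
    (fun x => ((c^-1) ^+ m * (c ^+ m * y x)) `^ q x)); last first.
    by move=> x _; rewrite mulrA -exprMn mulVf ?gt_eqF// expr1n mul1r.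
  apply: le_trans (integ_pow_scale_le1 mu mq lo1 loq (mOm m) (nnmZ cm0 hy)
    cim0 cim1) _.
  apply: (@le_trans _ _ ((((c^-1) ^+ m) `^ lo)%:E * 1)%E).
    by apply: lee_wpmul2l; rewrite ?lee_fin ?powR_ge0//; exact: dec.
  rewrite mule1 lee_fin -powR_mulrn ?invr_ge0 ?(ltW c0)// powRAC ss.
  by rewrite powR_mulrn// mulr_ge0// ltW.
pose b m := lam m.+1 `^ delta.
have b0 m : 0 <= b m by exact: powR_ge0.
(* A step function that dominates [k `^ delta] where [k <= lam M]. *)
pose H M x := 1 + \sum_(m < M) b m * (\1_(Om m) x + \1_(N m) x).
have HS M x : H M.+1 x = H M x + b M * (\1_(Om M) x + \1_(N M) x).
  by rewrite /H big_ord_recr/= addrA.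
have n1 : nnm (fun _ : T => 1 : R) by exact: nnm_cst.
have nI m : nnm (fun x => \1_(Om m) x + \1_(N m) x : R).
  by apply: nnmD; apply: nnm_indic => //; exact: (HN m).1.
have hH M : nnm (H M).
  elim: M => [|M IH].
    by rewrite (_ : H 0%N = fun=> 1)//; apply/funext => x; rewrite /H big_ord0 addr0.
  rewrite (_ : H M.+1 = fun x => H M x + b M * (\1_(Om M) x + \1_(N M) x)).
    by apply: nnmD => //; exact: nnmZ.
  by apply/funext => x; exact: HS.
have intH M : (integ mu (union F) (fun x => y x `^ q x * H M x)%R <=
    (1 + \sum_(m < M) b m * (s^-1 * s^-1) ^+ m)%:E)%E.
  elim: M => [|M IH].
    rewrite big_ord0 addr0 (@eq_integ _ _ _ mu _ _ (fun x => y x `^ q x))//.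
    by move=> x _; rewrite /H big_ord0 addr0 mulr1.
  rewrite (@eq_integ _ _ _ mu _ _ (fun x => y x `^ q x * H M x +
    b M * (y x `^ q x * \1_(Om M) x + y x `^ q x * \1_(N M) x))); last first.
    by move=> x _; rewrite HS; ring.
  have nO : nnm (fun x => y x `^ q x * \1_(Om M) x).
    by apply: nnmM => //; exact: nnm_indic.
  have nN : nnm (fun x => y x `^ q x * \1_(N M) x).
    by apply: nnmM => //; apply: nnm_indic; exact: (HN M).1.
  have nON := nnmD nO nN.
  rewrite integD//; [|exact: nnmM|exact: nnmZ].
  rewrite big_ord_recr/= addrA EFinD; apply: leeD => //.
  rewrite integZ// integD// !integ_indic//; last exact: (HN M).1.
  rewrite !setIidr// (@integ_null _ _ _ mu (N M))//; [|exact: (HN M).1|exact: (HN M).2].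
  by rewrite adde0 EFinM; apply: lee_wpmul2l; rewrite ?lee_fin.
have kH M x : union F x -> k x <= lam M -> k x `^ delta <= H M x.
  move=> Ux; elim: M => [|M IH] kM.
    rewrite /H big_ord0 addr0; apply: powR_le1; first exact: ltW.
      exact: nnm_ge0.
    by apply: (le_trans kM); rewrite /lam expr0; lra.
  rewrite HS; have [kM'|kM'] := leP (k x) (lam M).
    apply: (le_trans (IH kM')); rewrite lerDl.
    exact: (mulr_ge0 (b0 M) (nnm_ge0 x (nI M))).
  have HM1 : 0 <= H M x by exact: nnm_ge0.
  apply: (@le_trans _ _ (b M)).
    by apply: powR_le_base => //; [exact: ltW|exact: nnm_ge0].
  have [Ox|nOx] := pselect (Om M x).
    have -> : \1_(Om M) x = 1 :> R by rewrite indicE mem_set.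
    have : 0 <= b M * \1_(N M) x by rewrite mulr_ge0.
    lra.
  have -> : \1_(N M) x = 1 :> R by rewrite indicE mem_set.
  have : 0 <= b M * \1_(Om M) x by rewrite mulr_ge0.
  lra.
pose A M := union F `&` [set x | k x <= lam M].
have mA M : measurable (A M).
  apply: measurableI => //; rewrite -[X in measurable X]setTI.
  have -> : [set x | k x <= lam M] = k @^-1` `]-oo, lam M].
    by apply/seteqP; split => x; rewrite /= in_itv.
  exact: (nnm_meas hk).
have lamle m n : (m <= n)%N -> lam m <= lam n.
  by move=> mn; rewrite /lam ler_pM2r//; exact: ler_weXn2l.
have UA : union F = \bigcup_M A M.
  apply/seteqP; split => [x Ux|x [M _ []]//].
  exists (Num.truncn (2 * k x)).+1 => //; split => //=.
  have : 2 * k x <= a ^+ (Num.truncn (2 * k x)).+1.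
    apply: le_trans (ltW (truncnS_gt _)) _.
    apply: (@le_trans _ _ (2 ^+ (Num.truncn (2 * k x)).+1)).
      by rewrite -natrX ler_nat ltnW// ltn_expl.
    by apply: lerXn2r; rewrite ?nnegrE; lra.
  rewrite /lam; lra.
rewrite UA; apply: integ_bigcup_le => //.
- move=> m n mn; apply/subsetPset => x [Ux kx]; split => //=.
  exact: le_trans (lamle _ _ mn).
- exact: nnmM.
move=> M; apply: (@le_trans _ _ (integ mu (A M) (fun x => y x `^ q x * H M x))).
  apply: le_integ => //; [exact: nnmM|exact: nnmM|].
  by move=> x [Ux kx]; rewrite ler_wpM2l ?powR_ge0//; exact: kH.
apply: (@le_trans _ _ (integ mu (union F) (fun x => y x `^ q x * H M x))).
  by apply: subset_integ => //; [exact: nnmM|move=> x []].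
apply: le_trans (intH M) _; rewrite lee_fin lerD2l.
apply: (@le_trans _ _ (\sum_(m < M) s * (s^-1) ^+ m)); last first.
  rewrite -mulr_sumr ler_wpM2l//; first lra.
  by apply: geometric_sum_le => //; exact: ltW.
apply: ler_sum => m _; rewrite /b.
have : lam m.+1 `^ delta <= s ^+ m.+1.
  apply: (@le_trans _ _ ((a ^+ m.+1) `^ delta)).
    apply: powR_le_base; [exact: ltW|exact: ltW|].
    by rewrite /lam; have := am m.+1; lra.
  by rewrite -(powR_mulrn _ (ltW a0)) powRAC ads powR_mulrn//; lra.
have sm0 : 0 <= (s^-1 * s^-1) ^+ m by rewrite exprn_ge0// mulr_ge0// ltW.
move=> /(ler_wpM2r sm0) /le_trans; apply.
rewrite exprMn exprS -mulrA ler_wpM2l//; first lra.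
by rewrite mulrA -exprMn mulfV ?gt_eqF ?expr1n ?mul1r//; lra.
Qed.

End ReverseHolder2.

(** * Self-improvement of the averaging operators *)

Section LeftOpen.
Context {R : realType} {d : measure_display} {T : measurableType d}.
Variable mu : {measure set T -> \bar R}.
Variables (D : int -> set (set T)) (eps : R).
Hypotheses (gD : grid mu D eps) (dD : differentiates mu D).

Variables (q : T -> R) (lo hi : R).
Hypotheses (mq : measurable_fun [set: T] q) (lo1 : 1 < lo) (lohi : lo <= hi)
  (loq : forall x, lo <= q x) (qhi : forall x, q x <= hi).

Let q1 x : 1 < q x. Proof. exact: lt_le_trans (loq x). Qed.
Let q0 x : 0 < q x. Proof. by apply: lt_trans (q1 x). Qed.

Lemma power_averaging_le (s t C : R) : 0 < s -> s <= t ->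
  power_averaging_bounded mu D q t C -> power_averaging_bounded mu D q s C.
Proof.
move=> s0 st HA F g u pF hg hu g1 hug; have t0 : 0 < t by exact: lt_le_trans st.
apply: (HA F g) => // Q x FQ Qx; have cQ := pF.1 _ FQ.
have ts : 1 <= t / s by rewrite ler_pdivlMr// mul1r.
have hgs : nnm (fun x => g x `^ s) by apply: nnm_powR => //; exact: nnm_meas.
have := jensen_powR (grid_measurable gD cQ) (grid_fin gD cQ) hgs ts
  (powR_ge0 _ _) (hug Q x FQ Qx).
rewrite -powRrM mulrC divfK ?gt_eqF//.
rewrite (@eq_integ _ _ _ mu Q _ (fun x => g x `^ t))//.
by move=> z _; rewrite -powRrM mulrC divfK ?gt_eqF.
Qed.

(** The reverse Hoelder inequality for the conjugate exponent is what
    [power_averaging_of_dual] asks for. Indeed [k `^ ((s - 1) / s)], raised to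
    the conjugate exponent, is at most [1 + k `^ delta] once
    [(s - 1) * lo / (lo - 1) <= delta]. *)
Lemma left_open (C : R) : 1 <= C -> averaging_bounded mu D q C ->
  exists s C' : R, [/\ 1 < s, s <= lo, 1 <= C' & power_averaging_bounded mu D q s C'].
Proof.
move=> C1 HA.
have [C2 [C21 HA']] := averaging_bounded_conj gD mq lo1 lohi loq qhi C1 HA.
pose q' x := q x / (q x - 1).
have hi1 : 1 < hi by apply: lt_le_trans lohi.
have l1 : 1 < hi / (hi - 1) by rewrite ltr_pdivlMr; lra.
have lh : hi / (hi - 1) <= lo / (lo - 1) by exact: conj_antimono.
have mq' : measurable_fun setT q' := measurable_conj mq lo1 loq.
have lq' : forall x, hi / (hi - 1) <= q' x := conj_ge lo1 loq qhi.
have hq' : forall x, q' x <= lo / (lo - 1) := conj_le lo1 loq.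
have [delta [C3 [de0 C31 RH]]] :=
  reverse_holder gD dD mq' l1 lh lq' hq' C21 HA'.
have [L LE] : exists L, L = lo / (lo - 1) by eexists.
rewrite -LE in lh hq'.
have L1 : 1 < L by apply: lt_le_trans lh.
have L0 : 0 < L by apply: lt_trans L1.
have [C4 C4E] : exists C4, C4 = C2 + C2 `^ L * C3 by eexists.
have C41 : 1 <= C4.
  have : 0 <= C2 `^ L * C3 by rewrite mulr_ge0// ?powR_ge0//; lra.
  lra.
have [s sE] : exists s, s = 1 + Num.min (lo - 1) (delta / L) by eexists.
have lo10 : 0 < lo - 1 by rewrite subr_gt0.
have s1 : 1 < s by rewrite sE ltrDl lt_min lo10 divr_gt0.
have slo : s <= lo by rewrite sE -lerBrDl ge_min lexx.
have sdL : (s - 1) * L <= delta.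
  by rewrite -ler_pdivlMr// sE addrAC subrr add0r ge_min lexx orbT.
have s0 : 0 < s by lra.
have s10 : 0 < s - 1 by lra.
suff [C' [C'1 H]] : exists C', 1 <= C' /\ power_averaging_bounded mu D q s C'.
  by exists s, C'.
apply: (power_averaging_of_dual gD mq lo1 lohi loq qhi (ltW s1) slo C41 HA').
move=> G y k pG hy hk yc kQ y1; rewrite -/q' in y1 *.
have mG := measurable_union (packing_family gD pG).
have pw (f : T -> R) (e : R) : nnm f -> nnm (fun x => f x `^ e).
  by move=> hf; apply: nnm_powR => //; exact: nnm_meas.
have pq' (f : T -> R) : nnm f -> nnm (fun x => f x `^ q' x) by exact: nnm_pow.
have C20 : 0 < C2 by lra.
have C2i0 : 0 <= C2^-1 by rewrite invr_ge0; lra.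
have C2i1 : C2^-1 <= 1 by rewrite invf_le1.
have RHk : (integ mu (union G)
    (fun x => (C2^-1 * y x) `^ q' x * k x `^ delta)%R <= C3%:E)%E.
  apply: RH => //; first exact: nnmZ.
    by move=> Q x x' GQ Qx Qx'; rewrite (yc Q x x').
  apply: le_trans (integ_pow_scale_le1 mu mq' l1 lq' mG hy C2i0 C2i1) _.
  apply: (@le_trans _ _ ((C2^-1)%:E * C2%:E)%E); last first.
    by rewrite -EFinM mulVf ?gt_eqF.
  apply: lee_pmul => //; [by rewrite lee_fin powR_ge0|exact/integ_ge0/pq'|].
  rewrite lee_fin -[leRHS]powRr1//; apply: powR_exp_le1 => //; exact: ltW.
have hyk : nnm (fun x => (C2^-1 * y x) `^ q' x * k x `^ delta).
  by apply: nnmM; [apply: pq'; exact: nnmZ|exact: pw].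
have hyK : nnm (fun x => y x * k x `^ ((s - 1) / s)) by exact: (nnmM hy (pw _ _ hk)).
apply: (@le_trans _ _ (integ mu (union G) (fun x => y x `^ q' x +
    C2 `^ L * ((C2^-1 * y x) `^ q' x * k x `^ delta)))).
  apply: (le_integ mu mG (pq' _ hyK)
    (nnmD (pq' _ hy) (nnmZ (powR_ge0 _ _) hyk))).
  move=> x _; have yx := nnm_ge0 x hy; have kx := nnm_ge0 x hk.
  rewrite powRM ?powR_ge0//.
  have q'1 : 1 < q' x by apply: lt_le_trans (lq' x).
  have q'0 : 0 < q' x by apply: lt_trans q'1.
  have ss0 : 0 < (s - 1) / s by rewrite divr_gt0.
  apply: (@le_trans _ _ (y x `^ q' x * (1 + k x `^ delta))).
    apply: ler_wpM2l; first exact: powR_ge0.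
    rewrite -powRrM; have [k1|/ltW k1] := leP 1 (k x).
      apply: (@le_trans _ _ (k x `^ delta)); last by rewrite lerDr.
      apply: ler_powR => //; apply: le_trans sdL.
      apply: ler_pM => //; [exact: ltW|exact: ltW|].
      by rewrite ler_pdivrMr// ler_peMr; lra.
    apply: (@le_trans _ _ 1); last by rewrite lerDl powR_ge0.
    by apply: powR_le1 => //; rewrite mulr_ge0// ltW.
  rewrite mulrDr mulr1 lerD2l mulrA ler_wpM2r ?powR_ge0//.
  have {1}-> : y x = C2 * (C2^-1 * y x) by rewrite mulVKf ?gt_eqF.
  by apply: powR_scale_ge1 => //; rewrite mulr_ge0.
rewrite (integD mu mG (pq' _ hy) (nnmZ (powR_ge0 _ _) hyk)).
rewrite (integZ mu mG (powR_ge0 _ _) hyk) C4E EFinD; apply: leeD => //.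
by rewrite EFinM; apply: lee_wpmul2l; rewrite ?lee_fin ?powR_ge0.
Qed.

End LeftOpen.

Section Improved.
Context {R : realType} {d : measure_display} {T : measurableType d}.
Variable mu : {measure set T -> \bar R}.
Variables (D : int -> set (set T)) (eps : R).
Hypotheses (gD : grid mu D eps) (dD : differentiates mu D).
Variables (q : T -> R) (lo hi : R).
Hypotheses (mq : measurable_fun [set: T] q) (lo1 : 1 < lo) (lohi : lo <= hi)
  (loq : forall x, lo <= q x) (qhi : forall x, q x <= hi).

Let q1 x : 1 < q x. Proof. exact: lt_le_trans (loq x). Qed.
Let q0 x : 0 < q x. Proof. by apply: lt_trans (q1 x). Qed.

Lemma integ_bounded_fin Q h (K : R) : cube D Q -> nnm h -> 0 <= K ->
  (forall x, Q x -> h x <= K) -> (integ mu Q h < +oo)%E.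
Proof.
move=> cQ hh K0 hK; have mQ := grid_measurable gD cQ.
apply: le_lt_trans (integ_cst_fin gD (h := fun=> K) cQ _) => //.
by apply: le_integ => //; exact: nnm_cst.
Qed.

Lemma nnm_exp (t e : R) : nnm (fun x => t `^ (q x * e)).
Proof. by apply: nnm_powR => //; exact: measurable_funM. Qed.

Lemma exp_fin Q (t e : R) : cube D Q -> 0 <= t -> 0 <= e ->
  (integ mu Q (fun x => t `^ (q x * e))%R < +oo)%E.
Proof.
move=> cQ t0 e0; apply: (@integ_bounded_fin _ _ ((1 + t) `^ (hi * e))) => //.
- exact: nnm_exp.
- exact: powR_ge0.
move=> x _; apply: (@le_trans _ _ ((1 + t) `^ (q x * e))).
  by apply: powR_le_base => //; [rewrite mulr_ge0// ltW|lra].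
by apply: ler_powR; [lra|exact: ler_wpM2r].
Qed.

(** The [L^e] mean of the function [t `^ q] over [Q]. For [e > 1] a bound on it
    limits the oscillation of the exponent on [Q], as seen by the number [t]. *)
Definition pmean (e t : R) (Q : set T) : R :=
  (avg mu Q (fun x => t `^ (q x * e))) `^ e^-1.

Lemma pmeanE (e t : R) Q : cube D Q -> 0 < e -> 0 <= t ->
  ((pmean e t Q `^ e)%:E * mu Q = integ mu Q (fun x => t `^ (q x * e))%R)%E.
Proof.
move=> cQ e0 t0; rewrite /pmean powR_rootK//; last exact/avg_ge0/nnm_exp.
rewrite (cube_avgE gD)//; first exact: nnm_exp.
by apply: exp_fin => //; exact: ltW.
Qed.

Lemma pmean_ge0 e t Q : 0 <= pmean e t Q. Proof. exact: powR_ge0. Qed.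

Lemma avg_leZ Q g h (c : R) : cube D Q -> nnm g -> nnm h ->
  (integ mu Q h < +oo)%E -> 0 <= c ->
  (forall x, Q x -> g x <= c * h x) -> avg mu Q g <= c * avg mu Q h.
Proof.
move=> cQ hg hh fh c0 gh; have mQ := grid_measurable gD cQ.
have H : (integ mu Q g <= c%:E * integ mu Q h)%E.
  by rewrite -integZ//; apply: le_integ => //; exact: nnmZ.
have m0 : 0 < fine (mu Q) by rewrite fine_gt0// (grid_gt0 gD)// (grid_fin gD).
have [y yE] : exists y, integ mu Q h = y%:E.
  by exists (fine (integ mu Q h)); rewrite fineK// ge0_fin_numE// integ_ge0.
rewrite avg.unlock yE /= mulrA ler_pM2r ?invr_gt0//.
rewrite yE -EFinM in H.
rewrite -lee_fin fineK// ge0_fin_numE; last exact: integ_ge0.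
by apply: le_lt_trans H _; rewrite ltry.
Qed.

Lemma pmean_scale (e t c : R) Q : cube D Q -> 0 < e -> 0 <= t -> 1 <= c ->
  pmean e (c * t) Q <= c `^ hi * pmean e t Q.
Proof.
move=> cQ e0 t0 c1; have c0 : 0 <= c by lra.
rewrite /pmean -[c `^ hi](powR_Kroot e0) ?powR_ge0//.
rewrite -powRM ?powR_ge0//; last exact/avg_ge0/nnm_exp.
apply: powR_le_base; [by rewrite invr_ge0 ltW|exact/avg_ge0/nnm_exp|].
apply: avg_leZ => //; try exact: nnm_exp; first exact: exp_fin (ltW e0).
  exact: powR_ge0.
move=> x _; rewrite -powRrM; apply: powR_scale_ge1 => //.
by apply: ler_wpM2r => //; exact: ltW.
Qed.

(** Let [A] be the mean of [t `^ q], and [z] its [L^sigma] mean, so that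
    [z `^ sigma] is [A `^ (sigma - 1)] times the mean of
    [t `^ q * k `^ (sigma - 1)]. If [z <= A] there is nothing to do; otherwise
    divide by [A `^ (sigma - 1) <= z `^ (sigma - 1)]. *)
Lemma pmean_reverse (sigma delta t : R) Q (k : T -> R) : cube D Q ->
  1 < sigma -> sigma - 1 <= delta -> 0 < t -> nnm k ->
  (forall x, Q x -> k x = t `^ q x / avg mu Q (fun z => t `^ q z)) ->
  ((pmean sigma t Q)%:E * mu Q <=
    integ mu Q (fun x => t `^ q x + t `^ q x * k x `^ delta)%R)%E.
Proof.
move=> cQ s1 sd t0 hk kE; have mQ := grid_measurable gD cQ.
have s0 : 0 < sigma by lra.
have s10 : 0 < sigma - 1 by lra.
have d0 : 0 <= delta by lra.
have htq : nnm (fun x => t `^ q x) by exact: nnm_powR.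
have hkd e : nnm (fun x => k x `^ e).
  by apply: nnm_powR => //; exact: nnm_meas.
have htk e : nnm (fun x => t `^ q x * k x `^ e) by exact: nnmM.
have ftq : (integ mu Q (fun x => t `^ q x)%R < +oo)%E.
  have := exp_fin cQ (ltW t0) ler01.
  by rewrite (@eq_integ _ _ _ mu Q _ (fun x => t `^ q x))// => x _; rewrite mulr1.
have AE := cube_avgE gD cQ htq ftq.
have [A AA] : exists A, A = avg mu Q (fun z => t `^ q z) by eexists.
rewrite -AA in kE AE.
have A0 : 0 < A.
  rewrite lt_neqAle AA avg_ge0// andbT -AA eq_sym; apply/negP => /eqP Az.
  have Imin : ((Num.min 1 t `^ hi)%:E * mu Q <= integ mu Q (fun x => t `^ q x)%R)%E.
    rewrite -integ_cst//; apply: le_integ => //; first exact/nnm_cst/powR_ge0.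
    move=> x _; apply: (@le_trans _ _ (Num.min 1 t `^ q x)).
      apply: powR_exp_le1 => //; first by rewrite le_min ler01 ltW.
      by rewrite ge_min lexx.
    apply: powR_le_base; [exact: ltW|by rewrite le_min ler01 ltW|].
    by rewrite ge_min lexx orbT.
  move: Imin; rewrite -AE Az mul0e leNgt => /negP; apply.
  by rewrite mule_gt0 ?(grid_gt0 gD)// lte_fin powR_gt0// lt_min ltr01.
have [zA|Az] := leP (pmean sigma t Q) A.
  apply: (@le_trans _ _ (A%:E * mu Q)%E).
    by apply: lee_wpmul2r; rewrite ?lee_fin ?measure_ge0.
  rewrite AE; apply: le_integ => //; first exact: nnmD.
  by move=> x _; rewrite lerDl mulr_ge0 ?powR_ge0.
apply: (@le_trans _ _ (integ mu Q (fun x => t `^ q x * k x `^ (sigma - 1)))); last first.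
  apply: le_integ => //; first exact: nnmD.
  move=> x _; have kx := nnm_ge0 x hk.
  have -> : t `^ q x + t `^ q x * k x `^ delta =
    t `^ q x * (1 + k x `^ delta) by rewrite mulrDr mulr1.
  apply: ler_wpM2l; first exact: powR_ge0.
  have [k1|/ltW k1] := leP 1 (k x).
    by apply: le_trans (ler_powR k1 sd) _; rewrite lerDr.
  by apply: le_trans (powR_le1 (ltW s10) kx k1) _; rewrite lerDl powR_ge0.
have := pmeanE cQ s0 (ltW t0).
have z0 : 0 < pmean sigma t Q by apply: lt_trans Az.
have As0 : 0 <= A `^ (sigma - 1) by exact: powR_ge0.
have -> : integ mu Q (fun x => t `^ (q x * sigma)) =
    integ mu Q (fun x => A `^ (sigma - 1) * (t `^ q x * k x `^ (sigma - 1))).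
  apply: eq_integ => x Qx; rewrite (kE _ Qx) powRM ?powR_ge0 ?invr_ge0 ?(ltW A0)//.
  rewrite -powR_inv1 ?(ltW A0)// (powRAC A) powR_inv1// powRrM.
  rewrite -(mulr_powRB1 (powR_ge0 t (q x)) s0).
  by field; rewrite gt_eqF// powR_gt0.
rewrite (integZ mu mQ As0 (htk _)) => E.
have h : ((A `^ (sigma - 1))%:E * ((pmean sigma t Q)%:E * mu Q) <=
    (A `^ (sigma - 1))%:E * integ mu Q (fun x => t `^ q x * k x `^ (sigma - 1))%R)%E.
  rewrite -E muleA -EFinM; apply: lee_wpmul2r; first exact: measure_ge0.
  rewrite lee_fin -(mulr_powRB1 (ltW z0) s0) mulrC ler_wpM2l ?(ltW z0)//.
  by apply: powR_le_base; exact: ltW.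
by rewrite lee_pmul2l// lte_fin powR_gt0 in h.
Qed.

(** Left-openness bounds the integral of [t `^ q], and the reverse Hoelder
    inequality, with [k] the quotient of [t `^ q] by its mean on each cube,
    raises this to a bound on the [L^sigma] means. *)
Lemma improved_averaging (C : R) : 1 <= C -> averaging_bounded mu D q C ->
  exists sigma C' : R, [/\ 1 < sigma, sigma * sigma <= lo, 1 <= C',
    power_averaging_bounded mu D q (sigma * sigma) C' &
    forall F g t, packing D F -> nnm g -> 0 < t ->
      (integ mu (union F) (fun x => g x `^ q x)%R <= 1)%E ->
      (forall Q, F Q -> ((t `^ (sigma * sigma))%:E * mu Q <=
        integ mu Q (fun x => g x `^ (sigma * sigma))%R)%E) ->
      (integ mu (union F) (fun x => pmean sigma t (cubeof F x)) <= C'%:E)%E].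
Proof.
move=> C1 HA.
have [s [C5 [s1 slo C51 HT]]] := left_open gD dD mq lo1 lohi loq qhi C1 HA.
have [delta [C3 [de0 C31 RH]]] := reverse_holder gD dD mq lo1 lohi loq qhi C1 HA.
have [r rE] : exists r, r = s `^ 2^-1 by eexists.
have h20 : 0 < 2^-1 :> R by rewrite invr_gt0.
have s0 : 0 < s by lra.
have r1 : 1 < r by have := powR_lt_base h20 ler01 s1; rewrite powR1 rE.
have rr : r * r = s.
  rewrite rE -powRD; first by rewrite (_ : 2^-1 + 2^-1 = 1) ?powRr1 ?(ltW s0)//; lra.
  by rewrite gt_eqF ?implybT.
have [sigma sE] : exists sigma, sigma = Num.min r (1 + delta) by eexists.
have sig1 : 1 < sigma by rewrite sE lt_min r1; lra.
have sigr : sigma <= r by rewrite sE ge_min lexx.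
have sigd : sigma - 1 <= delta by rewrite lerBlDl sE ge_min lexx orbT.
have sig0 : 0 < sigma by lra.
have ss : sigma * sigma <= s by rewrite -rr; apply: ler_pM => //; exact: ltW.
have HT2 : power_averaging_bounded mu D q (sigma * sigma) C5.
  by apply: (power_averaging_le gD) ss HT; exact: mulr_gt0.
have C5h : 1 <= C5 `^ hi.
  by apply: powR_ge1 => //; apply: le_trans lohi; rewrite ltW// (lt_trans ltr01).
exists sigma, (C5 `^ hi * (1 + C3) + C5); split => //; first exact: le_trans slo.
- have : 0 <= C5 `^ hi * (1 + C3) by rewrite mulr_ge0 ?powR_ge0//; lra.
  lra.
- move=> F g u pF hg hu g1 hug; apply: le_trans (HT2 F g u pF hg hu g1 hug) _.
  by rewrite lee_fin lerDr mulr_ge0 ?powR_ge0//; lra.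
move=> F g t pF hg t0 g1 htg.
have fF := packing_family gD pF; have mF := measurable_union fF.
have t1 : (integ mu (union F) (fun x => t `^ q x)%R <= C5%:E)%E.
  apply: (HT2 F g (fun=> t)) => //; first exact/nnm_cst/ltW.
  by move=> Q x FQ _; exact: htg.
have C50 : 0 < C5 by lra.
have [y yE] : exists y, y = C5^-1 * t by eexists.
have y0 : 0 < y by rewrite yE mulr_gt0// invr_gt0.
have tE : t = C5 * y by rewrite yE mulVKf ?gt_eqF.
have C5i0 : 0 <= C5^-1 by rewrite invr_ge0 ltW.
have C5i1 : C5^-1 <= 1 by rewrite invf_le1.
have hct : nnm (fun _ : T => t) by exact/nnm_cst/ltW.
have hcy : nnm (fun _ : T => y) by exact/nnm_cst/ltW.
have hyq : nnm (fun x => y `^ q x) by exact: nnm_powR.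
have y1 : (integ mu (union F) (fun x => y `^ q x)%R <= 1)%E.
  rewrite yE; apply: le_trans (integ_pow_scale_le1 mu mq lo1 loq mF hct C5i0 C5i1) _.
  apply: (@le_trans _ _ ((C5^-1)%:E * C5%:E)%E); last first.
    by rewrite -EFinM mulVf ?gt_eqF.
  apply: lee_pmul => //; [by rewrite lee_fin powR_ge0|exact/integ_ge0/nnm_powR|].
  rewrite lee_fin -[leRHS]powRr1//; apply: powR_exp_le1 => //; exact: ltW.
have [phi phiE] : exists phi : set T -> R, phi = fun Q => (avg mu Q (fun z => y `^ q z))^-1.
  by eexists.
have hphi : nnm (fun x => phi (cubeof F x)).
  by apply: (cubeof_nnm gD) => // Q; rewrite phiE invr_ge0 avg_ge0.
have hk : nnm (fun x => y `^ q x * phi (cubeof F x)) by exact: nnmM.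
set k := fun x => _ in hk.
have kE Q x : F Q -> Q x -> k x = y `^ q x / avg mu Q (fun z => y `^ q z).
  by move=> FQ Qx; rewrite /k (cubeofE fF FQ Qx) phiE.
have ftq Q : F Q -> (integ mu Q (fun x => y `^ q x)%R < +oo)%E.
  move=> FQ; have := exp_fin (pF.1 _ FQ) (ltW y0) ler01.
  by rewrite (@eq_integ _ _ _ mu Q _ (fun x => y `^ q x))// => x _; rewrite mulr1.
have kQ Q : F Q -> (integ mu Q k <= mu Q)%E.
  move=> FQ; have cQ := pF.1 _ FQ; have mQ := grid_measurable gD cQ.
  have A0 := avg_ge0 mu Q hyq.
  have Ai0 : 0 <= (avg mu Q (fun z => y `^ q z))^-1 by rewrite invr_ge0.
  rewrite (@eq_integ _ _ _ mu Q _
    (fun x => (avg mu Q (fun z => y `^ q z))^-1 * y `^ q x)); last first.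
    by move=> x Qx; rewrite (kE _ _ FQ Qx) mulrC.
  rewrite (integZ mu mQ Ai0 hyq) -(cube_avgE gD cQ hyq (ftq _ FQ)) muleA -EFinM.
  rewrite -[leRHS]mul1e; apply: lee_wpmul2r; first exact: measure_ge0.
  rewrite lee_fin; have [->|nz] := eqVneq (avg mu Q (fun z => y `^ q z)) 0.
    by rewrite mulr0.
  by rewrite mulVf.
have hkd : nnm (fun x => k x `^ delta).
  by apply: nnm_powR => //; exact: nnm_meas.
have RHk := RH F k (fun=> y) pF hk hcy (fun _ _ _ _ _ _ => erefl) kQ y1.
have hyk := nnmM hyq hkd.
have hsum := nnmD hyq hyk.
have Ch0 : 0 <= C5 `^ hi by exact: powR_ge0.
apply: (@le_trans _ _ (integ mu (union F)
    (fun x => C5 `^ hi * (y `^ q x + y `^ q x * k x `^ delta)))).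
  apply: integ_union_le => //.
  - by apply: (cubeof_nnm gD) => // Q; exact: pmean_ge0.
  - exact: nnmZ.
  move=> Q FQ; have cQ := pF.1 _ FQ; have mQ := grid_measurable gD cQ.
  rewrite (@eq_integ _ _ _ mu Q _ (fun=> pmean sigma t Q)); last first.
    by move=> x Qx; rewrite (cubeofE fF FQ Qx).
  rewrite integ_cst// (integZ mu mQ Ch0 hsum).
  apply: (@le_trans _ _ ((C5 `^ hi)%:E * ((pmean sigma y Q)%:E * mu Q))%E).
    rewrite muleA -EFinM; apply: lee_wpmul2r; first exact: measure_ge0.
    by rewrite lee_fin tE; exact: pmean_scale cQ sig0 (ltW y0) C51.
  apply: lee_wpmul2l; rewrite ?lee_fin//.
  by apply: pmean_reverse => // x Qx; rewrite (kE _ _ FQ Qx).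
rewrite (integZ mu mF Ch0 hsum) (integD mu mF hyq hyk) EFinD.
apply: (@le_trans _ _ (C5 `^ hi * (1 + C3))%:E); last first.
  by rewrite -EFinD lee_fin lerDl ltW.
by rewrite EFinM; apply: lee_wpmul2l; rewrite ?lee_fin// EFinD leeD.
Qed.

End Improved.

(** * Homogeneous estimates on level sets *)

Lemma powRD_gt0 {R : realType} (a x y : R) : 0 < a ->
  a `^ (x + y) = a `^ x * a `^ y.
Proof. by move=> a0; rewrite powRD// (gt_eqF a0) implybT. Qed.

Section Levels.
Context {R : realType} {d : measure_display} {T : measurableType d}.
Variable mu : {measure set T -> \bar R}.
Variables (D : int -> set (set T)) (eps : R).
Hypotheses (gD : grid mu D eps).
Variables (q : T -> R) (lo hi : R).
Hypotheses (mq : measurable_fun [set: T] q) (lo1 : 1 < lo) (lohi : lo <= hi)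
  (loq : forall x, lo <= q x) (qhi : forall x, q x <= hi).

Let q1 x : 1 < q x. Proof. exact: lt_le_trans (loq x). Qed.
Let q0 x : 0 < q x. Proof. by apply: lt_trans (q1 x). Qed.

Lemma jensen_concave Q h (b y : R) : cube D Q -> nnm h -> 0 <= b -> b <= 1 ->
  0 <= y -> (integ mu Q h <= y%:E * mu Q)%E ->
  (integ mu Q (fun x => h x `^ b)%R <= (y `^ b)%:E * mu Q)%E.
Proof.
move=> cQ hh; have mQ := grid_measurable gD cQ.
rewrite le_eqVlt => /predU1P[<- _ _ _|b0 b1 y0 hy].
  rewrite powRr0 -integ_cst//; rewrite (@eq_integ _ _ _ mu Q _ (fun=> 1))//.
  by move=> x _; rewrite powRr0.
have hb : nnm (fun x => h x `^ b) by apply: nnm_powR => //; exact: nnm_meas.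
have b1' : 1 <= b^-1 by rewrite invf_ge1.
apply: (jensen_root mQ (grid_gt0 gD cQ) (grid_fin gD cQ) hb b1') => //.
  exact: powR_ge0.
rewrite powR_Kroot// (@eq_integ _ _ _ mu Q _ h)// => x _.
by rewrite powR_Kroot// nnm_ge0.
Qed.

Variables (s C : R).
Hypotheses (s1 : 1 < s) (slo : s < lo) (C1 : 1 <= C)
  (HT : power_averaging_bounded mu D q s C).

Let s0 : 0 < s. Proof. by apply: lt_trans s1. Qed.

Lemma power_averaging1 Q g (t : R) : cube D Q -> nnm g -> 0 <= t ->
  (integ mu Q (fun x => g x `^ q x)%R <= 1)%E ->
  ((t `^ s)%:E * mu Q <= integ mu Q (fun x => g x `^ s)%R)%E ->
  (integ mu Q (fun x => t `^ q x)%R <= C%:E)%E.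
Proof.
move=> cQ hg t0 g1 tg; have := HT (packing1 cQ) hg (nnm_cst t0).
by rewrite !union1; apply => // _ x -> _.
Qed.

Let e x := (q x - s)^-1.
Let qs0 x : 0 < q x - s. Proof. by rewrite subr_gt0 (lt_le_trans slo). Qed.
Let e0 x : 0 < e x. Proof. by rewrite invr_gt0. Qed.
Let qe x : q x * e x = 1 + s * e x.
Proof. by rewrite -[1](mulfV (_ : q x - s != 0)) ?gt_eqF// -mulrDl subrK. Qed.

Let me : measurable_fun [set: T] e.
Proof.
rewrite (_ : e = fun x => (q x - s) `^ (-1)).
  by apply: measurable_powR2 => //; exact: measurable_funB.
by apply/funext => x; rewrite powR_inv1// ltW.
Qed.

(** Up to constants, the function [k `^ e] has the least modular among all
    functions with its [L^s] mean. Indeed [r `^ s <= r `^ q / k] wherever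
    [r > k `^ e]. *)
Let ext_lower Q G (k t : R) : cube D Q -> nnm G -> 0 < k -> 0 <= t ->
  (mu Q <= integ mu Q (fun x => G x `^ s)%R)%E ->
  (integ mu Q (fun x => k `^ (s * e x))%R <= (t `^ s / 2)%:E * mu Q)%E ->
  ((k * t `^ s / 2)%:E * mu Q <= integ mu Q (fun x => (t * G x) `^ q x)%R)%E.
Proof.
move=> cQ hG k0 t0 GQ kQ; have mQ := grid_measurable gD cQ.
have htG : nnm (fun x => t * G x) by exact: nnmZ.
have hGs : nnm (fun x => G x `^ s) by apply: nnm_powR => //; exact: nnm_meas.
have hk : nnm (fun x => k `^ (s * e x)).
  by apply: nnm_powR => //; exact: measurable_funM.
have hq : nnm (fun x => (t * G x) `^ q x) by exact: nnm_pow.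
have ki0 : 0 <= k^-1 by rewrite invr_ge0 ltW.
have H : ((t `^ s)%:E * mu Q <= integ mu Q (fun x => k `^ (s * e x))%R +
    (k^-1)%:E * integ mu Q (fun x => (t * G x) `^ q x)%R)%E.
  apply: (@le_trans _ _ ((t `^ s)%:E * integ mu Q (fun x => G x `^ s)%R)%E).
    by apply: lee_wpmul2l; rewrite ?lee_fin ?powR_ge0.
  rewrite -(integZ mu mQ (powR_ge0 _ _) hGs) -(integZ mu mQ ki0 hq).
  rewrite -(integD mu mQ hk (nnmZ ki0 hq)).
  apply: (le_integ mu mQ (nnmZ (powR_ge0 _ _) hGs) (nnmD hk (nnmZ ki0 hq))).
  move=> x _; have Gx := nnm_ge0 x hG; rewrite -powRM//.
  have tGx := nnm_ge0 x htG; set r := t * G x in tGx *.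
  have [rk|kr] := leP r (k `^ e x).
    apply: (@le_trans _ _ ((k `^ e x) `^ s)).
      by apply: powR_le_base => //; exact: ltW.
    by rewrite -powRrM mulrC lerDl mulr_ge0// powR_ge0.
  have r0 : 0 < r by apply: le_lt_trans kr; exact: powR_ge0.
  have kr' : k <= r `^ (q x - s).
    have := powR_le_base (ltW (qs0 x)) (powR_ge0 _ _) (ltW kr).
    by rewrite -powRrM mulVf ?gt_eqF// powRr1// ltW.
  apply: (@le_trans _ _ (k^-1 * r `^ q x)); last by rewrite lerDr powR_ge0.
  rewrite ler_pdivlMl// -[q x](subrK s) powRD_gt0//.
  by rewrite ler_wpM2r ?powR_ge0.
have [m m0 mE] := cube_measure gD cQ.
have iq := integ_ge0 mu Q hq; have ik := integ_ge0 mu Q hk.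
rewrite mE in kQ H *.
case: (integ mu Q (fun x => (t * G x) `^ q x)) iq H => [b b0 H| |]//; last first.
  by move=> _ _; rewrite leey.
have {}H : (((t `^ s) * m)%:E <= (t `^ s / 2 * m + k^-1 * b)%:E)%E.
  rewrite EFinM; apply: (le_trans H); rewrite EFinD.
  by apply: leeD; rewrite EFinM.
rewrite lee_fin in H; rewrite -EFinM lee_fin.
have h3 : t `^ s * m / 2 <= k^-1 * b by lra.
rewrite ler_pdivlMl// in h3.
by apply: le_trans h3; rewrite le_eqVlt; apply/orP; left; apply/eqP; ring.
Qed.

(** A bound that is homogeneous in the modular, on a single cube. Choose [k]
    so that [k `^ e] has modular about [1], and let [tau] be its [L^s] mean.
    Then [tau `^ q] has integral at most [C]. If [tau <= t], the extremality of
    [k `^ e] bounds the modular of [t * G] from below by a constant multiple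
    of [1]. If [1 <= t <= tau], write [t = tau `^ b] with [b <= 1]; by Jensen's
    inequality for the concave power [b], the upper bound for the mean of
    [tau `^ (q - s)] passes to its [b]-th power, and [k `^ b] takes the place
    of [k] in the lower bound. *)
Lemma high_level : exists C2 : R, 1 <= C2 /\ forall Q G (t : R), cube D Q ->
  nnm G -> 1 <= t -> (mu Q <= integ mu Q (fun x => G x `^ s)%R)%E ->
  (integ mu Q (fun x => (t * G x) `^ q x)%R <= 1)%E ->
  (integ mu Q (fun x => t `^ q x)%R <=
    C2%:E * integ mu Q (fun x => (t * G x) `^ q x)%R)%E.
Proof.
have [B BE] : exists B, B = 2 `^ (hi / (lo - s)) :> R by eexists.
have ls0 : 0 < lo - s by rewrite subr_gt0.
have lo0 : 0 < lo by exact: lt_trans lo1.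
have hi0 : 0 < hi by exact: lt_le_trans lohi.
have B1 : 1 <= B.
  by rewrite BE; apply: powR_ge1; [rewrite divr_ge0// ltW|rewrite ler1n].
have [de [deE]] : exists de : R, de `^ (s / hi) = 2^-1 /\ 0 < de <= 1.
  exists (2^-1 `^ (s / hi)^-1).
  have sh0 : 0 < s / hi by rewrite divr_gt0.
  split; first by rewrite powR_rootK// invr_ge0.
  rewrite powR_gt0 ?invr_gt0//=; apply: powR_le1; rewrite ?invr_ge0 ?(ltW sh0)//.
  by rewrite invf_le1// ler1n.
move=> /andP[de0 de1].
have qeB x : q x * e x <= hi / (lo - s).
  apply: ler_pM => //; [exact: ltW|exact: ltW|].
  by rewrite lef_pV2 ?posrE// lerD2r.
have qe1 x : 1 <= q x * e x by rewrite qe lerDl mulr_ge0// ltW.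
have seh x : s / hi <= s * e x.
  rewrite ler_pM2l// lef_pV2 ?posrE//; apply: le_trans (qhi x).
  by rewrite lerBlDr lerDl ltW.
have K1 : 1 <= C * B by exact: mulr_ege1.
have [C2 C2E] : exists C2, C2 = 2 * (C * B) / de by eexists.
exists C2; split.
  by rewrite C2E ler_pdivlMr// mul1r; lra.
move=> Q G t cQ hG t1 GQ tG1; have mQ := grid_measurable gD cQ.
have [m m00 mE] := cube_measure gD cQ.
have npe (k : R) (f : T -> R) : measurable_fun setT f -> nnm (fun x => k `^ f x).
  by move=> mf; exact: nnm_powR.
have mqe : measurable_fun setT (fun x => q x * e x) by exact: measurable_funM.
have mse : measurable_fun setT (fun x => s * e x) by exact: measurable_funM.
pose P (k : R) := integ mu Q (fun x => k `^ (q x * e x)).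
have Ple a b : 0 < a -> a <= b -> (P a <= P b)%E.
  move=> a0 ab; apply: (le_integ mu mQ (npe _ _ mqe) (npe _ _ mqe)) => x _.
  by apply: powR_le_base => //; [exact: le_trans (qe1 x)|exact: ltW].
(* All exponents [q x * e x] are at least [1], so the constants
   [min 1 m^-1] and [max 1 (2 / m)] enclose the value to be found. *)
have [k [k0' Pk Pk2]] : exists k, [/\ Num.min 1 m^-1 <= k, (P k <= 1)%E &
    (1 < P (2 * k)%R)%E].
  apply: (@crossing R P (Num.min 1 m^-1) (Num.max 1 (2 / m))) => //.
  - by rewrite lt_min ltr01 invr_gt0.
  - apply: (@le_trans _ _ (integ mu Q (fun=> m^-1))).
      have mi0 : 0 <= m^-1 by rewrite invr_ge0 ltW.
      apply: (le_integ mu mQ (npe _ _ mqe) (nnm_cst mi0)) => x _.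
      have mn0 : 0 <= Num.min 1 m^-1 by rewrite le_min ler01.
      apply: (@le_trans _ _ (Num.min 1 m^-1 `^ 1)).
        by apply: powR_exp_le1; rewrite ?ge_min ?lexx.
      by rewrite powRr1// ge_min lexx orbT.
    by rewrite integ_cst// mE -EFinM mulVf// gt_eqF.
  - by rewrite lt_max ltr01.
  - apply: (@lt_le_trans _ _ (integ mu Q (fun=> 2 / m))).
      by rewrite integ_cst// mE -EFinM divfK ?gt_eqF// lte_fin ltr1n.
    have m20 : 0 <= 2 / m by rewrite divr_ge0// ltW.
    apply: (le_integ mu mQ (nnm_cst m20) (npe _ _ mqe)) => x _.
    have m1 : 1 <= Num.max 1 (2 / m) by rewrite le_max lexx.
    apply: (@le_trans _ _ (Num.max 1 (2 / m) `^ 1)).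
      by rewrite powRr1 ?le_max ?lexx ?ler01 ?orbT.
    exact: ler_powR.
have k0 : 0 < k by apply: lt_le_trans k0'; rewrite lt_min ltr01 invr_gt0.
have PB : (1 <= B%:E * P k)%E.
  apply: ltW; apply: lt_le_trans Pk2 _.
  have B0 : 0 <= B by lra.
  rewrite -(integZ mu mQ B0 (npe _ _ mqe)).
  apply: (le_integ mu mQ (npe _ _ mqe) (nnmZ B0 (npe _ _ mqe))) => x _.
  rewrite powRM ?(ltW k0)//; apply: ler_wpM2r; first exact: powR_ge0.
  by rewrite BE; apply: ler_powR => //; rewrite ler1n.
have [A AE] : exists A, A = avg mu Q (fun x => k `^ (s * e x)) by eexists.
have PE : P k = (k%:E * integ mu Q (fun x => k `^ (s * e x))%R)%E.
  rewrite -(integZ mu mQ (ltW k0) (npe _ _ mse)).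
  apply: eq_integ => x _; rewrite qe powRD_gt0//.
  by rewrite powRr1// ltW.
have fA : (integ mu Q (fun x => k `^ (s * e x))%R < +oo)%E.
  move: Pk; rewrite PE.
  case: (integ mu Q _) (integ_ge0 mu Q (npe k _ mse)) => [r _ _|_|//].
    by rewrite ltry.
  by rewrite gt0_muley ?lte_fin.
have Amu := cube_avgE gD cQ (npe _ _ mse) fA; rewrite -AE in Amu.
have A0 : 0 <= A by rewrite AE; apply: avg_ge0; exact: npe.
have [tau tauE] : exists tau, tau = A `^ s^-1 by eexists.
have tau0 : 0 <= tau by rewrite tauE powR_ge0.
have taus : tau `^ s = A by rewrite tauE powR_rootK.
have PA : P k = (k * A * m)%:E by rewrite PE -Amu mE !EFinM muleA.
have BkAm : 1 <= B * (k * A * m) by move: PB; rewrite PA -EFinM lee_fin.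
have Ap : 0 < A.
  rewrite lt_neqAle A0 andbT; apply/negP => /eqP A00.
  by move: BkAm; rewrite -A00 mulr0 mul0r mulr0 ler10.
have taup : 0 < tau by rewrite tauE powR_gt0.
have tauC : (integ mu Q (fun x => tau `^ q x)%R <= C%:E)%E.
  apply: (power_averaging1 cQ (npe k _ me) tau0).
    rewrite (@eq_integ _ _ _ mu Q _ (fun x => k `^ (q x * e x)))// => x _.
    by rewrite -powRrM mulrC.
  rewrite taus Amu (@eq_integ _ _ _ mu Q _ (fun x => k `^ (s * e x)))// => x _.
  by rewrite -powRrM mulrC.
have t0 : 0 < t by lra.
have htG : nnm (fun x => t * G x) by apply: nnmZ => //; exact: ltW.
have hGs : nnm (fun x => G x `^ s) by apply: nnm_powR => //; exact: nnm_meas.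
have low k' : 0 < k' -> (integ mu Q (fun x => k' `^ (s * e x))%R <=
    (t `^ s)%:E * mu Q)%E ->
    ((de * k' * t `^ s / 2)%:E * mu Q <=
     integ mu Q (fun x => (t * G x) `^ q x)%R)%E.
  move=> k'0 hk'; apply: ext_lower => //; [exact: mulr_gt0|exact: ltW|].
  apply: (@le_trans _ _ ((2^-1)%:E * integ mu Q (fun x => k' `^ (s * e x))%R)%E).
    have h20 : 0 <= 2^-1 :> R by rewrite invr_ge0.
    rewrite -(integZ mu mQ h20 (npe _ _ mse)).
    apply: (le_integ mu mQ (npe _ _ mse) (nnmZ h20 (npe _ _ mse))) => x _.
    rewrite powRM ?(ltW de0) ?(ltW k'0)// -deE; apply: ler_wpM2r.
      exact: powR_ge0.
    by apply: powR_exp_le1 => //; [exact: ltW|rewrite divr_gt0].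
  rewrite (mulrC (t `^ s)) EFinM -muleA.
  by apply: lee_wpmul2l => //; rewrite lee_fin invr_ge0.
have [taut|ttau] := leP tau t.
  have h1 : (integ mu Q (fun x => t `^ q x)%R <= C%:E)%E.
    apply: (power_averaging1 cQ htG (ltW t0) tG1).
    rewrite (@eq_integ _ _ _ mu Q _ (fun x => t `^ s * G x `^ s)); last first.
      by move=> x _; rewrite powRM ?(ltW t0) ?nnm_ge0.
    rewrite (integZ mu mQ (powR_ge0 _ _) hGs).
    by apply: lee_wpmul2l; rewrite ?lee_fin ?powR_ge0.
  have ts : A <= t `^ s by rewrite -taus; apply: powR_le_base => //; exact: ltW.
  have h0 : (integ mu Q (fun x => k `^ (s * e x))%R <= (t `^ s)%:E * mu Q)%E.
    by rewrite -Amu; apply: lee_wpmul2r; rewrite ?measure_ge0// lee_fin.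
  have h2 := low k k0 h0; apply: (le_trans h1).
  have C20 : (0 <= C2%:E)%E.
    by rewrite lee_fin C2E divr_ge0 ?(ltW de0)// mulr_ge0//; lra.
  apply: (@le_trans _ _ (C2%:E * ((de * k * t `^ s / 2)%:E * mu Q))%E); last first.
    exact: lee_wpmul2l.
  rewrite mE -!EFinM lee_fin C2E.
  have -> : 2 * (C * B) / de * (de * k * t `^ s / 2 * m) =
    C * (B * (k * t `^ s * m)) by field; rewrite gt_eqF.
  apply: ler_peMr; first exact: le_trans ler01 C1.
  apply: (le_trans BkAm); rewrite ler_pM2l; last lra.
  by rewrite ler_pM2r// ler_pM2l.
have lnt : 0 < ln tau by apply: ln_gt0; lra.
have [b bE] : exists b, b = ln t / ln tau by eexists.
have b0 : 0 <= b by rewrite bE; apply: divr_ge0; [exact: ln_ge0|exact: ltW].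
have b1 : b <= 1 by rewrite bE ler_pdivrMr// mul1r ler_ln ?posrE// ltW.
have tb : t = tau `^ b.
  by rewrite /powR gt_eqF// bE divfK ?gt_eqF// lnK ?posrE.
have kb0 : 0 < k `^ b by exact: powR_gt0.
have h0 : (integ mu Q (fun x => (k `^ b) `^ (s * e x))%R <=
    (t `^ s)%:E * mu Q)%E.
  rewrite (@eq_integ _ _ _ mu Q _ (fun x => (k `^ (s * e x)) `^ b)); last first.
    by move=> x _; rewrite powRAC.
  rewrite tb powRAC taus.
  by apply: jensen_concave => //; [exact: npe|rewrite -Amu].
have h2 := low _ kb0 h0.
have mqs : measurable_fun setT (fun x => q x - s) by exact: measurable_funB.
have htau : (integ mu Q (fun x => tau `^ (q x - s))%R <= (C * B * k)%:E * mu Q)%E.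
  have As0 : 0 <= A^-1 by rewrite invr_ge0.
  rewrite (@eq_integ _ _ _ mu Q _ (fun x => A^-1 * tau `^ q x)); last first.
    move=> x _; rewrite -taus -{2}(subrK s (q x)) (powRD_gt0 (q x - s) s taup).
    by rewrite mulrC mulfK// gt_eqF// powR_gt0.
  rewrite (integZ mu mQ As0 (npe _ _ mq)).
  apply: (@le_trans _ _ (A^-1%:E * C%:E)%E).
    by apply: lee_wpmul2l => //; rewrite lee_fin.
  rewrite mE -!EFinM lee_fin mulrC ler_pdivrMr//.
  have -> : C * B * k * m * A = C * (B * (k * A * m)) by ring.
  by apply: ler_peMr => //; exact: le_trans ler01 C1.
have CBk0 : 0 <= C * B * k by rewrite mulr_ge0 ?(ltW k0)//; lra.
have htb := jensen_concave cQ (npe _ _ mqs) b0 b1 CBk0 htau.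
rewrite (@eq_integ _ _ _ mu Q _
  (fun x => t `^ s * (tau `^ (q x - s)) `^ b)); last first.
  move=> x _; rewrite powRAC -tb -powRD_gt0//.
  by rewrite addrC subrK.
have hnb : nnm (fun x => (tau `^ (q x - s)) `^ b).
  by apply: nnm_powR => //; exact: (nnm_meas (npe _ _ mqs)).
rewrite (integZ mu mQ (powR_ge0 _ _) hnb).
have C20 : (0 <= C2%:E)%E.
  by rewrite lee_fin C2E divr_ge0 ?(ltW de0)// mulr_ge0//; lra.
apply: (@le_trans _ _ (C2%:E * ((de * k `^ b * t `^ s / 2)%:E * mu Q))%E); last first.
  exact: lee_wpmul2l.
apply: (@le_trans _ _ ((t `^ s)%:E * (((C * B * k) `^ b)%:E * mu Q))%E).
  by apply: lee_wpmul2l => //; rewrite lee_fin powR_ge0.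
rewrite mE -!EFinM lee_fin C2E.
have -> : 2 * (C * B) / de * (de * k `^ b * t `^ s / 2 * m) =
  t `^ s * ((C * B * k `^ b) * m) by field; rewrite gt_eqF.
rewrite ler_wpM2l ?powR_ge0// ler_pM2r// powRM ?(ltW k0)//; last lra.
rewrite ler_pM2r// -[leRHS]powRr1; last lra.
exact: ler_powR.
Qed.

End Levels.

Section LowLevels.
Context {R : realType} {d : measure_display} {T : measurableType d}.
Variable mu : {measure set T -> \bar R}.
Variables (D : int -> set (set T)) (eps : R).
Hypotheses (gD : grid mu D eps).
Variables (q : T -> R) (lo hi : R).
Hypotheses (mq : measurable_fun [set: T] q) (lo1 : 1 < lo) (lohi : lo <= hi)
  (loq : forall x, lo <= q x) (qhi : forall x, q x <= hi).

Let q1 x : 1 < q x. Proof. exact: lt_le_trans (loq x). Qed.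
Let q0 x : 0 < q x. Proof. by apply: lt_trans (q1 x). Qed.

Variables (s C : R).
Hypotheses (s1 : 1 < s) (C1 : 1 <= C)
  (HT : power_averaging_bounded mu D q (s * s) C)
  (HV : forall F g t, packing D F -> nnm g -> 0 < t ->
      (integ mu (union F) (fun x => g x `^ q x)%R <= 1)%E ->
      (forall Q, F Q -> ((t `^ (s * s))%:E * mu Q <=
        integ mu Q (fun x => g x `^ (s * s))%R)%E) ->
      (integ mu (union F) (fun x => pmean mu q s t (cubeof F x)) <= C%:E)%E).

Let s0 : 0 < s. Proof. by apply: lt_trans s1. Qed.
Let th := s^-1.
Let th0 : 0 < th. Proof. by rewrite invr_gt0. Qed.
Let th1 : th < 1. Proof. by rewrite invf_lt1. Qed.
Let hi0 : 0 < hi.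
Proof. by apply: lt_le_trans lohi; apply: lt_trans lo1. Qed.
Let C0 : 0 < C. Proof. exact: lt_le_trans C1. Qed.

(** Without values in the interval from [0] to [1], the powers [G `^ b]
    increase with [b]. *)
Definition normal (G : T -> R) := nnm G /\ forall x, G x = 0 \/ 1 <= G x.

Let pw (f : T -> R) (a : R) : nnm f -> nnm (fun x => f x `^ a).
Proof. by move=> hf; apply: nnm_powR => //; exact: nnm_meas. Qed.

Let scaled (t : R) G b : 0 <= t -> nnm G -> nnm (fun x => (t * G x `^ b) `^ q x).
Proof. by move=> t0 hG; apply: nnm_pow => //; apply: nnmZ => //; exact: pw. Qed.

Let pmean1 Q G (k : R) : cube D Q -> nnm G -> 0 < k ->
  (mu Q <= integ mu Q (fun x => G x `^ s)%R)%E ->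
  (integ mu Q (fun x => (k * G x `^ th) `^ q x)%R <= 1)%E ->
  ((pmean mu q s k Q)%:E * mu Q <= C%:E)%E.
Proof.
move=> cQ hG k0 GQ g1; have mQ := grid_measurable gD cQ.
have := HV (packing1 cQ) (nnmZ (ltW k0) (pw th hG)) k0.
rewrite union1 => /(_ g1) H; rewrite -integ_cst//.
rewrite (@eq_integ _ _ _ mu Q _ (fun x => pmean mu q s k (cubeof [set Q] x))).
  apply: H => _ ->; rewrite (@eq_integ _ _ _ mu Q _
    (fun x => k `^ (s * s) * G x `^ s)); last first.
    move=> x _; rewrite powRM ?(ltW k0) ?powR_ge0// -(powRrM (G x)).
    by rewrite mulrA mulVf ?gt_eqF// mul1r.
  rewrite (integZ mu mQ (powR_ge0 _ _) (pw s hG)).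
  by apply: lee_wpmul2l; rewrite ?lee_fin ?powR_ge0.
move=> x Qx; rewrite (cubeofE (packing_family gD (packing1 cQ)) (erefl Q) Qx)//.
Qed.

Let pw2 (t : R) G b : 0 < t -> nnm G -> forall x,
  (t `^ b * G x `^ b) `^ q x = ((t * G x) `^ q x) `^ b.
Proof.
move=> t0 hG x; have Gx := nnm_ge0 x hG.
by rewrite -(powRM b (ltW t0) Gx) powRAC.
Qed.

(** Jensen's inequality on both sides: the mean of [t `^ q] to the power [b] is
    at most the [L^s] mean of [t `^ (b * q)] as [b * s >= 1], and the mean of a
    [b]-th power is at most the [b]-th power of the mean. *)
Let transfer Q G (t b K : R) : cube D Q -> nnm G -> 0 < t -> th <= b -> b <= 1 ->
  1 <= K -> (integ mu Q (fun x => (t * G x) `^ q x)%R <= 1)%E ->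
  ((pmean mu q s (t `^ b) Q)%:E * mu Q <=
    K%:E * integ mu Q (fun x => (t `^ b * G x `^ b) `^ q x)%R)%E ->
  (integ mu Q (fun x => t `^ q x)%R <=
    (K `^ s)%:E * integ mu Q (fun x => (t * G x) `^ q x)%R)%E.
Proof.
move=> cQ hG t0 tb b1 K1 W1 zK; have mQ := grid_measurable gD cQ.
have b0 : 0 < b by exact: lt_le_trans tb.
have hW : nnm (fun x => (t * G x) `^ q x).
  by apply: nnm_pow => //; apply: nnmZ => //; exact: ltW.
have fW : (integ mu Q (fun x => (t * G x) `^ q x)%R < +oo)%E.
  by apply: le_lt_trans W1 _; rewrite ltry.
have WE := cube_avgE gD cQ hW fW.
have [B BE] : exists B, B = avg mu Q (fun x => (t * G x) `^ q x) by eexists.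
rewrite -BE in WE; have B0 : 0 <= B by rewrite BE; exact: avg_ge0.
have htq : nnm (fun x => t `^ q x) by exact: nnm_powR.
have ftq : (integ mu Q (fun x => t `^ q x)%R < +oo)%E.
  have := exp_fin gD mq lo1 loq qhi cQ (ltW t0) ler01.
  by rewrite (@eq_integ _ _ _ mu Q _ (fun x => t `^ q x))// => x _; rewrite mulr1.
have AE := cube_avgE gD cQ htq ftq.
have [A AA] : exists A, A = avg mu Q (fun z => t `^ q z) by eexists.
rewrite -AA in AE; have A0 : 0 <= A by rewrite AA; exact: avg_ge0.
have [m m0 mE] := cube_measure gD cQ.
rewrite -AE -WE mE -!EFinM lee_fin mulrA ler_pM2r//.
have z0 : 0 <= pmean mu q s (t `^ b) Q by exact: pmean_ge0.
have [z zE] : exists z, z = pmean mu q s (t `^ b) Q by eexists.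
rewrite -zE in zK z0.
have zb : z <= K * B `^ b.
  have K0 : 0 <= K by lra.
  have : (integ mu Q (fun x => (t `^ b * G x `^ b) `^ q x)%R <= (B `^ b)%:E * mu Q)%E.
    rewrite (@eq_integ _ _ _ mu Q _ (fun x => ((t * G x) `^ q x) `^ b)).
      by apply: (jensen_concave gD) => //; [exact: ltW|rewrite -WE].
    by move=> x _; exact: pw2.
  move=> h; have : (z%:E * mu Q <= K%:E * ((B `^ b)%:E * mu Q))%E.
    by apply: (le_trans zK); apply: lee_wpmul2l.
  by rewrite mE -!EFinM lee_fin mulrA ler_pM2r.
have bs1 : 1 <= b * s by move: tb; rewrite -ler_pdivrMr// div1r.
have Ab : A `^ (b * s) <= z `^ s.
  have : ((A `^ (b * s))%:E * mu Q <= (z `^ s)%:E * mu Q)%E.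
    rewrite zE (pmeanE gD mq lo1 loq qhi cQ s0 (powR_ge0 _ _)).
    rewrite (@eq_integ _ _ _ mu Q _ (fun x => (t `^ q x) `^ (b * s))).
      apply: jensen_powR => //; [exact: (grid_fin gD)|by rewrite AE].
    by move=> x _; rewrite -!powRrM; congr (_ `^ _); ring.
  by rewrite mE -!EFinM lee_fin ler_pM2r.
have Kb1 : 1 <= K `^ b^-1 by apply: powR_ge1 => //; rewrite invr_ge0 ltW.
have : A <= K `^ b^-1 * B.
  have bs0 : 0 < b * s by exact: mulr_gt0.
  rewrite -(@powR_le_baseP _ (b * s))//; last first.
    by rewrite mulr_ge0 ?powR_ge0.
  apply: (le_trans Ab).
  rewrite powRM ?powR_ge0// -powRrM mulrA mulVf ?gt_eqF// mul1r.
  rewrite powRrM -powRM ?powR_ge0//; last lra.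
  by apply: powR_le_base => //; exact: ltW.
move=> /le_trans; apply; apply: ler_wpM2r => //.
apply: ler_powR => //; rewrite -(invrK s).
by rewrite lef_pV2// posrE.
Qed.

(** Interpolate between the modulars of [t * G] and [(t * G) `^ s^-1]. If the
    second one exceeds [1], then some [k = t `^ b] in between gives
    [k * G `^ s^-1] a modular comparable to [1], so that the [L^s] means satisfy
    the homogeneous inequality at the power [b], and [transfer] brings it back
    to the power [1]. If it does not exceed [1], then the power [b = s^-1] will
    do, unless the second alternative holds. *)
Lemma low_cube : exists C2 : R, 1 <= C2 /\ forall Q G (t : R), cube D Q ->
  normal G -> 0 < t -> t < 1 -> (mu Q <= integ mu Q (fun x => G x `^ s)%R)%E ->
  (integ mu Q (fun x => (t * G x) `^ q x)%R <= 1)%E ->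
  (integ mu Q (fun x => t `^ q x)%R <=
    C2%:E * integ mu Q (fun x => (t * G x) `^ q x)%R)%E \/
  (integ mu Q (fun x => (t `^ th * G x `^ th) `^ q x)%R <= 1)%E /\
  ((4 * C)%:E * integ mu Q (fun x => (t `^ th * G x `^ th) `^ q x)%R <=
    (pmean mu q s (t `^ th) Q)%:E * mu Q)%E.
Proof.
have h2 : 1 <= 2 `^ hi :> R by apply: powR_ge1; [exact: ltW|rewrite ler1n].
have [K KE] : exists K, K = 4 * C * 2 `^ hi by eexists.
have CB1 : 1 <= C * 2 `^ hi by exact: mulr_ege1.
have K4 : 4 * C <= K by rewrite KE; apply: ler_peMr => //; rewrite mulr_ge0// ltW.
have K2 : C * 2 `^ hi <= K by rewrite KE -mulrA; lra.
have K1 : 1 <= K by exact: le_trans K2.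
have K0 : 0 <= K by lra.
exists (K `^ s); split; first by apply: powR_ge1 => //; exact: ltW.
move=> Q G t cQ [hG nG] t0 t1 GQ W1; have mQ := grid_measurable gD cQ.
have tth0 : 0 < t `^ th by exact: powR_gt0.
have hS b : nnm (fun x => (t `^ b * G x `^ b) `^ q x).
  exact: (scaled _ (powR_ge0 _ _) hG).
have [S1|S1] := leP (integ mu Q (fun x => (t `^ th * G x `^ th) `^ q x)) 1%E.
  have [|lt4] := leP ((4 * C)%:E * integ mu Q
    (fun x => (t `^ th * G x `^ th) `^ q x)%R)%E
    ((pmean mu q s (t `^ th) Q)%:E * mu Q)%E; first by right.
  left; apply: (transfer (b := th)) => //; [exact: ltW|].
  apply: (le_trans (ltW lt4)); apply: lee_wpmul2r; first exact: integ_ge0.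
  by rewrite lee_fin.
left; pose phi k := integ mu Q (fun x => (k * G x `^ th) `^ q x).
have hphi k : 0 <= k -> nnm (fun x => (k * G x `^ th) `^ q x).
  by move=> k0; exact: scaled.
have hGth : nnm (fun x => G x `^ th) by exact: pw.
have phi_le a b : 0 < a -> a <= b -> (phi a <= phi b)%E.
  move=> a0 ab; have b0 : 0 < b by exact: lt_le_trans ab.
  apply: (le_integ_pow mu mq lo1 loq mQ (nnmZ (ltW a0) hGth) (nnmZ (ltW b0) hGth)).
  by move=> x _; rewrite ler_wpM2r// powR_ge0.
have Gle b c x : 0 < b -> b <= c -> G x `^ b <= G x `^ c.
  move=> b0 bc; have [->|G1] := nG x; last exact: ler_powR.
  by rewrite !powR0// gt_eqF// (lt_le_trans b0).
have phit : (phi t <= 1)%E.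
  apply: le_trans W1.
  apply: (le_integ_pow mu mq lo1 loq mQ (nnmZ (ltW t0) hGth) (nnmZ (ltW t0) hG)).
  move=> x _; rewrite ler_wpM2l ?(ltW t0)// -[leRHS]powRr1 ?nnm_ge0//.
  by apply: Gle => //; exact: ltW.
have [k [tk pk p2k]] := crossing t0 phi_le phit tth0 S1.
have k0 : 0 < k by exact: lt_le_trans tk.
have kt : k < t `^ th.
  rewrite ltNge; apply/negP => /(phi_le _ _ tth0) h.
  by have := lt_le_trans S1 h; rewrite ltNge pk.
have lnt : ln t < 0 by apply: ln_lt0; rewrite t0.
have [b bE] : exists b, b = ln k / ln t by eexists.
have kE : k = t `^ b.
  by rewrite /powR gt_eqF// bE divfK ?lt_eqF// lnK.
have tb : th <= b.
  rewrite bE ler_ndivlMr// -ln_powR ler_ln ?posrE//; exact: ltW.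
have b1 : b <= 1 by rewrite bE ler_ndivrMr// mul1r ler_ln ?posrE.
have b0 : 0 < b by exact: lt_le_trans tb.
apply: (transfer (b := b)) => //.
rewrite -kE; apply: (le_trans (pmean1 cQ hG k0 GQ pk)).
have hi20 : 0 <= 2 `^ hi :> R by exact: powR_ge0.
have : (1 <= (2 `^ hi)%:E * phi k)%E.
  apply: (le_trans (ltW p2k)).
  apply: le_trans (integ_pow_scale_ge1 mu mq qhi mQ (nnmZ (ltW k0) hGth) _).
    rewrite /phi (@eq_integ _ _ _ mu Q _ (fun x => (2 * (k * G x `^ th)) `^ q x))//.
    by move=> x _; rewrite mulrA.
  by rewrite ler1n.
move=> h; apply: (@le_trans _ _ (C%:E * ((2 `^ hi)%:E * phi k))%E).
  by rewrite -[leLHS]mule1; apply: lee_wpmul2l => //; rewrite lee_fin ltW.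
rewrite muleA -EFinM; apply: (@le_trans _ _ (K%:E * phi k)%E).
  by apply: lee_wpmul2r; [exact/integ_ge0/hphi/ltW|rewrite lee_fin].
apply: lee_wpmul2l; first by rewrite lee_fin.
rewrite /phi kE.
apply: (le_integ_pow mu mq lo1 loq mQ (nnmZ (powR_ge0 _ _) hGth)
  (nnmZ (powR_ge0 _ _) (pw b hG))).
by move=> x _; rewrite ler_wpM2l ?powR_ge0//; exact: Gle.
Qed.

(** On the cubes that violate the homogeneous inequality, let [S] be the
    modular of [(t * G) `^ s^-1]. If [S <= 1] on a subfamily, then the bound on
    [L^s] means improves this to [S <= 1 / 4]; as single cubes satisfy
    [S <= 1], adding them one by one shows that [S <= 1] on all of them. So the
    power averaging bound controls [t `^ s^-1] there, and the remaining factor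
    [t `^ (1 - s^-1)] is small. *)
Lemma low_level : exists C2 : R, 1 <= C2 /\ forall F G (t : R), packing D F ->
  normal G -> 0 < t -> t < 1 ->
  (forall Q, F Q -> (mu Q <= integ mu Q (fun x => G x `^ s)%R)%E) ->
  (integ mu (union F) (fun x => (t * G x) `^ q x)%R <= 1)%E ->
  (integ mu (union F) (fun x => t `^ q x)%R <=
    C2%:E * integ mu (union F) (fun x => (t * G x) `^ q x)%R +
    (C * t `^ ((1 - th) * lo))%:E)%E.
Proof.
have [C2 [C21 HC2]] := low_cube; exists C2; split => //.
move=> F G t pF nG t0 t1 GF W1; have [hG _] := nG.
have fF := packing_family gD pF; have mU := measurable_union fF.
have htG : nnm (fun x => (t * G x) `^ q x).
  by apply: nnm_pow => //; apply: nnmZ => //; exact: ltW.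
have htq : nnm (fun x => t `^ q x) by exact: nnm_powR.
have tth0 : 0 < t `^ th by exact: powR_gt0.
have C20 : 0 <= C2 by lra.
have hth : nnm (fun x => t `^ th * G x `^ th).
  by apply: nnmZ; [exact: ltW|exact: pw].
have hthq : nnm (fun x => (t `^ th * G x `^ th) `^ q x) by exact: nnm_pow.
pose good Q := (integ mu Q (fun x => t `^ q x)%R <=
  C2%:E * integ mu Q (fun x => (t * G x) `^ q x)%R)%E.
pose Fg := F `&` [set Q | good Q]; pose Fb := F `\` [set Q | good Q].
have FgF : Fg `<=` F by move=> Q [].
have FbF : Fb `<=` F by move=> Q [].
have pg := sub_packing FgF pF; have pb := sub_packing FbF pF.
have mg := measurable_union (packing_family gD pg).
have mb := measurable_union (packing_family gD pb).
have sub F' : F' `<=` F -> union F' `<=` union F.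
  by move=> FF x [Q FQ Qx]; exists Q => //; exact: FF.
have UE : union F `<=` union Fg `|` union Fb.
  move=> x [Q FQ Qx]; have [gQ|nQ] := pselect (good Q).
    by left; exists Q.
  by right; exists Q.
apply: le_trans (subset_integ mu mU (measurableU _ _ mg mb) htq UE) _.
apply: le_trans (integU_le mu mg mb htq) _; apply: leeD.
  apply: (@le_trans _ _ (C2%:E * integ mu (union Fg)
    (fun x => (t * G x) `^ q x)%R)%E).
    rewrite -(integZ mu mg C20 htG).
    apply: (integ_union_le (packing_family gD pg) htq (nnmZ C20 htG)).
    move=> Q [FQ gQ]; have mQ := grid_measurable gD (pF.1 _ FQ).
    by rewrite (integZ mu mQ C20 htG).
  apply: lee_wpmul2l; first by rewrite lee_fin.
  exact: (subset_integ mu mg mU htG (sub _ FgF)).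
have badQ Q : Fb Q ->
    (integ mu Q (fun x => (t `^ th * G x `^ th) `^ q x)%R <= 1)%E /\
    ((4 * C)%:E * integ mu Q (fun x => (t `^ th * G x `^ th) `^ q x)%R <=
    (pmean mu q s (t `^ th) Q)%:E * mu Q)%E.
  move=> [FQ ngQ]; have cQ := pF.1 _ FQ; have mQ := grid_measurable gD cQ.
  have WQ : (integ mu Q (fun x => (t * G x) `^ q x)%R <= 1)%E.
    apply: le_trans W1; apply: (subset_integ mu mQ mU htG).
    by move=> x Qx; exists Q.
  by have [] := HC2 Q G t cQ nG t0 t1 (GF _ FQ) WQ.
have ss : th * (s * s) = s by rewrite mulrA mulVf ?gt_eqF// mul1r.
have tQ Q : Fb Q -> (((t `^ th) `^ (s * s))%:E * mu Q <=
    integ mu Q (fun x => (t `^ th * G x `^ th) `^ (s * s))%R)%E.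
  move=> [FQ _]; have mQ := grid_measurable gD (pF.1 _ FQ).
  rewrite (@eq_integ _ _ _ mu Q _ (fun x => (t `^ th) `^ (s * s) * G x `^ s)).
    rewrite (integZ mu mQ (powR_ge0 _ _) (pw s hG)).
    by apply: lee_wpmul2l; [rewrite lee_fin powR_ge0|exact: GF].
  by move=> x _; rewrite powRM ?powR_ge0// -(powRrM (G x)) ss.
have quarter F' : F' `<=` Fb ->
    (integ mu (union F') (fun x => (t `^ th * G x `^ th) `^ q x)%R <= 1)%E ->
    (integ mu (union F') (fun x => (t `^ th * G x `^ th) `^ q x)%R <= 4^-1%:E)%E.
  move=> FF S1; have p' := sub_packing FF pb; have f' := packing_family gD p'.
  have m' := measurable_union f'.
  have V := HV p' hth tth0 S1 (fun Q FQ => tQ Q (FF Q FQ)).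
  have C40 : 0 < 4 * C by rewrite mulr_gt0.
  have : ((4 * C)%:E * integ mu (union F')
      (fun x => (t `^ th * G x `^ th) `^ q x)%R <= C%:E)%E.
    apply: le_trans V; rewrite -(integZ mu m' (ltW C40) hthq).
    have hz : nnm (fun x => pmean mu q s (t `^ th) (cubeof F' x)).
      by apply: (cubeof_nnm gD) => // Q; exact: pmean_ge0.
    apply: (integ_union_le f' (nnmZ (ltW C40) hthq) hz) => Q FQ.
    have cQ := p'.1 _ FQ; have mQ := grid_measurable gD cQ.
    rewrite (integZ mu mQ (ltW C40) hthq).
    rewrite (@eq_integ _ _ _ mu Q (fun x => pmean _ _ _ _ _)
      (fun=> pmean mu q s (t `^ th) Q)).
      by rewrite integ_cst//; exact: (badQ _ (FF _ FQ)).2.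
    by move=> x Qx; rewrite (cubeofE f' FQ Qx).
  rewrite -lee_pdivlMl// -EFinM; move=> /le_trans; apply.
  by rewrite lee_fin invfM -mulrA mulVf ?gt_eqF// mulr1.
have small : (integ mu (union Fb) (fun x => (t `^ th * G x `^ th) `^ q x)%R <= 1)%E.
  apply: (integ_union_fin (packing_family gD pb) hthq) => L LF.
  suff : (integ mu (union [set` L]) (fun x => (t `^ th * G x `^ th) `^ q x)%R <=
      4^-1%:E)%E.
    by move=> /le_trans; apply; rewrite lee_fin invf_le1// ler1n.
  elim: L LF => [_|Q L IH LF]; first by rewrite union_nil integ_set0 lee_fin invr_ge0.
  have LF' Q' : Q' \in L -> Fb Q' by move=> Q'L; apply: LF; rewrite inE Q'L orbT.
  have FQ : Fb Q by apply: LF; rewrite mem_head.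
  have cQ := pb.1 _ FQ; have mQ := grid_measurable gD cQ.
  apply: (quarter _ _ _) => //; rewrite union_cons.
  have mL : measurable (union [set` L]).
    apply/measurable_union/(packing_family gD)/(sub_packing _ pb).
    by move=> Q' /LF'.
  apply: le_trans (integU_le mu mQ mL hthq) _.
  have Q4 : (integ mu Q (fun x => (t `^ th * G x `^ th) `^ q x)%R <= 4^-1%:E)%E.
    have := quarter [set Q]; rewrite union1; apply; last exact: (badQ _ FQ).1.
    by move=> _ ->.
  apply: (@le_trans _ _ (4^-1%:E + 4^-1%:E)%E); first exact: leeD Q4 (IH LF').
  by rewrite -EFinD lee_fin; lra.
have hct : nnm (fun _ : T => t `^ th) by exact/nnm_cst/ltW.
have TT := HT pb hth hct small (fun Q x FQ _ => tQ Q FQ).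
have t1th : t `^ (1 - th) <= 1.
  by apply: powR_le1; [rewrite subr_ge0 ltW|exact: ltW|exact: ltW].
rewrite (@eq_integ _ _ _ mu _ (fun x => t `^ q x)
  (fun x => (t `^ (1 - th) * t `^ th) `^ q x)); last first.
  by move=> x _; rewrite -powRD_gt0// subrK powRr1// ltW.
apply: le_trans (integ_pow_scale_le1 mu mq lo1 loq mb hct (powR_ge0 _ _) t1th) _.
rewrite -powRrM mulrC EFinM muleC; apply: lee_wpmul2r => //.
by rewrite lee_fin powR_ge0.
Qed.

End LowLevels.

(** * The maximal operator of a grid *)

Section DyadicSums.
Context {R : realType}.
Implicit Types y b : R.

Lemma sum_powers_below b0 b y n : 0 < b0 -> b0 <= b -> 0 <= y ->
  \sum_(j < n) (if 2 ^+ j < y then (2 ^+ j) `^ b else 0) <=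
  (1 - 2^-1 `^ b0)^-1 * y `^ b.
Proof.
move=> b00 bb y0; have b0' : 0 < b by exact: lt_le_trans bb.
have h0 : 0 < 2^-1 :> R by rewrite invr_gt0.
have h1 : 2^-1 < 1 :> R by rewrite invf_lt1// ltr1n.
have rb0 : 2^-1 `^ b0 < 1 by have := powR_lt_base b00 (ltW h0) h1; rewrite powR1.
have rb : 2^-1 `^ b <= 2^-1 `^ b0 by apply: powR_exp_le1 => //; exact: ltW.
have [r rE] : exists r, r = 2^-1 `^ b by eexists.
have [r0 r0E] : exists r0, r0 = 2^-1 `^ b0 by eexists.
rewrite -rE -r0E in rb *; rewrite -r0E in rb0.
have rp : 0 < r by rewrite rE powR_gt0.
have K1 : (1 - r)^-1 <= (1 - r0)^-1 by rewrite lef_pV2 ?posrE; lra.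
have K0 : 0 <= (1 - r0)^-1 by rewrite invr_ge0; lra.
have p2 j : (2 ^+ j) `^ b = r^-1 ^+ j.
  by rewrite rE -powR_mulrn// powRAC powR_mulrn ?powR_ge0// -powR_inv1//
    (powRAC 2^-1) powR_inv1 ?invr_ge0// invrK.
have full m : \sum_(j < m) (2 ^+ j) `^ b <= r * (1 - r)^-1 * (2 ^+ m) `^ b.
  elim: m => [|m IH]; first by rewrite big_ord0 !mulr_ge0 ?powR_ge0// ?invr_ge0; lra.
  rewrite big_ord_recr/=; apply: (le_trans (lerD IH (lexx _))).
  rewrite !p2 exprS; set w := r^-1 ^+ m.
  by rewrite le_eqVlt; apply/orP; left; apply/eqP; field; lra.
elim: n => [|n IH]; first by rewrite big_ord0 mulr_ge0// powR_ge0.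
rewrite big_ord_recr/=; case: ifPn => [ny|_]; last by rewrite addr0.
apply: (@le_trans _ _ (\sum_(j < n.+1) (2 ^+ j) `^ b)).
  rewrite big_ord_recr/= lerD2r; apply: ler_sum => j _.
  by case: ifP => // _; exact: powR_ge0.
apply: (le_trans (full _)).
have -> : r * (1 - r)^-1 * (2 ^+ n.+1) `^ b = (1 - r)^-1 * (2 ^+ n) `^ b.
  by rewrite !p2 exprS; field; lra.
apply: ler_pM => //; first by rewrite invr_ge0; lra.
by apply: powR_le_base; [exact: ltW|rewrite exprn_ge0|exact: ltW].
Qed.

Lemma sum_inverse_powers_below b0 b y n : 0 < b0 -> b0 <= b -> 0 <= y ->
  \sum_(j < n) (if 2^-1 ^+ j.+1 < y then (2^-1 ^+ j.+1) `^ b else 0) <=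
  (1 - 2^-1 `^ b0)^-1 * y `^ b.
Proof.
move=> b00 bb; have b0' : 0 < b by exact: lt_le_trans bb.
have h0 : 0 < 2^-1 :> R by rewrite invr_gt0.
have h1 : 2^-1 < 1 :> R by rewrite invf_lt1// ltr1n.
have rb0 : 2^-1 `^ b0 < 1 by have := powR_lt_base b00 (ltW h0) h1; rewrite powR1.
have rb : 2^-1 `^ b <= 2^-1 `^ b0 by apply: powR_exp_le1 => //; exact: ltW.
have [r rE] : exists r, r = 2^-1 `^ b by eexists.
have [r0 r0E] : exists r0, r0 = 2^-1 `^ b0 by eexists.
rewrite -rE -r0E in rb *; rewrite -r0E in rb0.
have rp : 0 < r by rewrite rE powR_gt0.
have K1 : (1 - r)^-1 <= (1 - r0)^-1 by rewrite lef_pV2 ?posrE; lra.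
have K0 : 0 <= (1 - r0)^-1 by rewrite invr_ge0; lra.
have p2 j : (2^-1 ^+ j) `^ b = r ^+ j.
  by rewrite rE -powR_mulrn ?(ltW h0)// powRAC powR_mulrn ?powR_ge0.
elim: n y => [|n IH] y y0; first by rewrite big_ord0 mulr_ge0// powR_ge0.
rewrite big_ord_recl /=; case: ifPn => [ny|ny]; last first.
  rewrite add0r; have y20 : 0 <= 2 * y by rewrite mulr_ge0.
  rewrite (eq_bigr (fun j : 'I_n => r *
    (if 2^-1 ^+ j.+1 < 2 * y then (2^-1 ^+ j.+1) `^ b else 0))); last first.
    move=> j _; rewrite /bump/= add1n [in RHS]mulrC -ltr_pdivrMl//.
    rewrite -exprS; case: ifP => _; last by rewrite mul0r.
    by rewrite !p2 -exprSr.
  rewrite -mulr_sumr; apply: (le_trans (ler_wpM2l (ltW rp) (IH _ y20))).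
  rewrite powRM// mulrCA; apply: ler_wpM2l => //.
  rewrite mulrA rE -powRM ?(ltW h0)// mulVf// powR1 mul1r//.
apply: (@le_trans _ _ (\sum_(j < n.+1) r * r ^+ j)).
  rewrite big_ord_recl/=; apply: lerD; first by rewrite p2 expr1 expr0 mulr1.
  apply: ler_sum => j _; rewrite /bump/= add1n; case: ifP => _.
    by rewrite p2 -exprS.
  by rewrite mulr_ge0 ?exprn_ge0// ltW.
rewrite -mulr_sumr; have r1 : r < 1 by lra.
apply: (le_trans (ler_wpM2l (ltW rp) (geometric_sum_le _ (ltW rp) r1))).
rewrite mulrC; apply: ler_pM => //; [by rewrite invr_ge0; lra|exact: ltW|].
rewrite rE; apply: powR_le_base; [exact: ltW|exact: ltW|].
by move: ny; rewrite expr1 => /ltW.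
Qed.

End DyadicSums.

Section GridMaximal.
Context {R : realType} {d : measure_display} {T : measurableType d}.
Variable mu : {measure set T -> \bar R}.
Variables (D : int -> set (set T)) (eps : R).
Hypotheses (gD : grid mu D eps) (dD : differentiates mu D).
Variables (q : T -> R) (lo hi : R).
Hypotheses (mq : measurable_fun [set: T] q) (lo1 : 1 < lo) (lohi : lo <= hi)
  (loq : forall x, lo <= q x) (qhi : forall x, q x <= hi).

Let q1 x : 1 < q x. Proof. exact: lt_le_trans (loq x). Qed.
Let q0 x : 0 < q x. Proof. by apply: lt_trans (q1 x). Qed.

Definition superlevel (f : T -> R) (t : R) : set T :=
  [set x | exists Q, [/\ cube D Q, Q x & (t%:E * mu Q < integ mu Q f)%E]].

(** A point may lie in arbitrarily large cubes with mean above [t], so maximal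
    cubes exist only after a restriction to generations from [- n] on. *)
Lemma superlevel_bigcup f t : nnm f -> 0 <= t -> superlevel f t =
  \bigcup_n union (stopping mu D (D (- n%:Z)) f t).
Proof.
move=> hf t0; apply/seteqP; split; last first.
  move=> x [n _ [Q [[cQ _ lQ] _] Qx]]; by exists Q.
move=> x [Q [[k Dk] Qx lQ]].
have pk l : packing D (D l) by exact: (generation_packing gD (k := l)).
exists `|k|%N => //; have [P DP Px] := grid_cover gD (- `|k|%N%:Z) x.
have hQ : hit mu D (D (- `|k|%N%:Z)) f t Q.
  split => //; first by exists k.
  exists P => //; apply: (grid_nested gD _ DP Dk Px Qx).
  by rewrite abszE lerNl -normrN ler_norm.
have [Q' [sQ' QQ' _]] := hit_stopping gD (pk _) hf t0 hQ Qx.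
by exists Q' => //; exact: QQ'.
Qed.

(** For a cube on which the mean of [f] exceeds [t], this is a test function
    for the estimates on level sets: its [s]-th power is [2 * f / t] where this
    exceeds [1]. *)
Definition truncated (s : R) (f : T -> R) (t : R) (x : T) : R :=
  if t < 2 * f x then (2 * f x / t) `^ s^-1 else 0.

Lemma truncated_normal s f t : 0 < s -> 0 < t -> nnm f ->
  normal (truncated s f t).
Proof.
move=> s0 t0 hf; split; last first.
  move=> x; rewrite /truncated; case: ifPn => [tf|_]; [right|by left].
  by apply: powR_ge1; [rewrite invr_ge0 ltW|rewrite ler_pdivlMr// mul1r ltW].
apply/nnmP; split; last first.
  by move=> x; rewrite /truncated; case: ifP => // _; exact: powR_ge0.
have m2 : measurable_fun setT (fun x => 2 * f x).
  by apply: measurable_funM => //; exact: nnm_meas.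
apply: measurable_fun_ifT => //.
  by apply: measurable_fun_ltr.
apply: measurable_powR2 => //.
by apply: measurable_funM.
Qed.

(** The part of [f] below [t / 2] contributes at most half of the mean. *)
Lemma truncated_mean s f t Q : cube D Q -> 0 < s -> 0 < t -> nnm f ->
  (t%:E * mu Q <= integ mu Q f)%E ->
  (mu Q <= integ mu Q (fun x => truncated s f t x `^ s)%R)%E.
Proof.
move=> cQ s0 t0 hf tQ; have mQ := grid_measurable gD cQ.
have [hG _] := truncated_normal s0 t0 hf.
have hGs : nnm (fun x => truncated s f t x `^ s).
  by apply: nnm_powR => //; exact: nnm_meas.
have t20 : 0 <= t / 2 by lra.
have : (integ mu Q f <= integ mu Q
    (fun x => t / 2 + t / 2 * truncated s f t x `^ s)%R)%E.
  apply: (le_integ mu mQ hf (nnmD (nnm_cst t20) (nnmZ t20 hGs))) => x _.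
  rewrite /truncated; case: ifPn => [tf|]; last first.
    by rewrite -leNgt => ?; rewrite powR0 ?gt_eqF// mulr0 addr0; lra.
  rewrite powR_rootK//; last by rewrite divr_ge0// ?ltW//; lra.
  have -> : t / 2 * (2 * f x / t) = f x by field; rewrite gt_eqF.
  lra.
rewrite (integD mu mQ (nnm_cst t20) (nnmZ t20 hGs)) integ_cst//.
rewrite (integZ mu mQ t20 hGs) => H; have {H} := le_trans tQ H.
have [m m0 mE] := cube_measure gD cQ; rewrite mE.
case: (integ mu Q _) (integ_ge0 mu Q hGs) => [r| |]//.
  rewrite -!EFinM -EFinD !lee_fin => _ H.
  have : t / 2 * m <= t / 2 * r by lra.
  by rewrite ler_pM2l// divr_gt0.
by move=> _ _; rewrite leey.
Qed.

Lemma truncated_le s f t x : 1 <= s -> 0 < t -> nnm f ->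
  t * truncated s f t x <= 2 * f x.
Proof.
move=> s1 t0 hf; have fx := nnm_ge0 x hf.
rewrite /truncated; case: ifPn => [tf|_]; last by rewrite mulr0 mulr_ge0.
rewrite mulrC -ler_pdivlMr//; apply: ler1_powR; last by rewrite invf_le1//; lra.
by rewrite ler_pdivlMr// mul1r ltW.
Qed.

Lemma level_bound (C : R) : 1 <= C -> averaging_bounded mu D q C ->
  exists s C2 : R, [/\ 1 < s, 1 <= C2 & forall f t, nnm f -> 0 < t ->
    (integ mu setT (fun x => (2 * f x) `^ q x)%R <= 1)%E ->
    (integ mu (superlevel f t) (fun x => t `^ q x)%R <=
      C2%:E * integ mu setT (fun x => (t * truncated s f t x) `^ q x)%R +
      (if t < 1 then C2 * t `^ ((1 - s^-1) * lo) else 0)%:E)%E].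
Proof.
move=> C1 HA.
have [s [C' [s1 slo C'1 HT HV]]] :=
  improved_averaging gD dD mq lo1 lohi loq qhi C1 HA.
have s0 : 0 < s by lra.
have ss : s < s * s by rewrite ltr_pMl.
have sl : s < lo by exact: lt_le_trans slo.
have [Ch [Ch1 high]] := high_level gD mq lo1 lohi loq qhi s1 sl C'1
  (power_averaging_le gD s0 (ltW ss) HT).
have [Cl [Cl1 low]] := low_level gD mq lo1 lohi loq qhi s1 C'1 HT HV.
have [C2 C2E] : exists C2, C2 = Ch + Cl + C' by eexists.
exists s, C2; split => //; first lra.
move=> f t hf t0 f1; have [hG nG] := truncated_normal s0 t0 hf.
have htG : nnm (fun x => (t * truncated s f t x) `^ q x).
  by apply: nnm_pow => //; exact: (nnmZ (ltW t0) hG).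
have htq : nnm (fun x => t `^ q x) by exact: nnm_powR.
have h2f : nnm (fun x => (2 * f x) `^ q x) by apply: nnm_pow => //; exact: nnmZ.
have pk l : packing D (D l) by exact: (generation_packing gD (k := l)).
have pS n := stopping_packing gD (D (- n%:Z)) f t.
have mS n := measurable_union (packing_family gD (pS n)).
rewrite (superlevel_bigcup hf (ltW t0)); apply: integ_bigcup_le => //.
  move=> n m nm; apply/subsetPset => x [Q [[cQ [P DP QP] lQ] _] Qx].
  have [P' DP' P'x] := grid_cover gD (- m%:Z) x.
  have hQ : hit mu D (D (- m%:Z)) f t Q.
    split => //; exists P' => //; apply: (subset_trans QP).
    apply: (grid_nested gD _ DP' DP P'x (QP _ Qx)).
    by rewrite lerN2 lez_nat.
  have [Q' [sQ' QQ' _]] := hit_stopping gD (pk _) hf (ltW t0) hQ Qx.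
  by exists Q' => //; exact: QQ'.
move=> n; set F := stopping mu D (D (- n%:Z)) f t.
have mF : measurable (union F) by exact: mS.
have GF Q : F Q -> (mu Q <= integ mu Q (fun x => truncated s f t x `^ s)%R)%E.
  move=> SQ; have cQ := (pS n).1 _ SQ.
  by apply: truncated_mean => //; exact: stopping_low SQ.
have W1 A : measurable A ->
    (integ mu A (fun x => (t * truncated s f t x) `^ q x)%R <= 1)%E.
  move=> mA; apply: le_trans f1.
  apply: le_trans (subset_integ mu mA measurableT htG (@subsetT _ _)) _.
  apply: (le_integ mu measurableT htG h2f) => x _.
  apply: powR_le_base; [exact: ltW| |].
    by rewrite mulr_ge0 ?(ltW t0)//; exact: nnm_ge0.
  by apply: truncated_le => //; exact: ltW.
have FT := subset_integ mu mF measurableT htG (@subsetT _ _).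
have IT0 := integ_ge0 mu setT htG.
case: ifPn => [t1|]; last rewrite -leNgt => t1.
  apply: le_trans (low F _ t (pS n) (conj hG nG) t0 t1 GF (W1 _ mF)) _.
  apply: leeD.
    apply: (@le_trans _ _ (Cl%:E * integ mu setT
      (fun x => (t * truncated s f t x) `^ q x)%R)%E).
      by apply: lee_wpmul2l => //; rewrite lee_fin; lra.
    by apply: lee_wpmul2r => //; rewrite lee_fin; lra.
  by rewrite lee_fin; apply: ler_wpM2r; [exact: powR_ge0|lra].
rewrite adde0; have Ch0 : 0 <= Ch by lra.
apply: (@le_trans _ _ (integ mu (union F)
    (fun x => Ch * (t * truncated s f t x) `^ q x))).
  apply: (integ_union_le (packing_family gD (pS n)) htq (nnmZ Ch0 htG)) => Q FQ.
  have cQ := (pS n).1 _ FQ; have mQ := grid_measurable gD cQ.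
  rewrite (integZ mu mQ Ch0 htG); apply: high => //; [exact: GF|exact: W1].
rewrite (integZ mu mF Ch0 htG).
apply: (@le_trans _ _ (Ch%:E * integ mu setT
  (fun x => (t * truncated s f t x) `^ q x)%R)%E).
  by apply: lee_wpmul2l => //; rewrite lee_fin.
by apply: lee_wpmul2r => //; rewrite lee_fin; lra.
Qed.

(** A truncated version of the sum over all dyadic [t] of [t `^ q] on the level
    set of [t], which is comparable to the power [q] of the maximal
    function of the grid. *)
Definition level_sum (f : T -> R) (n : nat) (x : T) : R :=
  \sum_(j < n) ((2 ^+ j) `^ q x * \1_(superlevel f (2 ^+ j)) x +
    (2^-1 ^+ j.+1) `^ q x * \1_(superlevel f (2^-1 ^+ j.+1)) x).

Lemma measurable_superlevel f t : nnm f -> 0 <= t -> measurable (superlevel f t).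
Proof.
move=> hf t0; rewrite superlevel_bigcup//; apply: bigcup_measurable => n _.
exact: measurable_union (packing_family gD (stopping_packing gD _ f t)).
Qed.

Lemma nnm_level_sum f n : nnm f -> nnm (level_sum f n).
Proof.
move=> hf; elim: n => [|n IH].
  rewrite (_ : level_sum f 0 = fun=> 0); first exact: nnm_cst.
  by apply/funext => x; rewrite /level_sum big_ord0.
rewrite (_ : level_sum f n.+1 = fun x => level_sum f n x +
  ((2 ^+ n) `^ q x * \1_(superlevel f (2 ^+ n)) x +
    (2^-1 ^+ n.+1) `^ q x * \1_(superlevel f (2^-1 ^+ n.+1)) x)); last first.
  by apply/funext => x; rewrite /level_sum big_ord_recr.
apply: nnmD => //; apply: nnmD; apply: nnmM; try exact: nnm_powR;
  apply: nnm_indic; apply: measurable_superlevel => //; rewrite exprn_ge0//.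
Qed.

(** Where [t < 2 * f], the power [q] of [t * truncated s f t] is
    [(2 * f) `^ (q / s) * t `^ ((1 - s^-1) * q)]. Its sum over the dyadic [t] is
    geometric, and is dominated by the largest term, a multiple of
    [(2 * f) `^ q]. The error terms [t `^ ((1 - s^-1) * lo)] form a geometric
    series over the dyadic [t < 1]. *)
Lemma level_sum_bound (C : R) : 1 <= C -> averaging_bounded mu D q C ->
  exists C' : R, 1 <= C' /\ forall f n, nnm f ->
    (integ mu setT (fun x => (2 * f x) `^ q x)%R <= 1)%E ->
    (integ mu setT (level_sum f n) <= C'%:E)%E.
Proof.
move=> C1 HA; have [s [C2 [s1 C21 lev]]] := level_bound C1 HA.
have s0 : 0 < s by lra.
have th0 : 0 < 1 - s^-1 by rewrite subr_gt0 invf_lt1.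
have lo0 : 0 < lo by exact: lt_trans lo1.
have [b0 b0E] : exists b0, b0 = (1 - s^-1) * lo by eexists.
have b00 : 0 < b0 by rewrite b0E mulr_gt0.
have h0 : 0 < 2^-1 :> R by rewrite invr_gt0.
have h1 : 2^-1 < 1 :> R by rewrite invf_lt1// ltr1n.
have [r rE] : exists r, r = 2^-1 `^ b0 :> R by eexists.
have r0 : 0 < r by rewrite rE powR_gt0.
have r1 : r < 1.
  by have := powR_lt_base b00 (ltW h0) h1; rewrite powR1 rE.
have [K KE] : exists K, K = (1 - r)^-1 by eexists.
have K0 : 0 < K by rewrite KE invr_gt0; lra.
exists (1 + (C2 * (2 * K) + C2 * K)); split.
  by rewrite lerDl addr_ge0// !mulr_ge0 ?(ltW K0)//; lra.
move=> f n hf f1.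
have h2f : nnm (fun x => (2 * f x) `^ q x) by apply: nnm_pow => //; exact: nnmZ.
pose tr t x := (t * truncated s f t x) `^ q x.
have htr t : 0 < t -> nnm (tr t).
  move=> t0; apply: nnm_pow => //; apply: nnmZ; first exact: ltW.
  by have [] := truncated_normal s0 t0 hf.
pose S m x := \sum_(j < m) (tr (2 ^+ j) x + tr (2^-1 ^+ j.+1) x).
have p2 j : 0 < 2 ^+ j :> R by exact: exprn_gt0.
have p2' j : 0 < 2^-1 ^+ j :> R by exact: exprn_gt0.
have hS m : nnm (S m).
  elim: m => [|m IH].
    rewrite (_ : S 0 = fun=> 0); first exact: nnm_cst.
    by apply/funext => x; rewrite /S big_ord0.
  rewrite (_ : S m.+1 = fun x => S m x + (tr (2 ^+ m) x + tr (2^-1 ^+ m.+1) x)).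
    by apply: nnmD => //; apply: nnmD; exact: htr.
  by apply/funext => x; rewrite /S big_ord_recr.
have C20 : 0 <= C2 by lra.
have main m : (integ mu setT (level_sum f m) <= C2%:E * integ mu setT (S m) +
    (C2 * \sum_(j < m) r ^+ j.+1)%:E)%E.
  elim: m => [|m IH].
    rewrite (@eq_integ _ _ _ mu _ (level_sum f 0) (fun=> 0)); last first.
      by move=> x _; rewrite /level_sum big_ord0.
    rewrite integ_cst// mul0e big_ord0 mulr0 adde0 mule_ge0//.
    exact: integ_ge0.
  rewrite (@eq_integ _ _ _ mu _ (level_sum f m.+1) (fun x => level_sum f m x +
    ((2 ^+ m) `^ q x * \1_(superlevel f (2 ^+ m)) x +
      (2^-1 ^+ m.+1) `^ q x * \1_(superlevel f (2^-1 ^+ m.+1)) x))); last first.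
    by move=> x _; rewrite /level_sum big_ord_recr.
  have mu1 : measurable (superlevel f (2 ^+ m)).
    by apply: measurable_superlevel => //; exact: ltW.
  have mu2 : measurable (superlevel f (2^-1 ^+ m.+1)).
    by apply: measurable_superlevel => //; exact: ltW.
  have hp t : nnm (fun x => t `^ q x) by exact: nnm_powR.
  have hi1 := nnmM (hp (2 ^+ m)) (nnm_indic mu1).
  have hi2 := nnmM (hp (2^-1 ^+ m.+1)) (nnm_indic mu2).
  rewrite (integD mu measurableT (nnm_level_sum m hf) (nnmD hi1 hi2)).
  rewrite (integD mu measurableT hi1 hi2) !integ_indic// !setTI.
  rewrite (@eq_integ _ _ _ mu _ (S m.+1) (fun x => S m x +
    (tr (2 ^+ m) x + tr (2^-1 ^+ m.+1) x))); last first.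
    by move=> x _; rewrite /S big_ord_recr.
  rewrite (integD mu measurableT (hS m) (nnmD (htr _ (p2 m)) (htr _ (p2' m.+1)))).
  rewrite (integD mu measurableT (htr _ (p2 m)) (htr _ (p2' m.+1))).
  have I0 := integ_ge0 mu setT (hS m).
  have I1 := integ_ge0 mu setT (htr _ (p2 m)).
  have I2 := integ_ge0 mu setT (htr _ (p2' m.+1)).
  rewrite big_ord_recr/= mulrDr EFinD.
  have L1 := lev f _ hf (p2 m) f1; have L2 := lev f _ hf (p2' m.+1) f1.
  rewrite ltNge exprn_ege1 ?ler1n//= adde0 in L1.
  rewrite exprn_ilt1 ?invr_ge0//= -b0E in L2.
  have -> : r ^+ m.+1 = (2^-1 ^+ m.+1) `^ b0.
    by rewrite rE -powR_mulrn ?powR_ge0// powRAC powR_mulrn// invr_ge0.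
  rewrite (ge0_muleDr _ I0 (adde_ge0 I1 I2)) (ge0_muleDr _ I1 I2).
  apply: le_trans (leeD IH (leeD L1 L2)) _.
  rewrite le_eqVlt; apply/orP; left; apply/eqP.
  rewrite -!addeA; congr (_ + _)%E; rewrite addeC -!addeA; congr (_ + _)%E.
  by congr (_ + _)%E; rewrite addeC.
have SK x : S n x <= 2 * K * (2 * f x) `^ q x.
  have fx : 0 <= 2 * f x by rewrite mulr_ge0// nnm_ge0.
  have bb : b0 <= (1 - s^-1) * q x by rewrite b0E ler_wpM2l// ltW.
  have trE t : 0 < t -> tr t x = (2 * f x) `^ (s^-1 * q x) *
      (if t < 2 * f x then t `^ ((1 - s^-1) * q x) else 0).
    move=> t0; rewrite /tr /truncated; case: ifPn => tf; last first.
      by rewrite !mulr0 powR0// gt_eqF.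
    rewrite powRM ?powR_ge0 ?(ltW t0)// powRM ?invr_ge0 ?(ltW t0)//.
    rewrite powRM ?powR_ge0// -!powRrM mulrCA; congr (_ * _).
    rewrite -powR_inv1 ?(ltW t0)// -powRrM -powRD_gt0//.
    by congr (_ `^ _); ring.
  have E1 : \sum_(j < n) tr (2 ^+ j) x = (2 * f x) `^ (s^-1 * q x) *
      \sum_(j < n) (if 2 ^+ j < 2 * f x then (2 ^+ j) `^ ((1 - s^-1) * q x) else 0).
    by rewrite mulr_sumr; apply: eq_bigr => j _; exact: trE.
  have E2 : \sum_(j < n) tr (2^-1 ^+ j.+1) x = (2 * f x) `^ (s^-1 * q x) *
      \sum_(j < n) (if 2^-1 ^+ j.+1 < 2 * f x
        then (2^-1 ^+ j.+1) `^ ((1 - s^-1) * q x) else 0).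
    by rewrite mulr_sumr; apply: eq_bigr => j _; exact: trE.
  have -> : S n x = (2 * f x) `^ (s^-1 * q x) *
      (\sum_(j < n) (if 2 ^+ j < 2 * f x then (2 ^+ j) `^ ((1 - s^-1) * q x) else 0) +
       \sum_(j < n) (if 2^-1 ^+ j.+1 < 2 * f x
        then (2^-1 ^+ j.+1) `^ ((1 - s^-1) * q x) else 0)).
    by rewrite mulrDr; etransitivity; [exact: big_split|exact: (f_equal2 _ E1 E2)].
  have S1 := sum_powers_below n b00 bb fx.
  have S2 := sum_inverse_powers_below n b00 bb fx.
  rewrite -rE -KE in S1 S2.
  apply: (@le_trans _ _ ((2 * f x) `^ (s^-1 * q x) *
    (K * (2 * f x) `^ ((1 - s^-1) * q x) + K * (2 * f x) `^ ((1 - s^-1) * q x)))).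
    by apply: ler_wpM2l; [exact: powR_ge0|exact: lerD].
  have -> : (2 * f x) `^ q x =
      (2 * f x) `^ (s^-1 * q x) * (2 * f x) `^ ((1 - s^-1) * q x).
    rewrite -powRD; first by congr (_ `^ _); ring.
    by rewrite -mulrDl addrC subrK mul1r gt_eqF.
  by rewrite le_eqVlt; apply/orP; left; apply/eqP; ring.
apply: le_trans (main n) _; rewrite EFinD -[leLHS]add0e; apply: leeD.
  by rewrite lee_fin.
rewrite EFinD; apply: leeD.
  rewrite EFinM; apply: lee_wpmul2l; first by rewrite lee_fin.
  have K20 : 0 <= 2 * K by rewrite mulr_ge0// ltW.
  apply: le_trans (le_integ mu measurableT (hS n) (nnmZ K20 h2f) (fun x _ => SK x)) _.
  rewrite (integZ mu measurableT K20 h2f) -[leRHS]mule1.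
  by apply: lee_wpmul2l; rewrite ?lee_fin.
rewrite lee_fin; apply: ler_wpM2l => //.
apply: (@le_trans _ _ (\sum_(j < n) r ^+ j)); last first.
  by rewrite KE; apply: geometric_sum_le => //; exact: ltW.
apply: ler_sum => j _; rewrite exprS ler_piMl ?exprn_ge0// ltW//.
Qed.

End GridMaximal.

(** * Lebesgue differentiation along a grid *)

Lemma error_budget {R : realType} (c m : R) : 0 < c -> 0 < m ->
  exists e, 0 < e /\ e + c * e < c * m.
Proof.
move=> c0 m0; exists (c * m / (2 * (1 + c))); split.
  by rewrite divr_gt0 ?mulr_gt0//; lra.
have -> : c * m / (2 * (1 + c)) + c * (c * m / (2 * (1 + c))) = c * m / 2.
  by field; lra.
have : 0 < c * m by rewrite mulr_gt0.
lra.
Qed.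

Lemma density_contradiction {R : realType} (lam de a : R) : 0 <= lam -> 0 < de ->
  0 < a -> ~ (lam + de) * a <= lam * (a + de / (2 * (lam + 1)) * a).
Proof.
move=> lam0 de0 a0.
have -> : lam * (a + de / (2 * (lam + 1)) * a) =
  lam * a + (lam / (lam + 1)) * (de * a / 2) by field; lra.
have l1 : lam / (lam + 1) <= 1 by rewrite ler_pdivrMr ?mul1r; lra.
have da : 0 < de * a by rewrite mulr_gt0.
have da2 : 0 <= de * a / 2 by lra.
have := ler_wpM2r da2 l1; lra.
Qed.

Section Differentiation.
Context {R : realType} {d : measure_display} {T : measurableType d}.
Variables (rho : T -> T -> R) (mu : {measure set T -> \bar R}).
Variables (D : int -> set (set T)) (eps : R).
Hypotheses (gD : grid mu D eps).
Hypothesis semiregular : borel_semiregular rho mu.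
Hypothesis small_cubes : forall U x, qopen rho U -> U x ->
  exists n : nat, forall Q, D n%:Z Q -> Q x -> Q `<=` U.

Variables (n0 : int) (Q0 : set T).
Hypothesis DQ0 : D n0 Q0.

Let cQ0 : cube D Q0. Proof. by exists n0. Qed.
Let mQ0 : measurable Q0. Proof. exact: (grid_measurable gD). Qed.

Definition saturated (n : int) (V : set T) :=
  forall Q x y, D n Q -> Q x -> Q y -> V x -> V y.

(** Approximability in measure, inside [Q0], by unions of cubes of a single
    generation. The sets with this property form a sigma-algebra that
    contains the open sets, hence all Borel sets. *)
Definition cube_approx : set (set T) := [set A | measurable A /\
  forall e : R, 0 < e -> exists n V, [/\ n0 <= n, saturated n V, measurable V &
    (mu (Q0 `&` (A `\` V `|` V `\` A)) <= e%:E)%E]].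

Lemma saturated_le n l V : n <= l -> saturated n V -> saturated l V.
Proof.
move=> nl sV Q x y DQ Qx Qy Vx; have [P DP Px] := grid_cover gD n x.
have QP := grid_nested gD nl DP DQ Px Qx.
exact: (sV P x y DP Px (QP _ Qy) Vx).
Qed.

Lemma cube_approxC A : cube_approx A -> cube_approx (~` A).
Proof.
move=> [mA hA]; split; first exact: measurableC.
move=> e e0; have [n [V [nn sV mV AV]]] := hA e e0.
exists n, (~` V); split => //; last first.
- have E (X Y : set T) : ~` X `\` ~` Y = Y `\` X.
    by rewrite setDE setCK setIC -setDE.
  by rewrite !E setUC.
- exact: measurableC.
- move=> Q x y DQ Qx Qy nVx Vy; apply: nVx; exact: (sV Q y x).
Qed.

Let le_mu A B : measurable A -> measurable B -> A `<=` B -> (mu A <= mu B)%E.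
Proof. by move=> mA mB AB; apply: le_measure; rewrite ?inE. Qed.

Let mu_U2 A B : measurable A -> measurable B ->
  (mu (A `|` B) <= mu A + mu B)%E.
Proof. by move=> mA mB; exact: measureU2. Qed.

Lemma cube_approx0 : cube_approx set0.
Proof.
split => // e e0; exists n0, set0; split => //.
by rewrite setDv setU0 setI0 measure0 lee_fin ltW.
Qed.

Lemma cube_approxU A B : cube_approx A -> cube_approx B -> cube_approx (A `|` B).
Proof.
move=> [mA hA] [mB hB]; split; first exact: measurableU.
move=> e e0; have e20 : 0 < e / 2 by rewrite divr_gt0.
have [n [V [nn sV mV AV]]] := hA _ e20.
have [m [W [nm sW mW BW]]] := hB _ e20.
have [l [nl ml]] : exists l, n <= l /\ m <= l.
  by exists (Num.max n m); rewrite !le_max !lexx orbT.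
exists l, (V `|` W); split; [exact: le_trans nl| |exact: measurableU|].
  move=> Q x y DQ Qx Qy [Vx|Wx]; [left|right].
    exact: (saturated_le nl sV DQ Qx Qy).
  exact: (saturated_le ml sW DQ Qx Qy).
have mY X Y : measurable X -> measurable Y -> measurable (Q0 `&` (X `\` Y `|` Y `\` X)).
  by move=> mX mYY; apply: measurableI => //; apply: measurableU; exact: measurableD.
apply: (@le_trans _ _ (mu ((Q0 `&` (A `\` V `|` V `\` A)) `|`
    (Q0 `&` (B `\` W `|` W `\` B))))).
  apply: le_mu; [|by apply: measurableU; exact: mY|].
    by apply: mY; exact: measurableU.
  move=> x [Q0x [[[Ax|Bx] nVW]|[[Vx|Wx] nAB]]].
  - by left; split => //; left; split => // Vx; apply: nVW; left.
  - by right; split => //; left; split => // Wx; apply: nVW; right.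
  - by left; split => //; right; split => // Ax; apply: nAB; left.
  - by right; split => //; right; split => // Bx; apply: nAB; right.
apply: le_trans (mu_U2 (mY _ _ mA mV) (mY _ _ mB mW)) _.
by apply: le_trans (leeD AV BW) _; rewrite -EFinD lee_fin; lra.
Qed.

Lemma cube_approx_bigcup (A : nat -> set T) : (forall n, cube_approx (A n)) ->
  cube_approx (\bigcup_n A n).
Proof.
move=> hA; have mA n : measurable (A n) by case: (hA n).
have mU : measurable (\bigcup_n A n) by exact: bigcup_measurable.
split => // e e0; have e20 : 0 < e / 2 by rewrite divr_gt0.
pose B n := \bigcup_(i < n) A i.
have BS n : B n.+1 = B n `|` A n.
  apply/seteqP; split => [x [i /= iN Ax]|x [[i /= iN Ax]|Ax]].
  - move: iN; rewrite ltnS leq_eqVlt => /orP[/eqP iE|iN].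
      by right; rewrite -iE.
    by left; exists i.
  - by exists i => //=; exact: ltnW.
  - by exists n => /=.
have hB n : cube_approx (B n).
  elim: n => [|n IH]; last by rewrite BS; exact: cube_approxU.
  rewrite (_ : B 0 = set0); first exact: cube_approx0.
  by apply/seteqP; split => // x [].
have mB n : measurable (B n) by case: (hB n).
pose G n := Q0 `&` ((\bigcup_k A k) `\` B n).
have mG n : measurable (G n) by apply: measurableI => //; exact: measurableD.
have G0 : \bigcap_n G n = set0.
  apply/seteqP; split => // x Gx; have [_ [[k _ Akx] _]] := Gx 0 I.
  by have [_ [_ nB]] := Gx k.+1 I; apply: nB; exists k => /=.
have cvG : (mu \o G) n @[n --> \oo] --> mu (\bigcap_n G n).
  apply: nonincreasing_cvg_mu => //.
  - apply: le_lt_trans (grid_fin gD cQ0); apply: le_mu => //.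
    by move=> x [].
  - by rewrite G0.
  move=> n m nm; apply/subsetPset => x [Qx [Ux nB]]; split => //; split => //.
  by move=> [i /= iN Ax]; apply: nB; exists i => //=; exact: leq_trans nm.
rewrite G0 measure0 in cvG.
have [N GN] : exists N, (mu (G N) <= (e / 2)%:E)%E.
  apply: contrapT => nN; suff : ((e / 2)%:E <= 0)%E by rewrite lee_fin leNgt e20.
  rewrite -[leRHS](cvg_lim _ cvG)//; apply: lime_ge; first by apply/cvg_ex; exists 0%E.
  by apply: nearW => n; rewrite leNgt; apply/negP => /ltW ?; apply: nN; exists n.
have [n [V [nn sV mV BV]]] := (hB N).2 _ e20.
exists n, V; split => //.
have mY X Y : measurable X -> measurable Y -> measurable (Q0 `&` (X `\` Y `|` Y `\` X)).
  by move=> mX mYY; apply: measurableI => //; apply: measurableU; exact: measurableD.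
apply: (@le_trans _ _ (mu (G N `|` (Q0 `&` (B N `\` V `|` V `\` B N))))).
  apply: le_mu; [exact: mY|by apply: measurableU => //; exact: mY|].
  move=> x [Qx [[Ux nV]|[Vx nU]]].
    have [Bx|nBx] := pselect (B N x); last by left.
    by right; split => //; left.
  right; split => //; right; split => // -[i _ Ax]; apply: nU.
  by exists i.
apply: le_trans (mu_U2 (mG N) (mY _ _ (mB N) mV)) _.
by apply: le_trans (leeD GN BV) _; rewrite -EFinD lee_fin; lra.
Qed.

Lemma saturated_measurable n V : saturated n V -> measurable V.
Proof.
move=> sV; have -> : V = union (D n `&` [set Q | Q `<=` V]).
  apply/seteqP; split => [x Vx|x [Q [_ QV] Qx]]; last exact: QV.
  have [Q DQ Qx] := grid_cover gD n x.
  by exists Q => //; split => // y Qy; exact: (sV Q x y).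
by apply/measurable_union/(packing_family gD)/(generation_packing gD (k := n)) => Q [].
Qed.

Lemma qopen_cube_approx U : qopen rho U -> cube_approx U.
Proof.
move=> oU; pose V n := [set x | exists2 Q, D n%:Z Q & Q x /\ Q `<=` U].
have -> : U = \bigcup_n V n.
  apply/seteqP; split => [x Ux|x [n _ [Q _ [Qx QU]]]]; last exact: QU.
  have [n hn] := small_cubes oU Ux; exists n => //.
  by have [Q DQ Qx] := grid_cover gD n x; exists Q => //; split => //; exact: hn.
apply: cube_approx_bigcup => n.
have sV : saturated n (V n).
  move=> Q x y DQ Qx Qy [Q' DQ' [Q'x Q'U]]; exists Q' => //; split => //.
  exact: (grid_nested gD (lexx n%:Z) DQ' DQ Q'x Qx).
have mV := saturated_measurable sV.
split => // e e0; exists (Num.max n0 n%:Z), (V n); split => //.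
- by rewrite le_max lexx.
- by apply: saturated_le sV; rewrite le_max lexx orbT.
- by rewrite setDv setU0 setI0 measure0 lee_fin ltW.
Qed.

Lemma qborel_cube_approx B : qborel rho B -> cube_approx B.
Proof.
apply: smallest_sub; last exact: qopen_cube_approx.
split; first exact: cube_approx0.
- by move=> A hA; rewrite setTD; exact: cube_approxC.
- exact: cube_approx_bigcup.
Qed.

(** If no cube is almost filled by [E], then [c * mu (E `&` C) < mu (C `\` E)] on
    every cube [C] inside [Q0] that meets [E] in positive measure. Sum this
    over the cubes of a union that approximates [E] up to [e]: the right-hand
    side is at most [e], the left-hand side about [c * mu E]. *)
Lemma density_cube E (c : R) : measurable E -> E `<=` Q0 -> (0 < mu E)%E ->
  0 < c -> exists C, [/\ cube D C, C `<=` Q0, (0 < mu (E `&` C))%E &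
    (mu (C `\` E) <= c%:E * mu (E `&` C))%E].
Proof.
move=> mE EQ E0 c0; apply: contrapT => nC.
have fE : (mu E < +oo)%E.
  by apply: le_lt_trans (grid_fin gD cQ0); exact: le_mu.
have [m mEE] : exists m, mu E = m%:E.
  by exists (fine (mu E)); rewrite fineK// ge0_fin_numE.
have m0 : 0 < m by rewrite -lte_fin -mEE.
have [e [e0 ec]] := error_budget c0 m0.
have [B bB EB0] := semiregular mE fE.
have [mB hB] := qborel_cube_approx bB; have [n [V [nn sV mV BV]]] := hB e e0.
have mY X Y : measurable X -> measurable Y -> measurable (Q0 `&` (X `\` Y `|` Y `\` X)).
  by move=> mX mYY; apply: measurableI => //; apply: measurableU; exact: measurableD.
have mYY : measurable (E `+` B) by apply: measurableU; exact: measurableD.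
have close X : measurable X ->
    X `<=` (Q0 `&` (B `\` V `|` V `\` B)) `|` (E `+` B) -> (mu X <= e%:E)%E.
  move=> mX XE; apply: le_trans (le_mu mX (measurableU _ _ (mY _ _ mB mV) mYY) XE) _.
  apply: le_trans (mu_U2 (mY _ _ mB mV) mYY) _.
  by rewrite EB0 adde0.
clear EB0; pose F := D n `&` [set Q | Q `<=` Q0 `&` V].
have pF : packing D F by apply: (generation_packing gD (k := n)) => Q [].
have fF := packing_family gD pF; have mF := measurable_union fF.
have FE : union F = Q0 `&` V.
  apply/seteqP; split => [x [Q [_ QV] Qx]|x [Q0x Vx]]; first exact: QV.
  have [Q DQ Qx] := grid_cover gD n x; exists Q => //; split => // y Qy.
  split; last exact: (sV Q x y).
  exact: (grid_nested gD nn DQ0 DQ Q0x Qx).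
have mCE := measurableC mE.
have c00 := ltW c0.
have h1 : (integ mu (union F) (fun x => c * \1_E x)%R <=
    integ mu (union F) (fun x => 1 * \1_(~` E) x)%R)%E.
  have n1 : nnm (fun x => 1 * \1_(~` E) x : R) := nnmZ ler01 (nnm_indic mCE).
  apply: (integ_union_le fF (nnmZ c00 (nnm_indic mE)) n1) => Q [DQ QV].
  have cQ : cube D Q by exists n.
  have mQ := grid_measurable gD cQ.
  rewrite !(integ_indic mu (fun _ => _))// !integ_cst; try exact: measurableI.
  rewrite mul1e -setDE; have [z|] := leP (mu (E `&` Q)) 0%E.
    have -> : mu (Q `&` E) = 0%E by apply/eqP; rewrite -measure_le0 setIC.
    by rewrite mule0.
  move=> EQ0; rewrite setIC leNgt; apply/negP => lt; apply: nC; exists Q; split => //.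
    by move=> x /QV[].
  exact: ltW.
move: h1; rewrite !(integ_indic mu (fun _ => _))// !integ_cst; try exact: measurableI.
rewrite mul1e FE -setDE => h1.
have h2 : (mu (Q0 `&` V `\` E) <= e%:E)%E.
  apply: close; first by apply: measurableD => //; exact: measurableI.
  move=> x [[Q0x Vx] nE]; have [Bx|nB] := pselect (B x).
    by right; right.
  by left; split => //; right.
have h3 : (mu (E `\` V) <= e%:E)%E.
  apply: close; first exact: measurableD.
  move=> x [Ex nV]; have [Bx|nB] := pselect (B x); last by right; left.
  by left; split; [exact: EQ|left].
have h4 : (mu E <= mu (Q0 `&` V `&` E) + mu (E `\` V))%E.
  have mI : measurable (Q0 `&` V `&` E) by do 2 apply: measurableI => //.
  have mD : measurable (E `\` V) by exact: measurableD.
  apply: le_trans (mu_U2 mI mD); apply: le_mu => //; first exact: measurableU.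
  move=> x Ex; have [Vx|nV] := pselect (V x); last by right.
  by left; split => //; split => //; exact: EQ.
have mI : measurable (Q0 `&` V `&` E) by do 2 apply: measurableI => //.
have [a aE] : exists a, mu (Q0 `&` V `&` E) = a%:E.
  exists (fine (mu (Q0 `&` V `&` E))); rewrite fineK// ge0_fin_numE//.
  by apply: le_lt_trans fE; apply: le_mu => // x [].
rewrite mEE aE in h1 h4.
have h5 : m <= a + e.
  rewrite -lee_fin EFinD; apply: (le_trans h4); exact: leeD.
have h6 : c * a <= e by rewrite -lee_fin EFinM; exact: le_trans h2.
have : c * m <= c * (a + e) by rewrite ler_pM2l.
by rewrite leNgt mulrDr => /negP; apply; apply: le_lt_trans ec; rewrite lerD2r.
Qed.

(** Otherwise [h >= lam + de] on a part of [E] of positive measure, and the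
    mean of [h] over a cube almost filled by this part exceeds [lam]. *)
Lemma differentiation (h : T -> R) (lam : R) E : nnm h -> 0 <= lam ->
  measurable E -> E `<=` Q0 -> (forall x, E x -> lam < h x) ->
  (forall C x, cube D C -> C `<=` Q0 -> C x -> E x ->
    (integ mu C h <= lam%:E * mu C)%E) -> mu E = 0%E.
Proof.
move=> hh lam0 mE EQ Elam hE.
pose Ej (j : nat) := E `&` [set x | lam + (j.+1%:R)^-1 <= h x].
have mEj j : measurable (Ej j).
  apply: measurableI => //; rewrite -[X in measurable X]setTI.
  have -> : [set x | lam + (j.+1%:R)^-1 <= h x] = h @^-1` `[lam + (j.+1%:R)^-1, +oo[.
    by apply/seteqP; split => x; rewrite /= in_itv/= andbT.
  exact: (nnm_meas hh).
have EE : E = \bigcup_j Ej j.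
  apply/seteqP; split => [x Ex|x [j _ []]//].
  have xl : 0 < h x - lam by rewrite subr_gt0 Elam.
  exists (Num.truncn (h x - lam)^-1) => //; split => //=.
  rewrite -lerBrDl -[leRHS]invrK lef_pV2 ?posrE ?invr_gt0//.
  exact/ltW/truncnS_gt.
suff Ej0 j : mu (Ej j) = 0%E.
  apply/negligibleP => //; rewrite EE; apply: negligible_bigcup => j.
  by apply/negligibleP => //; exact: Ej0.
apply/eqP; rewrite -measure_le0 leNgt; apply/negP => Ejp.
have [de [de0 deE]] : exists de : R, 0 < de /\ de = (j.+1%:R)^-1.
  by eexists; split; last reflexivity; rewrite invr_gt0.
have c0 : 0 < de / (2 * (lam + 1)).
  by rewrite divr_gt0// mulr_gt0// ltr_wpDl.
have EjQ : Ej j `<=` Q0 by move=> x [/EQ].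
have [C [cC CQ EC0 CE]] := density_cube (mEj j) EjQ Ejp c0.
have mC := grid_measurable gD cC.
have mEC : measurable (Ej j `&` C) by exact: measurableI.
have [x [[Ex hx] Cx]] : exists x, (Ej j `&` C) x.
  by apply/set0P/eqP => E0; move: EC0; rewrite E0 measure0 ltxx.
have H1 := hE C x cC CQ Cx Ex.
have ld0 : 0 <= lam + de by rewrite addr_ge0// ltW.
have H2 : ((lam + de)%:E * mu (Ej j `&` C) <= integ mu C h)%E.
  rewrite -integ_cst//; apply: (@le_trans _ _ (integ mu (Ej j `&` C) h)).
    apply: (le_integ mu mEC (nnm_cst ld0) hh) => y [[_ hy] _].
    by rewrite deE.
  by apply: (subset_integ mu mEC mC hh) => y [].
have H3 : (mu C <= mu (Ej j `&` C) + mu (C `\` Ej j))%E.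
  have mD : measurable (C `\` Ej j) by exact: measurableD.
  apply: le_trans (mu_U2 mEC mD); apply: le_mu => //; first exact: measurableU.
  by move=> y Cy; have [Ey|nE] := pselect (Ej j y); [left|right].
have [a aE] : exists a, mu (Ej j `&` C) = a%:E.
  exists (fine (mu (Ej j `&` C))); rewrite fineK// ge0_fin_numE//.
  by apply: le_lt_trans (grid_fin gD cC); apply: le_mu => // y [].
rewrite aE lte_fin in EC0; rewrite aE in CE H2 H3.
have H4 := le_trans H2 H1.
have : ((lam + de)%:E * a%:E <= lam%:E * (a%:E + (de / (2 * (lam + 1)))%:E * a%:E))%E.
  apply: (le_trans H4); apply: lee_wpmul2l; first by rewrite lee_fin.
  by apply: (le_trans H3); exact: leeD.
rewrite -!EFinM lee_fin; exact: density_contradiction.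
Qed.

End Differentiation.

(** * Dyadic systems on spaces of homogeneous type *)

Section HK.
Context {R : realType} {d : measure_display} {T : measurableType d}.
Variables (rho : T -> T -> R) (mu : {measure set T -> \bar R}).
Hypothesis hX : homogeneous_space rho mu.
Variables (K : nat) (D : 'I_K -> int -> set (set T)) (eps eta r0 R0 : R).
Hypothesis hD : HK_dyadic_system rho mu D eps eta r0 R0.

Let r00 : 0 < r0. Proof. by case/andP: (hk_radii hD). Qed.
Let R00 : 0 < R0. Proof. by case/andP: (hk_radii hD) => ?; exact: lt_le_trans. Qed.
Let eta0 : 0 < eta. Proof. by case/andP: (hk_eta hD). Qed.
Let etak k : 0 < eta ^ k. Proof. exact: exprz_gt0. Qed.

Lemma ball_gt0 x r : 0 < r -> (0 < mu (qball rho x r))%E.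
Proof. by move=> rp; have [A _ /(_ x r rp)[]] := hs_doubling hX. Qed.

Lemma ball_fin x r : 0 < r -> (mu (qball rho x r) < +oo)%E.
Proof.
move=> rp; have [A _ /(_ x r rp)[_ h1 h2]] := hs_doubling hX.
exact: le_lt_trans h1 h2.
Qed.

Lemma ball_measurable x r : 0 < r -> measurable (qball rho x r).
Proof. exact: hs_ball_measurable hX x r. Qed.

Lemma HK_measurable t k Q : D t k Q -> measurable Q.
Proof. by move=> DQ; apply: (hs_borel hX); exact: (hk_borel hD DQ). Qed.

Let le_mu A B : measurable A -> measurable B -> A `<=` B -> (mu A <= mu B)%E.
Proof. by move=> mA mB AB; apply: le_measure; rewrite ?inE. Qed.

Lemma HK_grid t : grid mu (D t) eps.
Proof.
have /andP[e0 e1] := hk_eps hD; split.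
- by rewrite e0 ltW.
- by move=> Q [k DQ]; exact: HK_measurable DQ.
- move=> Q [k DQ]; have [c _ [bQ _]] := hk_center hD DQ.
  have rp : 0 < r0 * eta ^ k by rewrite mulr_gt0.
  apply: lt_le_trans (ball_gt0 c rp) _; apply: le_mu => //.
    exact: ball_measurable.
  exact: HK_measurable DQ.
- move=> Q [k DQ]; have [c _ [_ Qb]] := hk_center hD DQ.
  have rp : 0 < R0 * eta ^ k by rewrite mulr_gt0.
  apply: le_lt_trans (ball_fin c rp); apply: le_mu => //.
    exact: HK_measurable DQ.
  exact: ball_measurable.
- rewrite (_ : cube (D t) = \bigcup_(k in [set: int]) D t k).
    exact: hk_countable hD t.
  by apply/seteqP; split => [Q [k DQ]|Q [k _ DQ]]; exists k.
- move=> k x; have : [set: T] x by [].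
  by rewrite -(hk_cover hD t k) => -[Q DQ Qx]; exists Q.
- move=> k l Q Q' x; rewrite le_eqVlt => /predU1P[->|kl] DQ DQ' Qx Q'x.
    rewrite (_ : Q' = Q)//.
    have tD : trivIset (D t l) id by exact: (hk_disjoint hD).
    by apply: (tD _ _ DQ' DQ); exists x.
  have [//|E] := hk_nested hD kl DQ DQ'.
  suff : set0 x by [].
  by rewrite -E.
- move=> k Q Q' DQ DQ' QQ'; apply: (hk_child_measure hD _ DQ' QQ').
  by rewrite addrK.
Qed.

Lemma HK_small t U x : qopen rho U -> U x ->
  exists n : nat, forall Q, D t n%:Z Q -> Q x -> Q `<=` U.
Proof.
move=> oU /oU[r rp rU]; have [A0 A01 tri] := qm_triangle (hs_quasi_metric hX).
have A00 : 0 < A0 by exact: lt_le_trans A01.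
have cst0 : 0 < A0 * (2 * R0) by rewrite !mulr_gt0.
have e0 : 0 < r / (A0 * (2 * R0)) by rewrite divr_gt0.
have [n hn] : exists n : nat, eta ^+ n < r / (A0 * (2 * R0)).
  have /andP[_ eta1] := hk_eta hD.
  have cv : eta ^+ n @[n --> \oo] --> (0 : R).
    by apply: cvg_expr; rewrite ger0_norm// ltW.
  have h : \forall n \near \oo, eta ^+ n < r / (A0 * (2 * R0)).
    by apply: (cvgr_lt _ cv).
  by have [N _ hN] := h; exists N; apply: hN => /=.
exists n => Q DQ Qx y Qy; apply: rU; rewrite /qball/=.
have [c _ [_ Qb]] := hk_center hD DQ.
have := Qb _ Qx; have := Qb _ Qy; rewrite /qball/= => cy cx.
have xc : rho x c < R0 * eta ^ n%:Z by rewrite (qm_sym (hs_quasi_metric hX)).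
apply: (le_lt_trans (tri x c y)).
apply: (@lt_trans _ _ (A0 * (2 * R0) * eta ^+ n)); last first.
  by rewrite mulrC -ltr_pdivlMr.
have -> : A0 * (2 * R0) * eta ^+ n = A0 * (R0 * eta ^+ n + R0 * eta ^+ n) by ring.
by rewrite ltr_pM2l// ltrD.
Qed.

Lemma HK_differentiates t : borel_semiregular rho mu -> differentiates mu (D t).
Proof.
move=> reg Q h lam E [k DQ] hh lam0 mE EQ Elam hE.
exact: (differentiation (HK_grid t) reg (@HK_small t) DQ hh lam0 mE EQ Elam hE).
Qed.

(** Iterate the doubling condition from the outer to the inner ball of a
    cube. *)
Lemma cube_ball : exists2 C : R, 0 < C & forall t k Q, D t k Q -> exists B,
  [/\ is_qball rho B, Q `<=` B & (mu B <= C%:E * mu Q)%E].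
Proof.
have [A A1 dbl] := hs_doubling hX.
have A0 : 0 < A by exact: lt_le_trans A1.
have [n hn] : exists n : nat, R0 / 2 ^+ n <= r0.
  exists (Num.truncn (R0 / r0)).+1.
  rewrite ler_pdivrMr ?exprn_gt0// mulrC -ler_pdivrMr//.
  apply: (le_trans (ltW (truncnS_gt _))).
  by rewrite -natrX ler_nat ltnW// ltn_expl.
exists (A ^+ n); first exact: exprn_gt0.
move=> t k Q DQ; have [c _ [bQ Qb]] := hk_center hD DQ.
have rp : 0 < R0 * eta ^ k by rewrite mulr_gt0.
exists (qball rho c (R0 * eta ^ k)); split => //.
  by exists c, (R0 * eta ^ k).
have it m : (mu (qball rho c (R0 * eta ^ k)) <=
    (A ^+ m)%:E * mu (qball rho c (R0 * eta ^ k / 2 ^+ m)))%E.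
  elim: m => [|m IH]; first by rewrite !expr0 divr1 mul1e.
  apply: (le_trans IH); rewrite exprSr EFinM -muleA.
  apply: lee_wpmul2l; first by rewrite lee_fin exprn_ge0// ltW.
  have rm : 0 < R0 * eta ^ k / 2 ^+ m by rewrite divr_gt0// exprn_gt0.
  have [_ h _] := dbl c _ rm.
  by rewrite exprSr invfM mulrA.
apply: (le_trans (it n)); apply: lee_wpmul2l.
  by rewrite lee_fin exprn_ge0// ltW.
have rn : 0 < R0 * eta ^ k / 2 ^+ n by rewrite divr_gt0// exprn_gt0.
apply: le_mu; [exact: ball_measurable|exact: HK_measurable DQ|].
apply: subset_trans bQ => y; rewrite /qball/= => /lt_le_trans; apply.
by rewrite mulrAC ler_pM2r.
Qed.

End HK.

(** * Luxemburg norms and modulars *)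

Section Luxemburg.
Context {R : realType} {d : measure_display} {T : measurableType d}.
Variable mu : {measure set T -> \bar R}.
Local Open Scope ereal_scope.

(** A comparison for functions that may fail to be measurable, such as the
    maximal function: the integral is a supremum over simple functions. *)
Lemma le_integral_ge0 (f g : T -> \bar R) : (forall x, 0 <= f x) ->
  (forall x, f x <= g x) -> \int[mu]_x f x <= \int[mu]_x g x.
Proof.
move=> f0 fg; have g0 x : 0 <= g x by exact: le_trans (fg x).
rewrite !ge0_integralTE//; apply: ereal_sup_le => _ [h hf <-].
by exists h => // x; exact: le_trans (fg x).
Qed.

Lemma le_integral_off_null (f g : T -> \bar R) N : (forall x, 0 <= f x) ->
  (forall x, 0 <= g x) -> measurable_fun [set: T] g -> measurable N ->
  mu N = 0 -> (forall x, ~ N x -> f x <= g x) ->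
  \int[mu]_x f x <= \int[mu]_x g x.
Proof.
move=> f0 g0 mg mN N0 fg.
pose h x := if x \in N then +oo else g x.
have mh : measurable_fun [set: T] h.
  apply: measurable_fun_ifT => //.
  apply: (measurable_fun_bool true); rewrite setTI.
  rewrite (_ : _ @^-1` _ = N)//; apply/seteqP.
  by split => x /=; [move/set_mem|move/mem_set].
rewrite (ge0_ae_eq_integral (g := h) measurableT mg mh)//.
- apply: le_integral_ge0 => // x; rewrite /h.
  by case: ifPn => [_|/negP]; [rewrite leey|rewrite inE; exact: fg].
- by move=> x _; rewrite /h; case: ifP.
exists N; split => // x /= nh; apply: contrapT => nN; apply: nh => _.
by rewrite /h memNset.
Qed.

Lemma epower_ge0 (a r : \bar R) : 0 <= epower a r.
Proof. by case: r => [r| |]//=; [exact: poweR_ge0|case: ifP]. Qed.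

Lemma le_epower (a b r : \bar R) : 0 <= a -> a <= b -> 1 <= r ->
  epower a r <= epower b r.
Proof.
move=> a0 ab; have b0 := le_trans a0 ab; case: r => [r| |]//=; last first.
  move=> _; case: ifPn => [_|na]; first by case: ifP.
  by rewrite ifN//; apply: contra na; exact: le_trans.
rewrite lee_fin => r1; have r0 : (0 < r)%R by exact: lt_le_trans r1.
case: b ab b0 => [b| |]// ab b0; last by rewrite poweRyr ?gt_eqF// leey.
case: a a0 ab => [a| |]// a0 ab.
rewrite !poweR_EFin lee_fin; rewrite !lee_fin in a0 ab.
by apply: powR_le_base => //; exact: ltW.
Qed.

Lemma lux_norm_le (p g : T -> \bar R) (l : R) : (0 < l)%R ->
  \int[mu]_x epower (g x * (l^-1)%:E) (p x) <= 1 -> lux_norm mu p g <= l%:E.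
Proof. by move=> l0 gl; apply: ereal_inf_lbound; exists l. Qed.

Section Monotone.
Variables (p : T -> \bar R).
Hypothesis p1 : forall x, 1 <= p x.

Lemma lux_norm_lt (g : T -> \bar R) (l : R) : (forall x, 0 <= g x) ->
  lux_norm mu p g < l%:E -> (0 < l)%R /\
  \int[mu]_x epower (g x * (l^-1)%:E) (p x) <= 1.
Proof.
move=> g0 gl; have [_ [k [k0 gk] <-] kl] := ereal_inf_lt gl.
rewrite lte_fin in kl; have l0 : (0 < l)%R by exact: lt_trans kl.
split; first exact: l0.
apply: le_trans gk; apply: le_integral_ge0 => x.
  exact: epower_ge0.
apply: le_epower => //.
  by rewrite mule_ge0// lee_fin invr_ge0 ltW.
by apply: lee_wpmul2l => //; rewrite lee_fin lef_pV2// ltW.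
Qed.

Lemma le_lux_norm (g h : T -> \bar R) : (forall x, 0 <= g x) ->
  (forall x, g x <= h x) -> lux_norm mu p g <= lux_norm mu p h.
Proof.
move=> g0 gh; apply: ereal_inf_le_tmp => _ [l [l0 hl] <-]; exists l => //; split => //.
have li0 : 0 <= (l^-1)%:E by rewrite lee_fin invr_ge0 ltW.
apply: le_trans hl; apply: le_integral_ge0 => x; first exact: epower_ge0.
apply: le_epower => //; first exact: mule_ge0.
by apply: lee_wpmul2r.
Qed.

Lemma lux_normZ (g : T -> \bar R) (c : R) : (0 < c)%R -> (forall x, 0 <= g x) ->
  lux_norm mu p (fun x => c%:E * g x) <= c%:E * lux_norm mu p g.
Proof.
move=> c0 g0; rewrite -lee_pdivrMl//; apply: le_ereal_inf_tmp => _ [l [l0 gl] <-].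
rewrite lee_pdivrMl// -EFinM; apply: lux_norm_le; first by rewrite mulr_gt0.
apply: le_trans gl; rewrite le_eqVlt; apply/orP; left; apply/eqP.
apply: eq_integral => x _; congr epower.
by rewrite (muleC c%:E) -muleA -EFinM invfM mulrA mulfV ?gt_eqF// mul1r.
Qed.

End Monotone.

(** Clip the exponent to the interval from its essential infimum to its
    essential supremum. *)
Lemma finite_exponent (p : T -> \bar R) : admissible_exponent mu p ->
  exists (q : T -> R) (lo hi : R) (N : set T),
  [/\ (1 < lo)%R, (lo <= hi)%R, measurable_fun [set: T] q,
      (forall x, (lo <= q x)%R) & (forall x, (q x <= hi)%R)] /\
  [/\ measurable N, mu N = 0 & forall x, ~ N x -> p x = (q x)%:E].
Proof.
move=> [mp p1 [i1 is_ s_]].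
have [lo loE] : exists lo, ess_inf mu p = lo%:E.
  exists (fine (ess_inf mu p)); rewrite fineK// fin_numElt (lt_trans _ i1) ?ltNyr//=.
  exact: le_lt_trans is_ s_.
have [hi hiE] : exists hi, ess_sup mu p = hi%:E.
  exists (fine (ess_sup mu p)); rewrite fineK// fin_numElt s_ andbT.
  by apply: lt_le_trans is_; rewrite (lt_trans _ i1)// ltNyr.
rewrite loE lte_fin in i1; rewrite loE hiE lee_fin in is_.
pose q x := fine (maxe lo%:E (mine hi%:E (p x))).
have qE x : q x = (Num.max lo (Num.min hi (fine (p x)))) \/ q x = hi.
  rewrite /q; case: (p x) (p1 x) => [r| |]//= _; first by left; rewrite -EFin_min -EFin_max.
  by right; rewrite min_l ?leey// -EFin_max/= max_r.
have [N [mN N0 hN]] := ess_inf_le mu p.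
have [N' [mN' N'0 hN']] := ess_sup_ge mu p.
exists q, lo, hi, (N `|` N'); split.
  split => //.
  - apply: measurableT_comp; first exact: fine_measurable.
    by apply: measurable_maxe => //; exact: measurable_mine.
  - by move=> x; have [->|->//] := qE x; rewrite le_max lexx.
  - move=> x; have [->|->//] := qE x.
    by rewrite ge_max is_ ge_min lexx.
split; [exact: measurableU|exact: null_set_setU|].
move=> x nN; have lx : lo%:E <= p x.
  by apply: contrapT => nl; apply: nN; left; apply: hN; rewrite /= loE.
have hx : p x <= hi%:E.
  by apply: contrapT => nl; apply: nN; right; apply: hN'; rewrite /= hiE.
rewrite /q; case: (p x) lx hx => [r| |]//=; rewrite !lee_fin => lr rh.
by rewrite -EFin_min -EFin_max /= min_r// max_r.
Qed.

Section Modular.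
Variables (p : T -> \bar R) (q : T -> R) (N : set T).
Hypotheses (mq : measurable_fun [set: T] q) (mN : measurable N) (N0 : mu N = 0)
  (pq : forall x, ~ N x -> p x = (q x)%:E).

Lemma modular_of_epower (h : T -> R) (g : T -> \bar R) : nnm h ->
  (forall x, (h x)%:E <= g x) -> (forall x, 1 <= p x) ->
  integ mu [set: T] (fun x => h x `^ q x)%R <= \int[mu]_x epower (g x) (p x).
Proof.
move=> hh hg p1.
have hq : nnm (fun x => h x `^ q x)%R.
  by apply: nnm_powR => //; exact: nnm_meas.
have mCN := measurableC mN.
have -> : integ mu [set: T] (fun x => h x `^ q x)%R =
    integ mu [set: T] (fun x => h x `^ q x * \1_(~` N) x)%R.
  rewrite !integE; apply: ge0_ae_eq_integral => //.
  - exact: nnm_emeas.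
  - by apply: nnm_emeas; apply: nnmM => //; exact: nnm_indic.
  - by move=> x _; rewrite lee_fin powR_ge0.
  - by move=> x _; rewrite lee_fin mulr_ge0 ?powR_ge0.
  exists N; split => // x /= nh; apply: contrapT => nN; apply: nh => _.
  by rewrite indicE mem_set// mulr1.
rewrite integE; apply: le_integral_ge0 => x.
  by rewrite lee_fin mulr_ge0 ?powR_ge0.
rewrite indicE; have [Nx|nN] := pselect (N x).
  by rewrite memNset ?mulr0 ?epower_ge0// => /(_ Nx).
rewrite mem_set// mulr1; apply: (@le_trans _ _ (epower (h x)%:E (p x))).
  by rewrite pq//= poweR_EFin.
by apply: le_epower => //; rewrite lee_fin nnm_ge0.
Qed.

Lemma epower_of_modular (h : T -> R) : nnm h -> (forall x, 1 <= p x) ->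
  \int[mu]_x epower (h x)%:E (p x) <=
  integ mu [set: T] (fun x => h x `^ q x)%R.
Proof.
move=> hh p1.
have hq : nnm (fun x => h x `^ q x)%R.
  by apply: nnm_powR => //; exact: nnm_meas.
rewrite integE; apply: (le_integral_off_null (N := N)) => //.
- by move=> x; exact: epower_ge0.
- by move=> x; rewrite lee_fin powR_ge0.
- exact: nnm_emeas.
by move=> x nN; rewrite pq//= poweR_EFin.
Qed.

End Modular.

End Luxemburg.

(** * Averaging operators and the maximal operator *)

Section Averaging.
Context {R : realType} {d : measure_display} {T : measurableType d}.
Variable mu : {measure set T -> \bar R}.

Definition modulus (f : T -> R[i]) (x : T) : R := ComplexField.Normc.normc (f x).

Lemma nnm_modulus f : measurable_cfun f -> nnm (modulus f).
Proof.
move=> [mr mi]; apply/nnmP; split; last first.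
  by move=> x; rewrite /modulus; case: (f x) => a b; exact: sqrtr_ge0.
rewrite (_ : modulus f = (fun x => Num.sqrt (complex.Re (f x) ^+ 2 + complex.Im (f x) ^+ 2))).
  apply: (measurableT_comp (continuous_measurable_fun (@sqrt_continuous R))).
  by apply: measurable_funD; apply: measurable_funX.
by apply/funext => x; rewrite /modulus; case: (f x).
Qed.

Lemma modulus_real (a : T -> R) : (forall x, 0 <= a x) ->
  modulus (fun x => Complex (a x) 0) = a.
Proof.
by move=> a0; apply/funext => x; rewrite /modulus/= expr0n addr0 sqrtr_sqr ger0_norm.
Qed.

Lemma averageE f Q m : mu Q = m%:E -> 0 < m ->
  average mu f Q = ((m^-1)%:E * integ mu Q (modulus f))%E.
Proof. by move=> mE m0; rewrite /average mE inver gt_eqF// integE. Qed.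

Lemma averaging_in F Q f x : trivIset F id -> F Q -> Q x ->
  (0 <= average mu f Q)%E -> averaging mu F f x = average mu f Q.
Proof.
move=> tF FQ Qx a0.
have E : average mu f Q = (average mu f Q * (\1_Q x)%:E)%E.
  by rewrite indicE mem_set// mule1.
rewrite /averaging [RHS]E -(@esum_set1 _ _ Q (fun Q => average mu f Q * (\1_Q x)%:E)%E).
  rewrite esum_mkcond [RHS]esum_mkcond; apply: eq_esum => P _.
  have [->|PQ] := eqVneq P Q; first by rewrite !mem_set.
  rewrite [in RHS]memNset; last by move=> /= /eqP; rewrite (negbTE PQ).
  case: ifPn => // /set_mem FP; rewrite indicE memNset ?mule0// => Px.
  move/eqP: PQ; apply; apply: tF => //; by exists x.
by rewrite -E.
Qed.

Lemma averaging_out F f x : ~ union F x -> averaging mu F f x = 0%E.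
Proof.
move=> nF; apply: esum1 => Q FQ; rewrite indicE memNset ?mule0// => Qx.
by apply: nF; exists Q.
Qed.

End Averaging.

Section DyadicLevels.
Context {R : realType}.

Lemma dyadic_level (a : R) : 0 < a -> exists n,
  (2 ^+ n < a <= 2 * 2 ^+ n) \/ (2^-1 ^+ n.+1 < a <= 2 * 2^-1 ^+ n.+1).
Proof.
move=> a0; have h0 : 0 < 2^-1 :> R by rewrite invr_gt0.
have [a1|a1] := ltP 1 a.
  have ex : exists n, a <= 2 ^+ n.+1.
    exists (Num.truncn a); apply: (le_trans (ltW (truncnS_gt _))).
    by rewrite -natrX ler_nat ltnW// ltn_expl.
  have [n an min] := ex_minnP ex.
  exists n; left; rewrite -exprS an andbT.
  case: n {an} min => [|n] min; first by rewrite expr0.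
  by rewrite ltNge; apply/negP => /min; rewrite ltnn.
have ex : exists n, 2^-1 ^+ n.+1 < a.
  exists (Num.truncn a^-1); rewrite exprVn -[ltRHS]invrK ltf_pV2 ?posrE ?invr_gt0 ?exprn_gt0//.
  apply: (lt_le_trans (truncnS_gt _)).
  by rewrite -natrX ler_nat ltnW// ltn_expl.
have [n an min] := ex_minnP ex.
exists n; right; rewrite an/= exprS mulrA mulfV ?gt_eqF// mul1r.
case: n {an} min => [|n] min; first by rewrite expr0.
by rewrite leNgt; apply/negP => /min; rewrite ltnn.
Qed.

End DyadicLevels.

Section Equivalence.
Context {R : realType} {d : measure_display} {T : measurableType d}.
Variables (rho : T -> T -> R) (mu : {measure set T -> \bar R}).
Hypotheses (hX : homogeneous_space rho mu) (hreg : borel_semiregular rho mu).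
Variables (K : nat) (D : 'I_K -> int -> set (set T)) (eps eta r0 R0 : R).
Hypothesis hD : HK_dyadic_system rho mu D eps eta r0 R0.
Implicit Types f : T -> R[i].

Lemma ball_real B : is_qball rho B ->
  measurable B /\ exists2 m : R, 0 < m & mu B = m%:E.
Proof.
move=> [x [r rp ->]]; split; first exact: (ball_measurable hX).
have B0 := ball_gt0 hX x rp; have Bf := ball_fin hX x rp.
have E : mu (qball rho x r) = (fine (mu (qball rho x r)))%:E.
  by rewrite fineK// ge0_fin_numE// ltW.
by exists (fine (mu (qball rho x r))) => //; rewrite -lte_fin -E.
Qed.

Lemma maximal_ge0 f x : measurable_cfun f -> (0 <= maximal rho mu f x)%E.
Proof.
move=> mf; have Bx : is_qball rho (qball rho x 1) by exists x, 1.
have [_ [m m0 mE]] := ball_real Bx.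
apply: (@le_trans _ _ (average mu f (qball rho x 1))).
  rewrite (averageE f mE m0) mule_ge0 ?lee_fin ?invr_ge0 ?(ltW m0)//.
  by apply: integ_ge0; exact: nnm_modulus.
apply: ereal_sup_ubound; exists (qball rho x 1) => //; split => //.
by rewrite /qball/= (qm_eq0 (hs_quasi_metric hX) x x).2.
Qed.

Lemma average_cube_ge0 t Q f : cube (D t) Q -> measurable_cfun f ->
  (0 <= average mu f Q)%E.
Proof.
move=> cQ mf; have [m m0 mE] := cube_measure (HK_grid hX hD _) cQ.
rewrite (averageE f mE m0) mule_ge0 ?lee_fin ?invr_ge0 ?(ltW m0)//.
by apply: integ_ge0; exact: nnm_modulus.
Qed.

Lemma averaging_ge0 F f x : F `<=` cubes D -> measurable_cfun f ->
  (0 <= averaging mu F f x)%E.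
Proof.
move=> FD mf; apply: esum_ge0 => Q /FD[t [k DQ]].
by rewrite mule_ge0 ?lee_fin// (@average_cube_ge0 t)//; exists k.
Qed.

(** A cube lies in a ball of comparable measure. *)
Lemma averaging_le_maximal : exists2 C : R, 0 < C & forall F f x,
  F `<=` cubes D -> trivIset F id -> measurable_cfun f ->
  (averaging mu F f x <= C%:E * maximal rho mu f x)%E.
Proof.
have [C C0 hC] := cube_ball hX hD; exists C => // F f x FD tF mf.
have hf := nnm_modulus mf.
have [[Q FQ Qx]|nF] := pselect (union F x); last first.
  rewrite averaging_out// mule_ge0 ?maximal_ge0// lee_fin; exact: ltW.
have [t [k DQ]] := FD _ FQ; have cQ : cube (D t) Q by exists k.
rewrite (averaging_in tF FQ Qx); last exact: (@average_cube_ge0 t).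
have [B [bB QB BQ]] := hC _ _ _ DQ.
have [mB [b b0 bE]] := ball_real bB; have [m m0 mE] := cube_measure (HK_grid hX hD _) cQ.
have mQ := grid_measurable (HK_grid hX hD t) cQ.
apply: (@le_trans _ _ (C%:E * average mu f B)%E); last first.
  apply: lee_wpmul2l; first by rewrite lee_fin ltW.
  by apply: ereal_sup_ubound; exists B => //; split => //; exact: QB.
rewrite (averageE f mE m0) (averageE f bE b0) muleA -EFinM.
have QI := subset_integ mu mQ mB hf QB; have I0 := integ_ge0 mu Q hf.
apply: lee_pmul => //; first by rewrite lee_fin invr_ge0 ltW.
rewrite bE mE -EFinM lee_fin in BQ; rewrite lee_fin.
by rewrite ler_pdivlMr// mulrC ler_pdivrMr.
Qed.

End Equivalence.

Section FiniteSums.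
Context {R : realType} {d : measure_display} {T : measurableType d}.
Variable mu : {measure set T -> \bar R}.

Lemma nnm_sum (I : Type) (s : seq I) (h : I -> T -> R) : (forall i, nnm (h i)) ->
  nnm (fun x => \sum_(i <- s) h i x).
Proof.
move=> hh; apply/nnmP; split; first by apply: measurable_sum => i; exact: nnm_meas.
by move=> x; apply: sumr_ge0 => i _; exact: nnm_ge0.
Qed.

Lemma integ_sum (I : Type) (s : seq I) A (h : I -> T -> R) : measurable A ->
  (forall i, nnm (h i)) ->
  integ mu A (fun x => \sum_(i <- s) h i x)%R = (\sum_(i <- s) integ mu A (h i))%E.
Proof.
move=> mA hh; elim: s => [|i s IH].
  by rewrite big_nil -[RHS](mul0e (mu A)) -integ_cst//; apply: eq_integ => x _; rewrite big_nil.
rewrite big_cons -IH -(integD mu mA (hh i) (nnm_sum s hh)).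
by apply: eq_integ => x _; rewrite big_cons.
Qed.

End FiniteSums.

Section Converse.
Context {R : realType} {d : measure_display} {T : measurableType d}.
Variables (rho : T -> T -> R) (mu : {measure set T -> \bar R}).
Hypotheses (hX : homogeneous_space rho mu) (hreg : borel_semiregular rho mu).
Variables (K : nat) (D : 'I_K -> int -> set (set T)) (eps eta r0 R0 : R).
Hypothesis hD : HK_dyadic_system rho mu D eps eta r0 R0.
Variables (p : T -> \bar R) (q : T -> R) (lo hi : R) (N : set T).
Hypotheses (p1 : forall x, (1 <= p x)%E) (lo1 : 1 < lo) (lohi : lo <= hi)
  (mq : measurable_fun [set: T] q) (loq : forall x, lo <= q x)
  (qhi : forall x, q x <= hi) (mN : measurable N) (N0 : mu N = 0%E)
  (pq : forall x, ~ N x -> p x = (q x)%:E).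
Implicit Types f : T -> R[i].

Let q1 x : 1 < q x. Proof. exact: lt_le_trans (loq x). Qed.
Let q0 x : 0 < q x. Proof. by apply: lt_trans (q1 x). Qed.
Let gD t : grid mu (D t) eps. Proof. exact (HK_grid hX hD t). Qed.

(** Test the norm inequality with [g] restricted to the union of the cubes.
    The averages have norm less than [C + 1], so their modular is at most [1]
    after division by [C + 1]. *)
Lemma averaging_bounded_of_norm (C : R) : 0 < C ->
  (forall F : set (set T), F `<=` cubes D -> trivIset F id ->
    forall f, in_Lp mu p f ->
    (lux_norm mu p (averaging mu F f) <= C%:E * lux_norm mu p (cabs f))%E) ->
  forall t, averaging_bounded mu (D t) q ((C + 1) `^ hi).
Proof.
move=> C0 HC t F g v pF hg hv g1 vg.
have fF := packing_family (gD t) pF; have mU := measurable_union fF.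
have C1 : 1 <= C + 1 by rewrite lerDr ltW.
have C10 : 0 < C + 1 by apply: lt_le_trans C1.
have FD : F `<=` cubes D by move=> Q /pF.1[k DQ]; exists t, k.
have tF : trivIset F id.
  by move=> Q Q' FQ FQ' [x [Qx Q'x]]; exact: pF.2 Qx Q'x.
have hu := nnm_indic (R := R) mU.
have [a aE] : exists a : T -> R, a = (fun x => g x * \1_(union F) x) by eexists.
have ha : nnm a by rewrite aE; exact: nnmM.
have [f fE] : exists f : T -> R[i], f = (fun x => Complex (a x) 0) by eexists.
have fa : modulus f = a.
  by rewrite fE modulus_real// => x; exact: nnm_ge0.
have cf : cabs f = EFin \o a by rewrite -fa.
have mf : measurable_cfun f.
  by rewrite fE; split => /=; [exact: nnm_meas|exact: measurable_cst].
have nf : (lux_norm mu p (cabs f) <= 1)%E.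
  apply: lux_norm_le => //; rewrite cf.
  rewrite (eq_integral (fun x => epower (a x)%:E (p x))); last first.
    by move=> x _; rewrite /= invr1 mule1.
  apply: le_trans (epower_of_modular mq mN N0 pq ha p1) _.
  apply: le_trans g1.
  rewrite -[union F]setTI -integ_indic//.
  apply: le_integ => //; [exact: nnm_pow|by apply: nnmM => //; exact: nnm_pow|].
  move=> x _; rewrite aE indicE; case: (x \in _); rewrite ?mulr1 ?mulr0//.
  by rewrite powR0// gt_eqF.
have Lf : in_Lp mu p f by split => //; apply: le_lt_trans nf _; rewrite ltry.
have lA : (lux_norm mu p (averaging mu F f) < (C + 1)%:E)%E.
  apply: le_lt_trans (HC F FD tF f Lf) _.
  apply: (@le_lt_trans _ _ (C%:E * 1)%E).
    by apply: lee_wpmul2l => //; rewrite lee_fin ltW.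
  by rewrite mule1 lte_fin ltrDl.
have A0 x : (0 <= averaging mu F f x)%E by exact: (averaging_ge0 hX hD).
have [_ IA] := lux_norm_lt p1 A0 lA.
have [h hE] : exists h : T -> R, h = (fun x => (C + 1)^-1 * (v x * \1_(union F) x)).
  by eexists.
have Ci0 : 0 <= (C + 1)^-1 by rewrite invr_ge0 ltW.
have hh : nnm h by rewrite hE; apply: nnmZ => //; exact: nnmM.
have hA x : ((h x)%:E <= averaging mu F f x * ((C + 1)^-1)%:E)%E.
  rewrite hE indicE; have [Ux|nU] := pselect (union F x); last first.
    by rewrite memNset// !mulr0 mule_ge0// lee_fin.
  rewrite mem_set// mulr1 EFinM muleC; apply: lee_wpmul2r; first by rewrite lee_fin.
  have [Q FQ Qx] := Ux; have cQ := pF.1 _ FQ; have [m m0 mE] := cube_measure (gD t) cQ.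
  rewrite (averaging_in tF FQ Qx); last exact: (average_cube_ge0 hX hD cQ).
  rewrite (averageE f mE m0) fa lee_pdivlMl//.
  rewrite (@eq_integ _ _ _ mu _ a g); first by rewrite muleC -mE; exact: vg Qx.
  by move=> y Qy; rewrite aE indicE mem_set ?mulr1//; exists Q.
have I1 := le_trans (modular_of_epower mq mN N0 pq hh hA p1) IA.
have hvq : nnm (fun x => v x `^ q x) by exact: nnm_pow.
have hhq : nnm (fun x => h x `^ q x) by exact: nnm_pow.
have Ch0 : 0 <= (C + 1) `^ hi by exact: powR_ge0.
apply: (@le_trans _ _ (integ mu (union F) (fun x => (C + 1) `^ hi * h x `^ q x))).
  apply: (le_integ mu mU hvq (nnmZ Ch0 hhq)) => x Ux.
  have -> : v x = (C + 1) * h x.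
    by rewrite hE indicE mem_set// mulr1 mulrA mulfV ?gt_eqF// mul1r.
  rewrite powRM ?(ltW C10)//; last exact: nnm_ge0.
  by apply: ler_wpM2r; [exact: powR_ge0|exact: ler_powR].
rewrite (integZ mu mU Ch0 hhq) -[leRHS]mule1; apply: lee_wpmul2l; first by rewrite lee_fin.
by apply: le_trans I1; exact: (subset_integ mu mU measurableT hhq (@subsetT _ _)).
Qed.

Lemma level_sum_nondecreasing t (g : T -> R) x :
  {homo (fun n => level_sum mu (D t) q g n x) : n m / (n <= m)%N >-> n <= m}.
Proof.
apply: homo_leq => [y|y z w|n]; [exact: lexx|exact: le_trans|].
by rewrite /level_sum big_ord_recr/= lerDl addr_ge0// mulr_ge0// powR_ge0.
Qed.

Definition all_levels (g : T -> R) (x : T) : \bar R :=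
  ereal_sup (range (fun n => (\sum_t level_sum mu (D t) q g n x)%:E)).

Let S (g : T -> R) n x := \sum_t level_sum mu (D t) q g n x.

Let nnm_S g n : nnm g -> nnm (S g n).
Proof.
move=> hg; apply: nnm_sum => t; exact: (nnm_level_sum (gD t) mq).
Qed.

Let S_homo g x : {homo (fun n => (S g n x)%:E) : n m / (n <= m)%N >-> (n <= m)%E}.
Proof.
by move=> n m nm; rewrite lee_fin; apply: ler_sum => t _; exact: level_sum_nondecreasing.
Qed.

Let S_cvg g x : ((S g n x)%:E @[n --> \oo] --> all_levels g x)%classic.
Proof. exact: ereal_nondecreasing_cvgn (@S_homo g x). Qed.

Lemma all_levels_ge0 g x : nnm g -> (0 <= all_levels g x)%E.
Proof.
move=> hg; apply: (@le_trans _ _ (S g 0 x)%:E).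
  by rewrite lee_fin; exact: nnm_ge0 (nnm_S 0 hg).
by apply: ereal_sup_ubound; exists 0%N.
Qed.

Lemma measurable_all_levels g : nnm g -> measurable_fun [set: T] (all_levels g).
Proof.
move=> hg; apply: (@emeasurable_fun_cvg _ _ _ _ (fun n x => (S g n x)%:E)) => [n|x _].
  exact: nnm_emeas (nnm_S n hg).
exact: S_cvg.
Qed.

Lemma all_levels_bound (C : R) : 1 <= C ->
  (forall t, averaging_bounded mu (D t) q C) ->
  exists2 C' : R, 1 <= C' & forall g, nnm g ->
    (integ mu setT (fun x => (2 * g x) `^ q x)%R <= 1)%E ->
    (\int[mu]_x all_levels g x <= C'%:E)%E.
Proof.
move=> C1 HA; have /choice[c hc] : forall t, exists C' : R, 1 <= C' /\
    forall g n, nnm g -> (integ mu setT (fun x => (2 * g x) `^ q x)%R <= 1)%E ->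
    (integ mu setT (level_sum mu (D t) q g n) <= C'%:E)%E.
  move=> t; have dD := HK_differentiates hX hD (t := t) hreg.
  exact: (level_sum_bound (gD t) dD mq lo1 lohi loq qhi C1 (HA t)).
exists (1 + \sum_t c t).
  by rewrite lerDl sumr_ge0// => t _; apply: le_trans (hc t).1.
move=> g hg g1.
have bS n : (integ mu setT (S g n) <= (1 + \sum_t c t)%:E)%E.
  rewrite /S integ_sum//; last by move=> t; exact: (nnm_level_sum (gD t) mq).
  apply: (@le_trans _ _ (\sum_t (c t)%:E)%E).
    by apply: lee_sum => t _; exact: (hc t).2.
  by rewrite sumEFin lee_fin lerDr.
have -> : (\int[mu]_x all_levels g x = \int[mu]_x limn (fun n => (S g n x)%:E))%E.
  by apply: eq_integral => x _; apply/esym/cvg_lim => //; exact: S_cvg.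
rewrite monotone_convergence//.
- apply: lime_le.
    apply: ereal_nondecreasing_is_cvgn => n m nm.
    rewrite -!integE; apply: le_integ => //; try exact: nnm_S.
    by move=> x _; rewrite -lee_fin; exact: S_homo.
  by apply: nearW => n; rewrite -integE.
- by move=> n; exact: nnm_emeas (nnm_S n hg).
- by move=> n x _; rewrite lee_fin; exact: nnm_ge0 (nnm_S n hg).
Qed.

(** A ball lies in a cube of comparable measure. If [s] is the dyadic number
    with [s < a <= 2 * s], where [a] is the mean over this cube, then the level
    [s] contributes [s `^ q x] to the sum over all levels at [x]. *)
Lemma average_le_all_levels : exists2 C : R, 0 < C &
  forall f (l : R) B x w, measurable_cfun f -> 0 < l -> is_qball rho B -> B x ->
    (integ mu setT (fun y => (2 * (modulus f y / (2 * l))) `^ q y)%R <= 1)%E ->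
    all_levels (fun y => modulus f y / (2 * l)) x = w%:E ->
    (average mu f B <= (C * l * w `^ (q x)^-1)%:E)%E.
Proof.
have [C hC] := hk_ball hD.
exists (4 * Num.max C 1); first by rewrite mulr_gt0// lt_max ltr01 orbT.
move=> f l B x w mf l0 bB Bx g1 wE.
have hf := nnm_modulus mf.
have [mB [b b0 bE]] := ball_real hX bB.
have [t [k [Q DQ [BQ QB]]]] := hC B bB; have cQ : cube (D t) Q by exists k.
have [m m0 mE] := cube_measure (gD t) cQ; have mQ := grid_measurable (gD t) cQ.
have [M ME] : exists M, M = Num.max C 1 by eexists.
have M0 : 0 < M by rewrite ME lt_max ltr01 orbT.
rewrite -ME; have mb : m <= M * b.
  rewrite bE mE -EFinM lee_fin in QB; apply: (le_trans QB).
  by rewrite ler_pM2r// ME le_max lexx.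
have [g gE] : exists g : T -> R, g = (fun y => modulus f y / (2 * l)) by eexists.
have l20 : 0 < 2 * l by rewrite mulr_gt0.
have hg : nnm g.
  rewrite gE (_ : (fun _ => _) = fun y => (2 * l)^-1 * modulus f y).
    by apply: nnmZ => //; rewrite invr_ge0 ltW.
  by apply/funext => y; rewrite mulrC.
have fg : modulus f = fun y => 2 * l * g y.
  by apply/funext => y; rewrite gE mulrC divfK// gt_eqF.
rewrite -gE in wE.
have w0 : 0 <= w by rewrite -lee_fin -wE; exact: all_levels_ge0.
have gq : (integ mu setT (fun y => g y `^ q y)%R <= 1)%E.
  have g2 : (integ mu setT (fun y => (2 * g y) `^ q y)%R <= 1)%E by rewrite gE.
  apply: le_trans g2; apply: le_integ => //; try exact: nnm_pow.
    by apply: nnm_pow => //; exact: nnmZ.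
  move=> y _; have gy := nnm_ge0 y hg; apply: powR_le_base => //; first exact: ltW.
  by rewrite ler_peMl// ler1n.
have gf : (integ mu Q g < +oo)%E.
  apply: (integ_fin_of_pow (gD t) mq lo1 loq cQ hg).
  apply: le_lt_trans (ltry 1); apply: le_trans gq.
  by apply: subset_integ => //; exact: nnm_pow.
have aE := cube_avgE (gD t) cQ hg gf.
have a0 := avg_ge0 mu Q hg.
apply: (@le_trans _ _ (M * (2 * l) * avg mu Q g)%:E).
  rewrite (averageE f bE b0) lee_pdivrMl//.
  apply: (le_trans (subset_integ mu mB mQ hf BQ)).
  rewrite fg (integZ mu mQ (ltW l20) hg) -aE mE -!EFinM lee_fin.
  have -> : b * (M * (2 * l) * avg mu Q g) = 2 * l * (avg mu Q g * (M * b)) by ring.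
  by rewrite ler_pM2l//; apply: ler_wpM2l.
have [z|an0] := eqVneq (avg mu Q g) 0.
  by rewrite z mulr0 lee_fin !mulr_ge0 ?powR_ge0// ltW.
have ap : 0 < avg mu Q g by rewrite lt_neqAle eq_sym an0.
suff : avg mu Q g <= 2 * w `^ (q x)^-1.
  move=> H; rewrite lee_fin.
  have -> : 4 * M * l * w `^ (q x)^-1 = M * (2 * l) * (2 * w `^ (q x)^-1) by ring.
  by rewrite ler_pM2l// mulr_gt0.
have lev s : 0 < s -> s < avg mu Q g -> superlevel mu (D t) g s x.
  move=> s0 sa; exists Q; split => //; first exact: BQ.
  by rewrite -aE mE -!EFinM lte_fin ltr_pM2r.
have ind1 s : 0 < s -> s < avg mu Q g -> \1_(superlevel mu (D t) g s) x = 1 :> R.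
  by move=> s0 sa; rewrite indicE mem_set//; exact: lev.
have Sw n : S g n x <= w.
  by rewrite -lee_fin -wE; apply: ereal_sup_ubound; exists n.
have tS n : level_sum mu (D t) q g n x <= S g n x.
  rewrite /S (bigD1 t)//= lerDl sumr_ge0// => u _.
  exact: nnm_ge0 (nnm_level_sum (gD u) mq n hg).
have root s : 0 <= s -> s `^ q x <= w -> s <= w `^ (q x)^-1.
  move=> s0 sw; rewrite -[leLHS](powR_Kroot (q := q x))//.
  by apply: powR_le_base => //; rewrite ?powR_ge0// invr_ge0 ltW.
have term n : (2 ^+ n) `^ q x * \1_(superlevel mu (D t) g (2 ^+ n)) x +
    (2^-1 ^+ n.+1) `^ q x * \1_(superlevel mu (D t) g (2^-1 ^+ n.+1)) x <= w.
  apply: le_trans (Sw n.+1); apply: le_trans (tS n.+1).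
  rewrite /level_sum big_ord_recr/= lerDr.
  exact: nnm_ge0 (nnm_level_sum (gD t) mq n hg).
have [n [/andP[na an]|/andP[na an]]] := dyadic_level ap; apply: (le_trans an);
  rewrite ler_pM2l//; apply: root; rewrite ?exprn_ge0 ?invr_ge0//;
  apply: le_trans (term n).
- rewrite (ind1 (2 ^+ n))// ?exprn_gt0// mulr1 lerDl mulr_ge0// powR_ge0//.
- rewrite (ind1 (2^-1 ^+ n.+1))// ?exprn_gt0// ?invr_gt0// mulr1 lerDr.
  by rewrite mulr_ge0// powR_ge0.
Qed.

(** After division by [2 * l] the modular of [f] meets the requirement of the
    level estimates. The constant [K1] that bounds the integral of all levels
    passes into the norm because the exponent is at least [1]. *)
Lemma maximal_norm_lt (C : R) : 1 <= C ->
  (forall t, averaging_bounded mu (D t) q C) ->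
  exists2 C' : R, 0 < C' & forall f (l : R), measurable_cfun f ->
    (lux_norm mu p (cabs f) < l%:E)%E ->
    (lux_norm mu p (maximal rho mu f) <= (C' * l)%:E)%E.
Proof.
move=> C1 HA; have [K1 K11 hK] := all_levels_bound C1 HA.
have [M M0 hM] := average_le_all_levels.
have K10 : 0 < K1 by exact: lt_le_trans K11.
exists (K1 * M); first exact: mulr_gt0.
move=> f l mf fl.
have hf := nnm_modulus mf.
have [l0 fl1] : 0 < l /\ (\int[mu]_x epower (cabs f x * (l^-1)%:E) (p x) <= 1)%E.
  apply: (lux_norm_lt p1 _ fl) => x.
  by rewrite lee_fin; exact: nnm_ge0 x hf.
have [g gE] : exists g : T -> R, g = (fun y => modulus f y / (2 * l)) by eexists.
have l20 : 0 < 2 * l by rewrite mulr_gt0.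
have hg : nnm g.
  rewrite gE (_ : (fun _ => _) = fun y => (2 * l)^-1 * modulus f y).
    by apply: nnmZ => //; rewrite invr_ge0 ltW.
  by apply/funext => y; rewrite mulrC.
have g2E y : 2 * g y = modulus f y * l^-1.
  by rewrite gE invfM; field; rewrite gt_eqF.
have g1 : (integ mu setT (fun x => (2 * g x) `^ q x)%R <= 1)%E.
  apply: le_trans fl1; apply: (modular_of_epower mq mN N0 pq) => //.
    by apply: nnmZ.
  by move=> x; rewrite g2E EFinM.
have IW := hK g hg g1.
have W0 x := all_levels_ge0 x hg; have mW := measurable_all_levels hg.
have c0 : 0 < K1 * M * l by rewrite !mulr_gt0.
have ci0 : (0 <= ((K1 * M * l)^-1)%:E :> \bar R)%E by rewrite lee_fin invr_ge0 ltW.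
apply: lux_norm_le => //.
have Ki0 : (0 <= (K1^-1)%:E :> \bar R)%E by rewrite lee_fin invr_ge0 ltW.
apply: (@le_trans _ _ (\int[mu]_x ((K1^-1)%:E * all_levels g x))%E); last first.
  rewrite ge0_integralZl//.
  by rewrite lee_pdivrMl// mule1.
apply: (le_integral_off_null (N := N)) => //.
- by move=> x; exact: epower_ge0.
- by move=> x; exact: mule_ge0.
- exact: measurable_funeM.
move=> x nN; rewrite pq//.
case wE : (all_levels g x) (W0 x) => [w| |]// w0; last first.
  by rewrite gt0_muley ?lte_fin ?invr_gt0// leey.
rewrite lee_fin in w0.
have Mx : (maximal rho mu f x <= (M * l * w `^ (q x)^-1)%:E)%E.
  apply: ge_ereal_sup => _ [B [bB Bx] <-].
  by apply: hM => //; move: g1 wE; rewrite gE.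
apply: (@le_trans _ _ (epower (w `^ (q x)^-1 / K1)%:E (q x)%:E)).
  apply: le_epower.
  - by rewrite mule_ge0// (maximal_ge0 hX).
  - apply: (@le_trans _ _ ((M * l * w `^ (q x)^-1)%:E * ((K1 * M * l)^-1)%:E)%E).
      exact: lee_wpmul2r.
    rewrite -EFinM lee_fin le_eqVlt; apply/orP; left; apply/eqP.
    by field; rewrite !gt_eqF.
  - by rewrite lee_fin ltW.
rewrite /= -EFinM lee_fin powRM ?powR_ge0 ?invr_ge0 ?(ltW K10)//.
rewrite powR_rootK// mulrC; apply: ler_wpM2r => //.
rewrite -[leRHS]powRr1 ?invr_ge0 ?(ltW K10)//.
by apply: powR_exp_le1; rewrite ?invr_ge0 ?invf_le1 ?ltr01// ltW.
Qed.

End Converse.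

Theorem theorem1p2 (R : realType) (d : measure_display) (T : measurableType d)
  (rho : T -> T -> R) (mu : {measure set T -> \bar R})
  (hX : homogeneous_space rho mu) (hunb : unbounded_space mu)
  (hreg : borel_semiregular rho mu)
  (K : nat) (D : 'I_K -> int -> set (set T)) (eps eta r0 R0 : R)
  (hD : HK_dyadic_system rho mu D eps eta r0 R0)
  (p : T -> \bar R) (hp : admissible_exponent mu p) :
  maximal_bounded rho mu p <->
  exists2 C : R, 0 < C &
    forall F : set (set T), F `<=` cubes D -> trivIset F id ->
    forall f : T -> R[i], in_Lp mu p f ->
      (lux_norm mu p (averaging mu F f) <= C%:E * lux_norm mu p (cabs f))%E.
Proof.
have p1 := ae_ge1 hp; split => [[C C0 HM]|[C C0 HC]].
  have [M M0 hM] := averaging_le_maximal hX hD.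
  exists (M * C) => [|F FD tF f Lf]; first exact: mulr_gt0.
  have mf : measurable_cfun f by case: Lf.
  rewrite EFinM -muleA; apply: le_trans (lee_wpmul2l _ (HM f Lf)); last first.
    by rewrite lee_fin ltW.
  apply: (@le_trans _ _ (lux_norm mu p (fun x => M%:E * maximal rho mu f x)%E)).
    by apply: le_lux_norm => // x; [exact: (averaging_ge0 hX hD)|exact: hM].
  by apply: lux_normZ => // x; exact: (maximal_ge0 hX).
have [q [lo [hi [N [[lo1 lohi mq loq qhi] [mN N0 pq]]]]]] := finite_exponent hp.
have A1 : 1 <= (C + 1) `^ hi.
  by apply: powR_ge1; [rewrite (le_trans _ lohi)// ltW// (lt_trans ltr01)|rewrite lerDr ltW].
have HA := averaging_bounded_of_norm hX hD p1 lo1 mq loq qhi mN N0 pq C0 HC.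
have [M M0 hM] := maximal_norm_lt hX hreg hD p1 lo1 lohi mq loq qhi mN N0 pq A1 HA.
exists M => // f [mf Lf].
have [L LE] : exists L, lux_norm mu p (cabs f) = L%:E.
  exists (fine (lux_norm mu p (cabs f))); rewrite fineK// ge0_fin_numE//.
  by apply: le_ereal_inf_tmp => _ [l [l0 _] <-]; rewrite lee_fin ltW.
rewrite LE; apply/lee_addgt0Pr => e e0.
have -> : (M%:E * L%:E + e%:E = (M * (L + e / M))%:E)%E.
  by rewrite -EFinM -EFinD mulrDr mulrCA mulfV ?gt_eqF// mulr1.
by apply: hM => //; rewrite LE lte_fin ltrDl divr_gt0.
Qed.
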